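(* Let $F\subset\mathbb{R}^d$ be a bounded set whose affine hull has dimension $1$. Then $$s_0^1(F)=s_0^2(F)=\dots=s_0^d(F).$$
   Context: For $F\subset\mathbb{R}^d$ with $\dim\mathrm{aff}\,F=1$ and $l\in\{1,\dots,d\}$, choose any $l$-dimensional affine subspace of $\mathbb{R}^d$ containing $F$ and identify it isometrically with $\mathbb{R}^l$; $F_\varepsilon^l$ denotes the closed parallel set $\{y:\mathrm{dist}(y,F)\le\varepsilon\}$ taken in this $\mathbb{R}^l$ (independent of the choice up to isometry). **Curvature measure $C_0$.** For a closed set $X\subset\mathbb{R}^l$ of positive reach (Federer) let $\mathrm{nor}\,X=\{(x,n): x\in\partial X,\ n\in S^{l-1}\cap\mathrm{Nor}(X,x)\}$, $\mathrm{Nor}(X,x)$ being the polar cone of the tangent cone of $X$ at $x$. For $\mathcal H^{l-1}$-a.e. $(x,n)\in\mathrm{nor}\,X$ there are generalized principal curvatures $\kappa_i(x,n)\in(-\infty,\infty]$ and orthonormal principal directions $a_i(x,n)$, $i=1,\dots,l-1$, such that the vectors $\left(\frac{a_i}{\sqrt{1+\kappa_i^2}},\frac{\kappa_ia_i}{\sqrt{1+\kappa_i^2}}\right)$ (equal to $(0,a_i)$ if $\kappa_i=\infty$) form an orthonormal basis of the tangent space of $\mathrm{nor}\,X$ at $(x,n)$. Put $$C_0(X,A)=\frac1{\mathcal H^{l-1}(S^{l-1})}\int_{\mathrm{nor}\,X}\mathbf 1_A(x)\prod_{i=1}^{l-1}\frac{\kappa_i(x,n)}{\sqrt{1+\kappa_i(x,n)^2}}\,d\mathcal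 H^{l-1}(x,n)$$ (a factor is $1$ if $\kappa_i=\infty$; an empty product is $1$). A value $\varepsilon>0$ is regular if the closure $\widetilde{F^l_\varepsilon}$ of the complement of $F_\varepsilon^l$ in $\mathbb{R}^l$ has positive reach and $\partial F^l_\varepsilon$ is a Lipschitz manifold; for such $\varepsilon$ put $C_0(F^l_\varepsilon,\cdot):=(-1)^{l-1}C_0(\widetilde{F^l_\varepsilon},\cdot)$ and let $C_0^{\mathrm{var}}(F^l_\varepsilon)$ be the total mass of its total variation measure. (For $l=1$ this is $\tfrac12\mathcal H^0(\partial F_\varepsilon^1)$.) For the sets $F$ considered almost all $\varepsilon>0$ are regular. **Scaling exponent.** $s_0^l(F):=\inf\{s\ge0:\ \mathrm{ess\,lim}_{\varepsilon\to0}\,\varepsilon^{s}C_0^{\mathrm{var}}(F^l_\varepsilon)=0\}$, where the essential limit means the limit after discarding a Lebesgue null set of $\varepsilon$'s. *)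

(* Defs.v *)
From HB Require Import structures.
From mathcomp Require Import all_boot all_order all_algebra.
From mathcomp Require Import all_classical all_reals all_analysis.
Set Implicit Arguments.
Unset Strict Implicit.
Unset Printing Implicit Defensive.
Import Order.TTheory GRing.Theory Num.Theory.
Import numFieldNormedType.Exports.
Local Open Scope classical_set_scope.
Local Open Scope ring_scope.

Section Euclidean.
Context {R : realType}.

Definition edot {m} (u v : 'rV[R]_m) : R := \sum_(i < m) u 0 i * v 0 i.

(* The library norm on row vectors is the maximum norm; it induces the same
   topology (open sets, closures, bounded sets) as [enorm]. *)
Definition enorm {m} (u : 'rV[R]_m) : R := Num.sqrt (edot u u).

Definition esphere {m} : set 'rV[R]_m := [set u | enorm u = 1].

(* Distance to a set, with value +oo for the empty set. *)
Definition edist {m} (y : 'rV[R]_m) (X : set 'rV[R]_m) : \bar R :=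
  ereal_inf [set (enorm (y - x))%:E | x in X].

Definition ediam {m} (X : set 'rV[R]_m) : \bar R :=
  ereal_sup [set (enorm (p.1 - p.2))%:E | p in X `*` X].

Definition boundary {T : topologicalType} (X : set T) : set T :=
  closure X `&` closure (~` X).

Definition parallel_set {m} (F : set 'rV[R]_m) (e : R) : set 'rV[R]_m :=
  [set y | (edist y F <= e%:E)%E].

Definition affine_hull {m} (F : set 'rV[R]_m) : set 'rV[R]_m :=
  [set y | exists (n : nat) (c : 'I_n -> R) (x : 'I_n -> 'rV[R]_m),
    [/\ forall i, F (x i), \sum_(i < n) c i = 1 &
        y = \sum_(i < n) c i *: x i]].

Definition is_affine_subspace {m} (k : nat) (E : set 'rV[R]_m) : Prop :=
  exists (p : 'rV[R]_m) (V : {vspace 'rV[R]_m}),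
    \dim V = k /\ E = [set p + v | v in [set` V]].

(* phi is an isometric identification of R^l with an l-dimensional affine
   subspace of R^d containing F. *)
Definition isometric_chart {l d : nat} (F : set 'rV[R]_d)
    (phi : 'rV[R]_l -> 'rV[R]_d) : Prop :=
  [/\ is_affine_subspace l (range phi), F `<=` range phi &
      forall x y, enorm (phi x - phi y) = enorm (x - y)].

End Euclidean.

Section Hausdorff.
Context {R : realType}.

(* Volume of the unit ball of R^k: w_(k+2) = 2 pi / (k+2) * w_k. *)
Fixpoint unit_ball_volume (k : nat) : R :=
  match k with
  | 0 => 1
  | 1 => 2
  | k'.+2 => 2 * pi / k'.+2%:R * unit_ball_volume k'
  end.

(* For k = 0 a nonempty set has size 1, since 0 ^+ 0 = 1. *)
Definition hausdorff_size {m} (k : nat) (U : set 'rV[R]_m) : \bar R :=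
  if U == set0 then 0%E
  else (unit_ball_volume k * (fine (ediam U) / 2) ^+ k)%:E.

Definition small_cover {m} (e : R) (A : set 'rV[R]_m) :
    set ((set 'rV[R]_m)^nat) :=
  [set U | (forall i, (ediam (U i) <= e%:E)%E) /\ A `<=` \bigcup_i U i].

Definition hausdorff_premeasure {m} (k : nat) (e : R) (A : set 'rV[R]_m) :
    \bar R :=
  ereal_inf [set (\sum_(i <oo) hausdorff_size k (U i))%E | U in small_cover e A].

(* k-dimensional Hausdorff (outer) measure for the Euclidean metric of R^m,
   normalized so that it is Lebesgue measure when m = k. *)
Definition hausdorff {m} (k : nat) (A : set 'rV[R]_m) : \bar R :=
  ereal_sup [set hausdorff_premeasure k e A | e in [set e : R | 0 < e]].

Local Open Scope ereal_scope.

Lemma enorm_ge0 m (u : 'rV[R]_m) : (0 <= enorm u)%R.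
Proof. exact: sqrtr_ge0. Qed.

Lemma unit_ball_volume_ge0 k : (0 <= unit_ball_volume k)%R.
Proof.
have : ((0 <= unit_ball_volume k) && (0 <= unit_ball_volume k.+1))%R.
  elim: k => [|k /andP[IH1 IH2]]; first by rewrite /= ler01 ler0n.
  rewrite IH2 /=; apply: mulr_ge0 => //.
  by rewrite divr_ge0// mulr_ge0// pi_ge0.
by case/andP.
Qed.

Lemma ediam_ge0 m (U : set 'rV[R]_m) : U !=set0 -> 0 <= ediam U.
Proof.
move=> [x Ux]; apply: (@le_trans _ _ (enorm (x - x))%:E).
  by rewrite lee_fin enorm_ge0.
by apply: ereal_sup_ubound; exists (x, x).
Qed.

Lemma hausdorff_size_ge0 m k (U : set 'rV[R]_m) : 0 <= hausdorff_size k U.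
Proof.
rewrite /hausdorff_size; case: ifPn => // /set0P U0.
rewrite lee_fin mulr_ge0 ?unit_ball_volume_ge0// exprn_ge0// divr_ge0//.
by rewrite fine_ge0// ediam_ge0.
Qed.

Lemma ediam0 m : ediam (set0 : set 'rV[R]_m) = -oo.
Proof.
rewrite /ediam (_ : image _ _ = set0) ?ereal_sup0//.
by apply/seteqP; split => // x [p [] []].
Qed.

Lemma hausdorff_premeasure_ge0 m k e (A : set 'rV[R]_m) :
  0 <= hausdorff_premeasure k e A.
Proof.
apply: le_ereal_inf_tmp => x [U _ <-].
by apply: nneseries_ge0 => *; exact: hausdorff_size_ge0.
Qed.

Lemma hausdorff_premeasure0 m k e :
  hausdorff_premeasure k e (set0 : set 'rV[R]_m) = 0.
Proof.
apply/eqP; rewrite eq_le hausdorff_premeasure_ge0 andbT.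
apply: ereal_inf_lbound; exists (fun=> set0).
  by split => // i; rewrite ediam0 leNye.
by apply: eseries0 => *; rewrite /hausdorff_size eqxx.
Qed.

Lemma le_hausdorff_premeasure m k e :
  {homo (@hausdorff_premeasure m k e) : A B / A `<=` B >-> A <= B}.
Proof.
move=> A B AB; apply/ereal_inf_le_tmp => x [U [dU BU] <-].
by exists U => //; split => //; exact: subset_trans AB BU.
Qed.

Lemma hausdorff_premeasure_sigma_subadditive m k e :
  sigma_subadditive (@hausdorff_premeasure m k e).
Proof.
set mu := @hausdorff_premeasure m k e.
have mu_ge0 A : 0 <= mu A by exact: hausdorff_premeasure_ge0.
move=> A; have [[i ioo]|] := pselect (exists i, mu (A i) = +oo).
  rewrite (eseries_pinfty _ _ ioo) ?leey// => n _.
  by rewrite -ltNye (lt_le_trans _ (mu_ge0 _)).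
rewrite -forallNE => Aoo.
suff add2e (t : {posnum R}) :
    mu (\bigcup_n A n) <= \sum_(i <oo) mu (A i) + t%:num%:E.
  by apply/lee_addgt0Pr => _/posnumP[].
rewrite (le_trans _ (epsilon_trick _ _ _))//.
pose P n (B : (set 'rV[R]_m)^nat) := small_cover e (A n) B /\
  \sum_(i <oo) hausdorff_size k (B i) <=
    mu (A n) + (t%:num / (2 ^ n.+1)%:R)%:E.
have [G PG] : {G : ((set 'rV[R]_m)^nat)^nat & forall n, P n (G n)}.
  apply: (@choice _ _ P) => n; rewrite /P /mu /hausdorff_premeasure.
  set S := (X in ereal_inf X); move infS : (ereal_inf S) => iS.
  case: iS infS => [r Sr|Soo|Soo].
  - have en1 : (0 < t%:num / (2 ^ n.+1)%:R)%R by [].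
    have /(lb_ereal_inf_adherent en1) : ereal_inf S \is a fin_num by rewrite Sr.
    move=> [x [B cB muBx] xS].
    by exists B; split => //; rewrite muBx -Sr; exact/ltW.
  - by have := Aoo n; rewrite /mu /hausdorff_premeasure Soo.
  - by have := mu_ge0 (A n); rewrite /mu /hausdorff_premeasure Soo.
have sG_ge0 x : 0 <= (hausdorff_size k \o uncurry G) x.
  exact: hausdorff_size_ge0.
apply: (@le_trans _ _ (\esum_(i in setT) (hausdorff_size k \o uncurry G) i)).
  apply: ereal_inf_lbound => /=.
  have /card_esym/ppcard_eqP[f] := card_nat2.
  exists (uncurry G \o f).
    split => [i /=|].
      by case: (f i) => a b; have [[dG _] _] := PG a; exact: dG.
    move=> x [i _]; have [[_ AG] _] := PG i; move=> /AG[j _ Bijx].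
    by exists (f^-1%FUN (i, j)) => //=; rewrite invK ?inE.
  rewrite -(esum_pred_image (hausdorff_size k \o uncurry G) _ xpredT)
    ?[fun=> _]set_true//.
  by rewrite image_eq.
rewrite (_ : esum _ _ = \sum_(i <oo) \sum_(j <oo) hausdorff_size k (G i j));
  last first.
  pose J : nat -> set (nat * nat) := fun i => [set (i, j) | j in setT].
  rewrite (_ : setT = \bigcup_k J k); last first.
    by rewrite predeqE => -[a b]; split => // _; exists a => //; exists b.
  rewrite esum_bigcupT /=; last 2 first.
    - apply/trivIsetP => i j _ _ ij.
      rewrite predeqE => -[n p] /=; split => //= -[] [_] _ [<-{n} _].
      by move=> [m' _] [] /esym/eqP; rewrite (negbTE ij).
    - by move=> /= [n p]; exact: hausdorff_size_ge0.
  rewrite -(image_id [set: nat]) -fun_true esum_pred_image//; last first.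
    by move=> n _; apply: esum_ge0 => *; exact: hausdorff_size_ge0.
  apply: eq_eseriesr => /= j _.
  rewrite -(esum_pred_image (hausdorff_size k \o uncurry G) (pair j) predT)//=;
    last 2 first.
  - by move=> n _; exact: hausdorff_size_ge0.
  - by move=> ? ? _ _; exact: (@can_inj _ _ _ snd).
  by congr esum; rewrite predeqE => -[a b]; split; move=> [i _ <-]; exists i.
apply: lee_nneseries => [n _ _|n _]; last by have [] := PG n.
by apply: nneseries_ge0 => p *; exact: (sG_ge0 (n, p)).
Qed.

Lemma hausdorff_premeasure_le m k e (A : set 'rV[R]_m) : (0 < e)%R ->
  hausdorff_premeasure k e A <= hausdorff k A.
Proof. by move=> e0; apply: ereal_sup_ubound; exists e. Qed.

Lemma hausdorff_ge0 m k (A : set 'rV[R]_m) : 0 <= hausdorff k A.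
Proof.
exact: le_trans (hausdorff_premeasure_ge0 k 1 A) (hausdorff_premeasure_le _ _ _).
Qed.

Lemma hausdorff0 m k : hausdorff k (set0 : set 'rV[R]_m) = 0.
Proof.
apply/eqP; rewrite eq_le hausdorff_ge0 andbT.
by apply: ge_ereal_sup => x [e _ <-]; rewrite hausdorff_premeasure0.
Qed.

Lemma le_hausdorff m k : {homo (@hausdorff m k) : A B / A `<=` B >-> A <= B}.
Proof.
move=> A B AB; apply: ge_ereal_sup => x [e e0 <-].
exact: le_trans (le_hausdorff_premeasure k e AB) (hausdorff_premeasure_le _ _ e0).
Qed.

Lemma hausdorff_sigma_subadditive m k : sigma_subadditive (@hausdorff m k).
Proof.
move=> A; apply: ge_ereal_sup => x [e e0 <-].
apply: le_trans (hausdorff_premeasure_sigma_subadditive k e A) _.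
apply: lee_nneseries => [i _ _|i _]; first exact: hausdorff_premeasure_ge0.
exact: hausdorff_premeasure_le.
Qed.

HB.instance Definition _ m k := isOuterMeasure.Build R 'rV[R]_m
  (@hausdorff m k) (@hausdorff0 m k) (@hausdorff_ge0 m k)
  (@le_hausdorff m k) (@hausdorff_sigma_subadditive m k).

(* Hausdorff measure on the sigma-algebra of Caratheodory measurable sets,
   which contains the Borel sets and all null sets. *)
Definition hausdorff_measure m k :
    set (caratheodory_type (@hausdorff m k)) -> \bar R := @hausdorff m k.

Lemma hausdorff_measure0 m k : @hausdorff_measure m k (set0 : set 'rV[R]_m) = 0.
Proof. exact: hausdorff0. Qed.

Lemma hausdorff_measure_ge0 m k (A : set 'rV[R]_m) : 0 <= @hausdorff_measure m k A.
Proof. exact: hausdorff_ge0. Qed.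

Lemma hausdorff_measure_sigma_additive m k :
  semi_sigma_additive (@hausdorff_measure m k).
Proof.
move=> F mF tF mUF; rewrite /hausdorff_measure.
exact: caratheodory_measure_sigma_additive.
Qed.

HB.instance Definition _ m k := isMeasure.Build _ _ _ (@hausdorff_measure m k)
  (@hausdorff_measure0 m k) (@hausdorff_measure_ge0 m k)
  (@hausdorff_measure_sigma_additive m k).

End Hausdorff.

Section CurvatureMeasure.
Context {R : realType}.

(* Federer's tangent cone of X at x. *)
Definition tangent_cone {m} (X : set 'rV[R]_m) (x : 'rV[R]_m) :
    set 'rV[R]_m :=
  [set v | forall e : R, 0 < e -> exists (y : 'rV[R]_m) (r : R),
    [/\ X y, 0 < r, enorm (y - x) < e & enorm (r *: (y - x) - v) < e]].

Definition normal_cone {m} (X : set 'rV[R]_m) (x : 'rV[R]_m) :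
    set 'rV[R]_m :=
  [set n | forall v, tangent_cone X x v -> edot v n <= 0].

(* Every point at distance less than r from X has a unique nearest point. *)
Definition positive_reach {m} (X : set 'rV[R]_m) : Prop :=
  closed X /\ exists r : R, 0 < r /\
    forall y, (edist y X < r%:E)%E ->
      exists! x, X x /\ (enorm (y - x))%:E = edist y X.

(* A pair (x, n) of R^l x R^l is encoded as row_mx x n in R^(l+l), whose
   Euclidean norm is that of the product. *)
Definition nor {l} (X : set 'rV[R]_l) : set 'rV[R]_(l + l) :=
  [set z | [/\ boundary X (lsubmx z), esphere (rsubmx z) &
               normal_cone X (lsubmx z) (rsubmx z)]].

(* The values at -oo are irrelevant: curvatures range over ]-oo, +oo]. *)
Definition curvature_vector {l} (kappa : \bar R) (a : 'rV[R]_l) :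
    'rV[R]_(l + l) :=
  if kappa is r%:E then
    row_mx ((Num.sqrt (1 + r ^+ 2))^-1 *: a)
           ((r / Num.sqrt (1 + r ^+ 2)) *: a)
  else row_mx 0 a.

Definition curvature_factor (kappa : \bar R) : R :=
  if kappa is r%:E then r / Num.sqrt (1 + r ^+ 2) else 1.

(* kappa lists generalized principal curvatures of X at z = (x, n), with
   principal directions a. Orthonormality of the curvature vectors follows
   from that of a. *)
Definition principal_curvatures {l} (X : set 'rV[R]_l) (z : 'rV[R]_(l + l))
    (kappa : 'I_l.-1 -> \bar R) : Prop :=
  exists a : 'I_l.-1 -> 'rV[R]_l,
    [/\ forall i, (-oo < kappa i)%E,
        forall i j, edot (a i) (a j) = (i == j)%:R &
        tangent_cone (nor X) z =
          [set` <<[seq curvature_vector (kappa i) (a i) | i : 'I_l.-1]>>%VS]].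

(* The product of the factors kappa_i / sqrt (1 + kappa_i ^ 2); it does not
   depend on the choice of kappa, which is determined up to order by the
   tangent space. The value 0 is used at points without principal curvatures. *)
Definition curvature_density {l} (X : set 'rV[R]_l) (z : 'rV[R]_(l + l)) : R :=
  xget 0 [set \prod_(i < l.-1) curvature_factor (kappa i)
         | kappa in principal_curvatures X z].

Definition C0 {l} (X : set 'rV[R]_l) (A : set 'rV[R]_l) : \bar R :=
  ((fine (hausdorff l.-1 (esphere : set 'rV[R]_l)))^-1%:E *
   \int[@hausdorff_measure R (l + l) l.-1]_(z in nor X)
     (\1_A (lsubmx z) * curvature_density X z)%:E)%E.

Definition borel_partition {T : topologicalType} (A : (set T)^nat) : Prop :=
  [/\ forall k, <<s [set U : set T | open U] >> (A k),
      trivIset setT A & \bigcup_k A k = setT].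

(* Total mass of the total variation measure of nu. *)
Definition total_variation {T : topologicalType} (nu : set T -> \bar R) :
    \bar R :=
  ereal_sup [set (\sum_(k <oo) `|nu (A k)|)%E | A in @borel_partition T].

(* M is locally bi-Lipschitz homeomorphic to open subsets of R^k. *)
Definition lipschitz_manifold {m} (k : nat) (M : set 'rV[R]_m) : Prop :=
  forall x, M x ->
    exists (U : set 'rV[R]_m) (V : set 'rV[R]_k) (f : 'rV[R]_k -> 'rV[R]_m)
      (c C : R),
    [/\ open U /\ U x, open V, f @` V = M `&` U, 0 < c &
        forall u v, V u -> V v ->
          c * enorm (u - v) <= enorm (f u - f v) <= C * enorm (u - v)].

Definition parallel_complement {l} (F : set 'rV[R]_l) (e : R) : set 'rV[R]_l :=
  closure (~` parallel_set F e).

Definition regular_value {l} (F : set 'rV[R]_l) (e : R) : Prop :=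
  [/\ 0 < e, positive_reach (parallel_complement F e) &
      lipschitz_manifold l.-1 (boundary (parallel_set F e))].

(* Meaningful for regular e only. *)
Definition C0_parallel {l} (F : set 'rV[R]_l) (e : R) (A : set 'rV[R]_l) :
    \bar R :=
  (((-1) ^+ l.-1)%:E * C0 (parallel_complement F e) A)%E.

Definition C0_var {l} (F : set 'rV[R]_l) (e : R) : \bar R :=
  total_variation (C0_parallel F e).

(* ess lim_(e -> 0) e^s C0_var(F_e) = 0; the discarded null set has to contain
   the values at which C0_var(F_e) is not defined. *)
Definition ess_lim_C0_var_eq0 {l} (F : set 'rV[R]_l) (s : R) : Prop :=
  exists N : set R,
    [/\ lebesgue_measure.-negligible N,
        forall e : R, 0 < e -> ~ regular_value F e -> N e &
        ((e `^ s)%:E * C0_var F e)%E @[e --> within (~` N) 0^'+] --> 0%E].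

Definition scaling_exponent {l} (F : set 'rV[R]_l) : \bar R :=
  ereal_inf [set s%:E | s in [set s | 0 <= s /\ ess_lim_C0_var_eq0 F s]].

End CurvatureMeasure.

(* Main.v *)
(** F lies on a line, in any R^l it is {x0 + t u | t in T}; let K be the closure of
    T.  For e other than the countably many half-lengths of gaps of K, e is regular
    and, with N(e) the number of gaps of K longer than 2e,
      c (1 + N(e)) <= C0_var(F_e) <= C (1 + sum over the gaps of min(1, g / 2e)),
    where the constants depend only on l and the diameter of K.  Below, the hemisphere that
    each long gap leaves in the boundary of the parallel set carries the curvature
    density of a ball.  Above, the density is at most 1, and the normal bundle is
    covered by Lipschitz images of bands of the unit sphere, one for each end of a gap
    and one for each edge where two balls meet.  If e ^ s N(e) -> 0 with s < 1, then the sum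
    over the short gaps is controlled by dyadic decomposition; for s > 1 it always
    is, as the lengths of the gaps are summable.  So the scaling exponent is the
    infimum of the s with e ^ s (1 + N(e)) -> 0, which only depends on T. *)
From HB Require Import structures.
From mathcomp Require Import all_boot all_order all_algebra.
From mathcomp Require Import all_classical all_reals all_analysis.
From mathcomp Require Import ring lra.
Require Import Defs.
Set Implicit Arguments.
Unset Strict Implicit.
Unset Printing Implicit Defensive.
Import Order.TTheory GRing.Theory Num.Theory.
Import numFieldNormedType.Exports.
Local Open Scope classical_set_scope.
Local Open Scope ring_scope.

(** * Euclidean geometry of row vectors *)

(** Neither the normal bundle nor its curvature density is shown to be measurable, and no area
    formula is used, so both bounds work with outer measures. From below, the integral is restricted
    to explicit hemispheres, where bundle and density are known exactly; from above, only covers of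
    the bundle matter. A cover has to be finite at each scale although K may have infinitely many
    gaps. So at mesh h only the gaps longer than 2eh are treated one by one; the rest of the bundle,
    whose normals are orthogonal to the line up to O(h), goes into about 1/h bands of width O(h),
    whose total size stays bounded. A gap of length g < 2e has weight g / 2e because the balls about
    its ends meet in an edge whose unit normals satisfy |(n, u)| <= g / 2e. The value s = 1 falls to
    neither argument for the upper bound, but the infimum does not see a single exponent. *)

Section Edot.
Context {R : realType}.
Implicit Types m : nat.

Lemma edotC m (u v : 'rV[R]_m) : edot u v = edot v u.
Proof. by apply: eq_bigr => i _; rewrite mulrC. Qed.

Lemma edotDl m (u v w : 'rV[R]_m) : edot (u + v) w = edot u w + edot v w.
Proof. by rewrite -big_split; apply: eq_bigr => i _; rewrite mxE mulrDl. Qed.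

Lemma edotDr m (u v w : 'rV[R]_m) : edot w (u + v) = edot w u + edot w v.
Proof. by rewrite edotC edotDl !(edotC w). Qed.

Lemma edotZl m a (u v : 'rV[R]_m) : edot (a *: u) v = a * edot u v.
Proof. by rewrite /edot mulr_sumr; apply: eq_bigr => i _; rewrite mxE mulrA. Qed.

Lemma edotZr m a (u v : 'rV[R]_m) : edot u (a *: v) = a * edot u v.
Proof. by rewrite edotC edotZl edotC. Qed.

Lemma edotNl m (u v : 'rV[R]_m) : edot (- u) v = - edot u v.
Proof. by rewrite -scaleN1r edotZl mulN1r. Qed.

Lemma edotNr m (u v : 'rV[R]_m) : edot u (- v) = - edot u v.
Proof. by rewrite edotC edotNl edotC. Qed.

Lemma edotBl m (u v w : 'rV[R]_m) : edot (u - v) w = edot u w - edot v w.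
Proof. by rewrite edotDl edotNl. Qed.

Lemma edotBr m (u v w : 'rV[R]_m) : edot w (u - v) = edot w u - edot w v.
Proof. by rewrite edotDr edotNr. Qed.

Lemma edot0l m (u : 'rV[R]_m) : edot 0 u = 0.
Proof. by rewrite -(scale0r 0) edotZl mul0r. Qed.

Lemma edot0r m (u : 'rV[R]_m) : edot u 0 = 0.
Proof. by rewrite edotC edot0l. Qed.

Definition edotE := (@edotDl, @edotDr, @edotBl, @edotBr, @edotZl, @edotZr,
  @edotNl, @edotNr, @edot0l, @edot0r).

Lemma edot_ge0 m (u : 'rV[R]_m) : 0 <= edot u u.
Proof. by apply: sumr_ge0 => i _; rewrite -expr2 sqr_ge0. Qed.

Lemma edot_eq0 m (u : 'rV[R]_m) : edot u u = 0 -> u = 0.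
Proof.
move=> /eqP; rewrite psumr_eq0 => [/allP h|i _]; last by rewrite -expr2 sqr_ge0.
apply/rowP => i; rewrite mxE; have := h i (mem_index_enum _).
by rewrite /= mulf_eq0 orbb => /eqP.
Qed.

Lemma enorm_sqr m (u : 'rV[R]_m) : enorm u ^+ 2 = edot u u.
Proof. by rewrite sqr_sqrtr// edot_ge0. Qed.

Lemma enorm_le m (u : 'rV[R]_m) c : 0 <= c -> (enorm u <= c) = (edot u u <= c ^+ 2).
Proof. by move=> c0; rewrite -enorm_sqr ler_sqr ?nnegrE ?enorm_ge0. Qed.

Lemma enorm_lt m (u : 'rV[R]_m) c : 0 <= c -> (enorm u < c) = (edot u u < c ^+ 2).
Proof. by move=> c0; rewrite -enorm_sqr ltr_sqr ?nnegrE ?enorm_ge0. Qed.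

Lemma enorm_ge m (u : 'rV[R]_m) c : 0 <= c -> (c <= enorm u) = (c ^+ 2 <= edot u u).
Proof. by move=> c0; rewrite -enorm_sqr ler_sqr ?nnegrE ?enorm_ge0. Qed.

Lemma enorm_eq m (u : 'rV[R]_m) c : 0 <= c -> edot u u = c ^+ 2 -> enorm u = c.
Proof. by move=> c0 h; rewrite /enorm h sqrtr_sqr ger0_norm. Qed.

Lemma esphereE m (u : 'rV[R]_m) : esphere u <-> edot u u = 1.
Proof.
split => [h|h]; first by rewrite -enorm_sqr h expr1n.
by apply: enorm_eq; rewrite ?expr1n.
Qed.

Lemma enorm0 m : enorm (0 : 'rV[R]_m) = 0.
Proof. by apply: enorm_eq; rewrite // edot0l expr0n. Qed.

Lemma enorm_eq0 m (u : 'rV[R]_m) : enorm u = 0 -> u = 0.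
Proof. by move=> h; apply: edot_eq0; rewrite -enorm_sqr h expr0n. Qed.

Lemma enorm_gt0 m (u : 'rV[R]_m) : u != 0 -> 0 < enorm u.
Proof.
by move=> u0; rewrite lt_neqAle enorm_ge0 andbT eq_sym; apply: contra_neq u0 => /enorm_eq0.
Qed.

Lemma enormN m (u : 'rV[R]_m) : enorm (- u) = enorm u.
Proof. by rewrite /enorm edotNl edotNr opprK. Qed.

Lemma enormB m (u v : 'rV[R]_m) : enorm (u - v) = enorm (v - u).
Proof. by rewrite -enormN opprB. Qed.

Lemma enormZ m a (u : 'rV[R]_m) : enorm (a *: u) = `|a| * enorm u.
Proof. by rewrite /enorm edotZl edotZr mulrA -expr2 sqrtrM ?sqr_ge0// sqrtr_sqr. Qed.

Lemma edot_le m (u v : 'rV[R]_m) : edot u v <= enorm u * enorm v.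
Proof.
have [->|v0] := eqVneq v 0; first by rewrite edot0r mulr_ge0 ?enorm_ge0.
have [->|u0] := eqVneq u 0; first by rewrite edot0l mulr_ge0 ?enorm_ge0.
have pu := enorm_gt0 u0; have pv := enorm_gt0 v0.
have := edot_ge0 (enorm v *: u - enorm u *: v).
rewrite !edotE -!enorm_sqr (edotC v u) => h.
rewrite -(ler_pM2l (mulr_gt0 pu pv)).
move: (enorm u) (enorm v) (edot u v) h => a b c h; lra.
Qed.

Lemma edot_abs m (u v : 'rV[R]_m) : `|edot u v| <= enorm u * enorm v.
Proof.
by rewrite ler_norml edot_le lerNl -edotNl -(enormN u) edot_le.
Qed.

Lemma enormD m (u v : 'rV[R]_m) : enorm (u + v) <= enorm u + enorm v.
Proof.
rewrite enorm_le ?addr_ge0 ?enorm_ge0// !edotE -!enorm_sqr (edotC v u).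
have := edot_le u v; move: (enorm u) (enorm v) (edot u v) => a b c; lra.
Qed.

Lemma enorm_triangle m (u v w : 'rV[R]_m) : enorm (u - w) <= enorm (u - v) + enorm (v - w).
Proof. by rewrite -[u in leLHS](subrK v) -addrA enormD. Qed.

Lemma enorm_triangleB m (u v : 'rV[R]_m) : enorm u - enorm v <= enorm (u - v).
Proof. by rewrite lerBlDr -[u in leLHS](subrK v) enormD. Qed.

Lemma enorm_sum m (I : Type) (r : seq I) (P : pred I) (f : I -> 'rV[R]_m) :
  enorm (\sum_(i <- r | P i) f i) <= \sum_(i <- r | P i) enorm (f i).
Proof.
elim/big_ind2 : _ => [|x a y b xa yb|//]; first by rewrite enorm0.
exact: le_trans (enormD _ _) (lerD xa yb).
Qed.

Lemma edot_row_mx m1 m2 (a c : 'rV[R]_m1) (b d : 'rV[R]_m2) :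
  edot (row_mx a b) (row_mx c d) = edot a c + edot b d.
Proof.
rewrite /edot big_split_ord /=; congr (_ + _); apply: eq_bigr => i _.
  by rewrite !row_mxEl.
by rewrite !row_mxEr.
Qed.

Lemma enorm_row_mx m1 m2 (a : 'rV[R]_m1) (b : 'rV[R]_m2) :
  enorm (row_mx a b) <= enorm a + enorm b.
Proof.
rewrite enorm_le ?addr_ge0 ?enorm_ge0// edot_row_mx -!enorm_sqr.
rewrite sqrrD lerD2r lerDl mulrn_wge0// mulr_ge0 ?enorm_ge0//.
Qed.

Lemma enorm_lsubmx m1 m2 (z : 'rV[R]_(m1 + m2)) : enorm (lsubmx z) <= enorm z.
Proof.
by rewrite enorm_le ?enorm_ge0// enorm_sqr -{3 4}(hsubmxK z) edot_row_mx lerDl edot_ge0.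
Qed.

Lemma enorm_rsubmx m1 m2 (z : 'rV[R]_(m1 + m2)) : enorm (rsubmx z) <= enorm z.
Proof.
by rewrite enorm_le ?enorm_ge0// enorm_sqr -{3 4}(hsubmxK z) edot_row_mx lerDr edot_ge0.
Qed.

Lemma coord_le_enorm m (u : 'rV[R]_m) i : `|u 0 i| <= enorm u.
Proof.
rewrite -sqrtr_sqr ler_wsqrtr// /edot (bigD1 i)//= -expr2 lerDl.
by apply: sumr_ge0 => j _; rewrite -expr2 sqr_ge0.
Qed.

Lemma normr_le_enorm m (u : 'rV[R]_m) : `|u| <= enorm u.
Proof.
rewrite [leLHS]/Num.norm/=; apply: (le_trans (y := mx_norm u)) => //.
rewrite mx_normrE; apply/bigmax_leP; split; first exact: enorm_ge0.
by move=> [a i] _ /=; rewrite (ord1 a); exact: coord_le_enorm.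
Qed.

Lemma enorm_le_normr m (u : 'rV[R]_m) : enorm u <= m%:R * `|u|.
Proof.
have -> : u = \sum_i u 0 i *: delta_mx 0 i by rewrite [LHS]row_sum_delta.
apply: (le_trans (enorm_sum _ _ _)); rewrite -row_sum_delta.
have -> : m%:R * `|u| = \sum_(i < m) `|u| by rewrite sumr_const card_ord mulr_natl.
apply: ler_sum => i _; rewrite enormZ.
have -> : enorm (delta_mx 0 i : 'rV[R]_m) = 1.
  apply: enorm_eq => //; rewrite /edot (bigD1 i)//= mxE !eqxx mulr1 big1 ?addr0 ?expr1n//.
  by move=> j ji; rewrite mxE (negPf ji) andbF mul0r.
rewrite mulr1.
have : `|u 0 i| <= mx_norm u.
  by rewrite mx_normrE; apply: (@le_bigmax _ _ _ _ (fun p => `|u p.1 p.2|) (0, i)).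
by [].
Qed.

(** The library topology is that of the maximum norm; each norm bounds the other up to a factor
    depending on the dimension, so Euclidean balls define the same neighbourhoods. *)
Lemma enorm_ballP m (x : 'rV[R]_m) (A : set 'rV[R]_m) :
  nbhs x A <-> exists2 e, 0 < e & forall y, enorm (y - x) < e -> A y.
Proof.
split.
  move=> /nbhs_ballP[e /= e0 h]; exists e => // y yx; apply: h.
  by rewrite -ball_normE /= distrC (le_lt_trans (normr_le_enorm _)).
(* [m.+1] instead of [m] covers dimension 0. *)
move=> [e e0 h]; apply/nbhs_ballP; exists (e / m.+1%:R) => /=; first by rewrite divr_gt0.
move=> y; rewrite -ball_normE /= distrC ltr_pdivlMr// => xy; apply: h.
apply: (le_lt_trans (enorm_le_normr _)); apply: le_lt_trans xy.
by rewrite mulrC ler_wpM2l// ler_nat.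
Qed.

Lemma enorm_openP m (A : set 'rV[R]_m) :
  open A <-> forall x, A x -> exists2 e, 0 < e & forall y, enorm (y - x) < e -> A y.
Proof.
rewrite openE; split => [h x /h|h x Ax]; first by rewrite /interior /= => /enorm_ballP.
by rewrite /interior /=; apply/enorm_ballP/h.
Qed.

Lemma enorm_closureP m (A : set 'rV[R]_m) x :
  closure A x <-> forall e, 0 < e -> exists2 y, A y & enorm (y - x) < e.
Proof.
split => [cx e e0|h B /enorm_ballP[e e0 eB]].
  have [|y [Ay yB]] := cx [set y | enorm (y - x) < e]; first by apply/enorm_ballP; exists e.
  by exists y.
by have [y Ay yx] := h _ e0; exists y; split => //; exact: eB.
Qed.

Lemma lipschitz_continuous_enorm m (f : 'rV[R]_m -> R) c :
  (forall x y, `|f x - f y| <= c * enorm (x - y)) -> continuous f.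
Proof.
move=> h x; apply/(@cvgrPdist_lt _ _ _ (nbhs x) (nbhs_filter x)) => e e0 /=; apply/enorm_ballP.
have c0 : 0 < `|c| + 1 by rewrite ltr_wpDl.
exists (e / (`|c| + 1)); first by rewrite divr_gt0.
move=> y; rewrite ltr_pdivlMr// => yx.
apply: (le_lt_trans (h x y)); apply: le_lt_trans yx.
rewrite enormB mulrC ler_wpM2l ?enorm_ge0//.
by rewrite (le_trans (ler_norm _))// lerDl.
Qed.

Lemma lipschitz_continuous (f : R -> R) c :
  (forall x y, `|f x - f y| <= c * `|x - y|) -> continuous f.
Proof.
move=> h x; apply/(@cvgrPdist_lt _ _ _ (nbhs x) (nbhs_filter x)) => e e0 /=.
have c0 : 0 < `|c| + 1 by rewrite ltr_wpDl.
apply/nbhs_ballP; exists (e / (`|c| + 1)) => /=; first by rewrite divr_gt0.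
move=> y /=; rewrite /ball /= ltr_pdivlMr// => yx.
apply: (le_lt_trans (h x y)); apply: le_lt_trans yx.
by rewrite mulrC ler_wpM2l// (le_trans (ler_norm _))// lerDl.
Qed.

Lemma enorm_continuous m (y : 'rV[R]_m) : continuous (fun x : 'rV[R]_m => enorm (x - y)).
Proof.
apply: (@lipschitz_continuous_enorm _ _ 1) => x x'; rewrite mul1r ler_norml.
rewrite lerNl opprB; apply/andP; split.
  by rewrite (le_trans (enorm_triangleB _ _))// opprB addrA subrK enormB.
by rewrite (le_trans (enorm_triangleB _ _))// opprB addrA subrK.
Qed.

End Edot.

Section OrthonormalFrame.
Context {R : realType}.

(* The frame is a Householder reflection exchanging the first vector of the
   standard basis and [u]. *)
Lemma orthonormal_frame k (u : 'rV[R]_k.+1) : edot u u = 1 ->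
  exists b : 'I_k.+1 -> 'rV[R]_k.+1,
    [/\ b ord0 = u, forall i j, edot (b i) (b j) = (i == j)%:R &
        forall x, x = \sum_i edot x (b i) *: b i].
Proof.
move=> u1.
have [w wE] : exists w : 'rV[R]_k.+1, w = delta_mx 0 ord0 - u by eexists.
have de i (x : 'rV[R]_k.+1) : edot x (delta_mx 0 i) = x 0 i.
  rewrite /edot (bigD1 i)//= mxE !eqxx mulr1 big1 ?addr0// => j ji.
  by rewrite mxE (negPf ji) andbF mulr0.
have dd i j : edot (delta_mx 0 i : 'rV[R]_k.+1) (delta_mx 0 j) = (i == j)%:R.
  by rewrite de mxE eqxx /= eq_sym.
have ww : edot w w = 2 * (1 - u 0 ord0).
  rewrite wE !edotE dd eqxx u1 (edotC u) (edotC _ u) de /= mulr1n; lra.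
have sumE (x : 'rV[R]_k.+1) : x = \sum_i edot x (delta_mx 0 i) *: delta_mx 0 i.
  by rewrite [LHS]row_sum_delta; apply: eq_bigr => i _; rewrite de.
have [w0|w0] := eqVneq w 0.
  exists (fun i => delta_mx 0 i); split => //.
  by apply/eqP; rewrite -subr_eq0 -wE w0.
have wp : edot w w != 0 by apply: contra_neq w0 => /edot_eq0.
pose c := 2 / edot w w.
pose h (x : 'rV[R]_k.+1) := x - (c * edot x w) *: w.
have hh x y : edot (h x) (h y) = edot x y.
  rewrite /h !edotE (edotC w y).
  have -> : edot w w = 2 / c by rewrite /c invfM invrK mulrA divff ?mul1r ?pnatr_eq0.
  have c0 : c != 0 by rewrite /c mulf_neq0 ?invr_eq0 ?pnatr_eq0.
  by move: (edot x w) (edot y w) (edot x y) => p q r; field.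
have hK x : h (h x) = x.
  rewrite /h !edotE.
  have -> : edot x w - c * edot x w * edot w w = - edot x w.
    by rewrite /c mulrAC divfK// mulr_natl mulr2n opprD addrA subrr add0r.
  by rewrite mulrN scaleNr opprK subrK.
exists (fun i => h (delta_mx 0 i)); split.
- rewrite /h edotC de.
  have -> : w 0 ord0 = edot w w / 2.
    by rewrite ww mulrAC divff ?pnatr_eq0// mul1r wE !mxE !eqxx.
  have -> : c * (edot w w / 2) = 1 by rewrite /c; move: (edot w w) wp => q q0; field.
  by rewrite scale1r wE opprB addrC subrK.
- by move=> i j; rewrite hh dd.
- move=> x; rewrite -{1}(hK x) {1}(sumE (h x)).
  rewrite {1}/h (big_morph (fun x => edot x w) (fun x y => edotDl x y w) (edot0l w)).
  under eq_bigr do rewrite edotZl.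
  rewrite mulr_sumr scaler_suml -sumrB; apply: eq_bigr => i _.
  have -> : edot x (h (delta_mx 0 i)) = edot (h x) (delta_mx 0 i) by rewrite -(hh x) hK.
  rewrite -/(h x) [in RHS]/h scalerBr scalerA; congr (_ - _ *: _).
  by rewrite mulrCA.
Qed.

Lemma frame_edot m n (b : 'I_n -> 'rV[R]_m) (x : 'rV[R]_m) :
  (forall i j, edot (b i) (b j) = (i == j)%:R) ->
  (forall x, x = \sum_i edot x (b i) *: b i) ->
  edot x x = \sum_i edot x (b i) ^+ 2.
Proof.
move=> bb bE; rewrite {1}(bE x).
rewrite (big_morph (fun y => edot y x) (fun y z => edotDl y z x) (edot0l x)).
by apply: eq_bigr => i _; rewrite edotZl (edotC (b i)) expr2.
Qed.

Lemma frame_enorm m n (b : 'I_n -> 'rV[R]_m) (x : 'rV[R]_m) :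
  (forall i j, edot (b i) (b j) = (i == j)%:R) ->
  (forall x, x = \sum_i edot x (b i) *: b i) ->
  enorm x <= \sum_i `|edot x (b i)|.
Proof.
move=> bb bE; rewrite {1}(bE x); apply: (le_trans (enorm_sum _ _ _)).
apply: ler_sum => i _; rewrite enormZ [enorm (b i)](@enorm_eq _ _ _ 1) ?mulr1//.
by rewrite bb eqxx expr1n.
Qed.

Lemma edot_frame_coord m n (b : 'I_n -> 'rV[R]_m) (a : 'I_n -> R) j :
  (forall i j, edot (b i) (b j) = (i == j)%:R) ->
  edot (\sum_i a i *: b i) (b j) = a j.
Proof.
move=> bb; rewrite (big_morph (fun y => edot y (b j)) (fun y z => edotDl y z _) (edot0l _)).
rewrite (bigD1 j)//= edotZl bb eqxx mulr1 big1 ?addr0// => i ij.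
by rewrite edotZl bb (negPf ij) mulr0.
Qed.

End OrthonormalFrame.

(** * Upper and lower estimates for Hausdorff measure *)

Section HausdorffUpper.
Context {R : realType}.
Local Open Scope ereal_scope.

(** At a fixed scale the premeasure is already an outer measure, so the pieces of a finite cover can
    be added up before the scale tends to 0, and the cover may depend on the scale. *)
HB.instance Definition _ m k e := isOuterMeasure.Build R 'rV[R]_m
  (@hausdorff_premeasure R m k e) (@hausdorff_premeasure0 R m k e)
  (@hausdorff_premeasure_ge0 R m k e) (@le_hausdorff_premeasure R m k e)
  (@hausdorff_premeasure_sigma_subadditive R m k e).

Lemma outer_measure_seq {T : Type} (mu : {outer_measure set T -> \bar R})
    (I : eqType) (s : seq I) (U : I -> set T) :
  mu [set x | exists2 i, i \in s & U i x] <= \sum_(i <- s) mu (U i).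
Proof.
elim: s => [|i s IH].
  rewrite big_nil (_ : mkset _ = set0) ?outer_measure0//.
  by apply/seteqP; split => // x [].
rewrite big_cons; apply: le_trans (leeD2l _ IH).
apply: le_trans (outer_measureU2 _ _ _); apply: le_outer_measure => x [j].
rewrite inE => /orP[/eqP ->|js] Ux; first by left.
by right; exists j.
Qed.

Lemma ediam_le m (U : set 'rV[R]_m) d :
  (forall x y, U x -> U y -> enorm (x - y) <= d)%R -> ediam U <= d%:E.
Proof. by move=> h; apply: ge_ereal_sup => _ [[x y] [/= Ux Uy] <-]; rewrite lee_fin h. Qed.

Lemma unit_ball_volume_gt0 k : (0 < unit_ball_volume k :> R)%R.
Proof.
have : ((0 < unit_ball_volume k :> R) && (0 < unit_ball_volume k.+1 :> R))%R.
  elim: k => [|k /andP[IH1 IH2]]; first by rewrite /= ltr01 ltr0n.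
  by rewrite IH2 /=; apply: mulr_gt0 => //; rewrite divr_gt0// mulr_gt0// pi_gt0.
by case/andP.
Qed.

Lemma premeasure_diam_le m k (e d : R) (U : set 'rV[R]_m) : (0 <= d <= e)%R ->
  (forall x y, U x -> U y -> enorm (x - y) <= d)%R ->
  hausdorff_premeasure k e U <= (unit_ball_volume k * (d / 2) ^+ k)%:E.
Proof.
move=> /andP[d0 de] Ud.
apply: (@le_trans _ _ (hausdorff_size k U)).
  apply: ereal_inf_lbound; exists (fun i : nat => if i is 0%N return set 'rV[R]_m then U else set0).
    split=> [[|i]|x Ux]; last by exists 0%N.
      by apply: (le_trans (ediam_le Ud)); rewrite lee_fin.
    by rewrite ediam0 leNye.
  rewrite nneseries_recl//; last by move=> *; exact: hausdorff_size_ge0.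
  rewrite eseries_cond/= eseries0 ?adde0// => -[|]//= i _ _.
  by rewrite /hausdorff_size eqxx.
rewrite /hausdorff_size; case: ifPn => [_|/set0P U0].
  by rewrite lee_fin mulr_ge0 ?unit_ball_volume_ge0// exprn_ge0// divr_ge0.
have h0 := ediam_ge0 U0; have hd := ediam_le Ud.
rewrite lee_fin ler_wpM2l ?unit_ball_volume_ge0// lerXn2r ?nnegrE ?divr_ge0 ?fine_ge0//.
rewrite ler_pM2r ?invr_gt0// -lee_fin fineK//.
by rewrite ge0_fin_numE// (le_lt_trans hd)// ltry.
Qed.

(** The functions [c] map P into a box. Cut the box into cells of mesh h: there are at most prod
    (r_i / h + 1) of them, and the part of P over each has diameter at most d. *)
Lemma premeasure_box_cover m k (P : set 'rV[R]_m) (c : 'I_k -> 'rV[R]_m -> R)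
    (lo r : 'I_k -> R) (h d e : R) : (0 < h)%R -> (0 <= d <= e)%R ->
  (forall i, 0 <= r i)%R ->
  (forall z i, P z -> lo i <= c i z <= lo i + r i)%R ->
  (forall z z', P z -> P z' -> (forall i, `|c i z - c i z'| <= h) ->
     enorm (z - z') <= d)%R ->
  hausdorff_premeasure k e P <=
    (\prod_i (r i / h + 1) * (unit_ball_volume k * (d / 2) ^+ k))%:E.
Proof.
move=> h0 de r0 Pc Pd.
(* Cell indices range over a common ['I_A]; [F i] cuts out those that occur in coordinate i, which
   makes the count a product. *)
pose A := (\sum_i Num.truncn (r i / h))%N.+1.
pose F (i : 'I_k) := [pred a : 'I_A | (a <= Num.truncn (r i / h))%N].
pose U (f : {ffun 'I_k -> 'I_A}) : set 'rV[R]_m :=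
  [set z | P z /\ forall i, Num.truncn ((c i z - lo i) / h) = f i].
have cge z i : P z -> (0 <= (c i z - lo i) / h)%R.
  by move=> /Pc -/(_ i)/andP[? _]; rewrite divr_ge0 ?subr_ge0// ltW.
apply: (@le_trans _ _ (hausdorff_premeasure k e
   [set z | exists2 f, f \in enum (family F) & U f z])).
  apply: le_outer_measure => z Pz.
  have tr i : (Num.truncn ((c i z - lo i) / h) <= Num.truncn (r i / h))%N.
    apply: le_truncn; rewrite ler_pM2r ?invr_gt0// lerBlDl.
    by have /andP[] := Pc z i Pz.
  have trA i : (Num.truncn ((c i z - lo i) / h) < A)%N.
    by rewrite ltnS (leq_trans (tr i))// (bigD1 i)//= leq_addr.
  exists [ffun i => Ordinal (trA i)].
    by rewrite mem_enum; apply/familyP => i; rewrite ffunE inE /=.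
  by split => // i; rewrite ffunE.
apply: (le_trans (outer_measure_seq _ _ _)).
apply: (@le_trans _ _ (\sum_(f <- enum (family F))
   (unit_ball_volume k * (d / 2) ^+ k)%:E)).
  apply: lee_sum => f _; apply: premeasure_diam_le => // x y [Px fx] [Py fy].
  apply: Pd => // i; have := truncn_itv (cge x i Px); have := truncn_itv (cge y i Py).
  rewrite fx fy; move: (nat_of_ord (f i)) => a.
  rewrite -natr1 !ler_pdivlMr// !ltr_pdivrMr// => /andP[y1 y2] /andP[x1 x2].
  rewrite ler_norml; apply/andP; split; lra.
rewrite sumEFin big_const_seq count_predT iter_addr_0 -cardE lee_fin -[leLHS]mulr_natl.
apply: ler_wpM2r.
  by case/andP: de => d0 _; rewrite mulr_ge0 ?unit_ball_volume_ge0 ?exprn_ge0 ?divr_ge0.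
rewrite card_family foldrE big_map big_enum /= natr_prod.
apply: ler_prod => i _; rewrite ler0n /=.
apply: (@le_trans _ _ (Num.truncn (r i / h)).+1%:R)%R.
  rewrite ler_nat -[leqRHS]card_ord.
  apply: (leq_trans (@leq_card_in _ _ (fun a : 'I_A => inord a : 'I_(Num.truncn (r i / h)).+1) (F i) _)).
    move=> a b; rewrite !inE /= => ai bi /(congr1 val); rewrite /= !inordK ?ltnS//.
    exact: val_inj.
  by [].
by rewrite -natr1 lerD2r truncn_le// divr_ge0// ltW.
Qed.

Local Close Scope ereal_scope.

(* On the part of the sphere where |edot n (b j)| >= 1/(k+1), the other
   coordinates of n determine n up to a Lipschitz constant; a grid of mesh h in
   these coordinates has O(w / h ^ k) cells meeting the band of width w. *)
Lemma premeasure_band (k : nat) : exists C D : R, [/\ 0 < C, 0 < D &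
  forall m (u : 'rV[R]_k.+1) (P : set 'rV[R]_m) (N : 'rV[R]_m -> 'rV[R]_k.+1)
    (L h w e : R), edot u u = 1 -> 0 <= L -> 0 < h <= w -> w <= 1 ->
    D * (L * h) <= e ->
    (forall z, P z -> edot (N z) (N z) = 1 /\ `|edot (N z) u| <= w) ->
    (forall z z', P z -> P z' -> enorm (z - z') <= L * (enorm (N z - N z') + h)) ->
    (hausdorff_premeasure k e P <= (C * L ^+ k * w)%:E)%E].
Proof.
(* For two points of one cell, k h bounds the sum of the differences in the free coordinates of N
   and k l h the difference in the pivot coordinate; the last 1 is for the extra h in the Lipschitz
   hypothesis. *)
pose l : R := k.+1%:R; pose D := k%:R + k%:R * l + 1.
have l1 : 1 <= l by rewrite /l ler1n.
have D0 : 0 < D by rewrite ltr_wpDl// addr_ge0// mulr_ge0.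
(* There are 2 l choices of pivot and sign, each with at most l w (3 / h) ^ k cells of diameter D L
   h. *)
exists (2 * l ^+ 2 * (unit_ball_volume k * (3 * D / 2) ^+ k)), D; split => //.
  rewrite mulr_gt0 ?unit_ball_volume_gt0//; first by rewrite mulr_gt0 ?exprn_gt0//; lra.
  by rewrite mulr_gt0 ?unit_ball_volume_gt0 ?exprn_gt0 ?divr_gt0 ?mulr_gt0.
move=> m u P N L h w e u1 L0 /andP[h0 hw] w1 De PN PL.
have [b [b0 bb bE]] := orthonormal_frame u1.
pose c i z := edot (N z) (b i).
have c0 z : P z -> `|c ord0 z| <= w by move=> /PN[_]; rewrite /c b0.
have csum z : P z -> \sum_i c i z ^+ 2 = 1.
  by move=> /PN[<- _]; rewrite (frame_edot _ bb bE).
have c1 i z : P z -> `|c i z| <= 1.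
  move=> Pz; rewrite -(@ler_sqr _ `|c i z| 1) ?nnegrE// real_normK ?num_real// expr1n.
  rewrite -(csum _ Pz) (bigD1 i)//= lerDl; apply: sumr_ge0 => j _; exact: sqr_ge0.
pose Pj (js : 'I_k.+1 * bool) : set 'rV[R]_m :=
  [set z | P z /\ l^-1 <= (-1) ^+ js.2 * c js.1 z].
have cover : P `<=` [set z | exists2 js, js \in enum {: 'I_k.+1 * bool} & Pj js z].
  move=> z Pz.
  have [[j cj]|] := pselect (exists j, l^-1 <= `|c j z|).
    exists (j, c j z < 0); first by rewrite mem_enum.
    by split => //=; rewrite -normrEsign.
  move=> /forallNP h1; exfalso.
  have : \sum_i c i z ^+ 2 < \sum_(i < k.+1) l^-1 ^+ 2.
    apply: ltr_sum => [|i _]; first by apply/hasP; exists ord0; rewrite ?mem_index_enum.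
    have /negP := h1 i; rewrite -ltNge => h2; rewrite -[X in X < _](real_normK (num_real _)).
    by rewrite ltr_sqr// nnegrE// invr_ge0; lra.
  rewrite csum// sumr_const card_ord -[X in _ < X]mulr_natl -/l expr2 mulrA divff; last by rewrite gt_eqF//; lra.
  by rewrite mul1r ltNge invf_le1//; lra.
apply: (le_trans (le_outer_measure (@hausdorff_premeasure R m k e) _ _ cover)).
apply: (le_trans (outer_measure_seq _ _ _)).
pose B := l * w * (unit_ball_volume k * (3 * D / 2) ^+ k * L ^+ k).
have V0 : 0 <= unit_ball_volume k * (D * (L * h) / 2) ^+ k :> R.
  by rewrite mulr_ge0 ?unit_ball_volume_ge0// exprn_ge0// divr_ge0// mulr_ge0 ?mulr_ge0//; lra.
apply: (@le_trans _ _ (\sum_(js <- enum {: 'I_k.+1 * bool}) B%:E)%E); last first.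
  rewrite sumEFin big_const_seq count_predT iter_addr_0 -cardE card_prod card_ord card_bool.
  rewrite lee_fin -[leLHS]mulr_natl natrM -/l /B le_eqVlt; apply/orP; left; apply/eqP; ring.
apply: lee_sum => -[j s] _.
have Pc : forall z z', Pj (j, s) z -> Pj (j, s) z' ->
    (forall i, `|c (lift j i) z - c (lift j i) z'| <= h) -> enorm (z - z') <= D * (L * h).
  move=> z z' [Pz sz] [Pz' sz'] hc; apply: (le_trans (PL _ _ Pz Pz')).
  rewrite mulrCA ler_wpM2l//; rewrite -lerBrDr.
  have -> : D * h - h = k%:R * l * h + k%:R * h by rewrite /D; ring.
  have cB i : edot (N z - N z') (b i) = c i z - c i z' by rewrite edotBl.
  apply: (le_trans (frame_enorm _ bb bE)); under eq_bigr do rewrite cB.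
  rewrite (bigD1_ord j)//=; apply: lerD; last first.
    apply: le_trans (_ : \sum_(i < k) h <= _); first by apply: ler_sum => i _; exact: hc.
    by rewrite sumr_const card_ord mulr_natl.
  (* The unit norm recovers the pivot from the other coordinates: its two squares differ by at most
     2 k h, while the sum of its two values is at least 2 / l in absolute value, the sign being
     fixed. *)
  have sq : (c j z) ^+ 2 - (c j z') ^+ 2 = \sum_i ((c (lift j i) z') ^+ 2 - (c (lift j i) z) ^+ 2).
    have := csum _ Pz; rewrite -(csum _ Pz') !(bigD1_ord j)//= sumrB => /eqP.
    by rewrite -subr_eq => /eqP; lra.
  have : `|(c j z) ^+ 2 - (c j z') ^+ 2| <= k%:R * (2 * h).
    rewrite sq; apply: (le_trans (ler_norm_sum _ _ _)).
    apply: le_trans (_ : \sum_(i < k) 2 * h <= _); last by rewrite sumr_const card_ord -[leLHS]mulr_natl.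
    apply: ler_sum => i _; rewrite subr_sqr normrM mulrC; apply: ler_pM => //.
      by apply: le_trans (ler_normD _ _) _; rewrite (_ : 2 = 1 + 1)// lerD// c1.
    by rewrite distrC.
  rewrite subr_sqr normrM.
  have : 2 * l^-1 <= `|c j z + c j z'|.
    rewrite -[leRHS](normrMsign s) mulrDr.
    apply: le_trans (ler_norm _); move: sz sz' => /=.
    move: (l^-1) (_ * c j z) (_ * c j z') => t p q; lra.
  move=> h1 h2.
  have a0 : 0 <= `|c j z - c j z'| by [].
  have : `|c j z - c j z'| * (2 * l^-1) <= k%:R * (2 * h).
    by apply: le_trans h2; rewrite ler_wpM2l.
  rewrite [X in X <= _ -> _]mulrA ler_pdivrMr; last lra.
  lra.
have e1 : 2 / h + 1 <= 3 / h by rewrite ler_pdivlMr// mulrDl divfK ?gt_eqF//; lra.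
have dge : 0 <= D * (L * h) <= e by rewrite De mulr_ge0 ?mulr_ge0//; lra.
have hE : (3 / h) ^+ k * (unit_ball_volume k * (D * (L * h) / 2) ^+ k) =
    unit_ball_volume k * (3 * D / 2) ^+ k * L ^+ k.
  rewrite mulrCA -exprMn -[RHS]mulrA -exprMn; congr (_ * _ ^+ _).
  by field; rewrite gt_eqF.
have X0 : 0 <= (3 / h) ^+ k * (unit_ball_volume k * (D * (L * h) / 2) ^+ k).
  by rewrite mulr_ge0// exprn_ge0// divr_ge0// ltW.
(* If the pivot is the coordinate along u, then w >= 1 / l, and the factor l w >= 1 makes up for the
   absence of a narrow coordinate. Otherwise the coordinate along u is a free one and ranges over an
   interval of length 2w only. *)
have [j0|j0] := eqVneq j ord0; first have [wl|wl] := ltP w l^-1.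
- rewrite (_ : Pj (j, s) = set0) ?outer_measure0 ?lee_fin//.
    rewrite /B mulr_ge0 ?mulr_ge0 ?exprn_ge0 ?unit_ball_volume_ge0//; lra.
  apply/seteqP; split => // z [Pz /=]; rewrite j0 => h1.
  have := c0 _ Pz; apply/negP; rewrite -ltNge (lt_le_trans wl)// (le_trans h1)//.
  by rewrite (le_trans (ler_norm _))// normrMsign.
- apply: (le_trans (premeasure_box_cover (c := fun i => c (lift j i)) (lo := fun=> -1)
    (r := fun=> 2) h0 dge _ _ Pc)) => //.
    by move=> z i [/c1 -/(_ (lift j i))]; rewrite ler_norml => /andP[? ?] _; apply/andP; split; lra.
  rewrite lee_fin prodr_const card_ord /B -hE.
  apply: (@le_trans _ _ ((3 / h) ^+ k * (unit_ball_volume k * (D * (L * h) / 2) ^+ k))).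
    by rewrite ler_wpM2r// lerXn2r ?nnegrE ?addr_ge0 ?divr_ge0//; lra.
  by rewrite ler_peMl// -ler_pdivrMl ?mulr1// (lt_le_trans ltr01).
- have [i0 i0E _] := unlift_some j0.
  pose r i : R := if i == i0 then 2 * w else 2.
  pose lo i : R := if i == i0 then - w else -1.
  apply: (le_trans (premeasure_box_cover (c := fun i => c (lift j i)) (lo := lo)
    (r := r) h0 dge _ _ Pc)) => //.
  + by move=> i; rewrite /r; case: ifP => _; lra.
  + move=> z i [Pz _]; rewrite /r /lo; case: eqP => [->|_].
      by have := c0 _ Pz; rewrite i0E ler_norml => /andP[? ?]; apply/andP; split; lra.
    by have := c1 (lift j i) _ Pz; rewrite ler_norml => /andP[? ?]; apply/andP; split; lra.
  have P1 : \prod_(i < k) (r i / h + 1) <= w * (3 / h) ^+ k.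
    have -> : w * (3 / h) ^+ k = \prod_(i < k) ((if i == i0 then w else 1) * (3 / h)).
      rewrite big_split prodr_const card_ord /=; congr (_ * _).
      by rewrite (bigD1 i0)//= eqxx big1 ?mulr1// => i /negPf ->.
    apply: ler_prod => i _ /=; rewrite /r; case: ifP => _.
      apply/andP; split; first by rewrite addr_ge0 ?divr_ge0//; lra.
      by rewrite mulrA ler_pdivlMr// mulrDl divfK ?gt_eqF//; lra.
    by rewrite mul1r e1 addr_ge0// divr_ge0//; lra.
  rewrite lee_fin /B -hE; apply: (le_trans (ler_wpM2r V0 P1)).
  by rewrite -[leLHS]mulrA ler_wpM2r// ler_peMl//; lra.
Qed.

End HausdorffUpper.

Section HausdorffLower.
Context {R : realType}.

Lemma card_window M D (S : {pred 'I_M}) :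
  (forall a b, a \in S -> b \in S -> (a <= b + D)%N) -> (#|S| <= D.+1)%N.
Proof.
move=> h; case: (posnP #|S|) => [-> //|/card_gt0P[a0 a0S]].
case: (arg_minnP (fun a : 'I_M => nat_of_ord a) a0S) => a aS amin.
rewrite -[leqRHS]card_ord.
apply: (@leq_card_in _ _ (fun b : 'I_M => inord (b - a) : 'I_D.+1) S) => b b' bS b'S.
move=> /(congr1 val) /=; rewrite !inordK ?ltnS ?leq_subLR ?h// => bb'.
by apply: val_inj; rewrite /= -(subnK (amin _ bS)) -(subnK (amin _ b'S)) bb'.
Qed.

(* Counts the points of a fine grid of the cube lying in each set of the cover;
   this avoids Lebesgue measure in dimension k. *)
Lemma cube_cover_lower k n (W : 'I_n -> set ('I_k -> R)) (d : 'I_n -> R) r :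
  0 < r -> (forall i, 0 < d i) ->
  (forall y, (forall j, `|y j| <= r) -> exists i, W i y) ->
  (forall i y y' j, W i y -> W i y' -> `|y j - y' j| <= d i) ->
  r ^+ k <= \sum_i d i ^+ k.
Proof.
move=> r0 d0 cW dW.
(* M exceeds every 2r / d_i, so the rounding in the number of grid points per axis at most doubles M
   d_i / 2r. This is the factor 2 between the side 2r of the cube and the r of the conclusion. *)
pose M := (\sum_i (Num.truncn (2 * r / d i)).+1)%N.+1.
have M0 : 0 < M%:R :> R by [].
have Md i : 1 <= M%:R * d i / (2 * r).
  rewrite ler_pdivlMr ?mul1r ?mulr_gt0// -ler_pdivrMr//.
  apply: ltW; apply: lt_le_trans (truncnS_gt _) _.
  by rewrite ler_nat /M (bigD1 i)//= -addnS leq_addr.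
pose y (f : {ffun 'I_k -> 'I_M}) j : R := - r + 2 * r * (f j)%:R / M%:R.
have yr f j : `|y f j| <= r.
  have : (f j)%:R <= M%:R :> R by rewrite ler_nat ltnW.
  rewrite /y ler_norml => fM; apply/andP; split.
    by rewrite lerDl divr_ge0 ?mulr_ge0// ltW.
  rewrite -lerBrDl ler_pdivrMr// opprK -mulr2n -[r *+ 2]mulr_natl.
  by rewrite ler_wpM2l// mulr_ge0// ltW.
have [g gW] : {g : {ffun 'I_k -> 'I_M} -> 'I_n & forall f, W (g f) (y f)}.
  by apply: (@choice _ _ (fun f i => W i (y f))) => f; apply: cW => j; exact: yr.
have cnt i : (#|[pred f | g f == i]| <= (Num.truncn (M%:R * d i / (2 * r))).+1 ^ k)%N.
  pose S j : pred 'I_M := [pred a | [exists f, (g f == i) && (f j == a)]].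
  apply: (@leq_trans #|family S|).
    apply: subset_leq_card; apply/fintype.subsetP => f; rewrite !inE => /eqP gf.
    by apply/familyP => j; rewrite inE; apply/existsP; exists f; rewrite gf !eqxx.
  rewrite card_family foldrE big_map big_enum /=.
  rewrite -[X in (_ <= _ ^ X)%N]card_ord -prod_nat_const; apply: leq_prod => j _.
  apply: card_window => a b; rewrite !inE => /existsP[f /andP[/eqP gf /eqP <-]].
  move=> /existsP[f' /andP[/eqP gf' /eqP <-]].
  rewrite -leq_subLR truncn_ge_nat; last by rewrite (le_trans ler01).
  have [h|h] := leqP (f j) (f' j).
    by rewrite (eqP (_ : (f j - f' j == 0)%N)) ?subn_eq0// (le_trans ler01).
  have := dW i (y f) (y f') j; rewrite -{1}gf -{1}gf' => /(_ (gW f) (gW f')).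
  rewrite natrB; last exact: ltnW.
  move=> /(le_trans (ler_norm _)).
  rewrite /y ler_pdivlMr ?mulr_gt0// -(ler_pM2l M0).
  have -> : M%:R * (- r + 2 * r * (f j)%:R / M%:R - (- r + 2 * r * (f' j)%:R / M%:R)) =
    ((f j)%:R - (f' j)%:R) * (2 * r) by field; rewrite gt_eqF.
  by [].
have tot : ((M ^ k)%N%:R : R) <= \sum_i (M%:R * d i / r) ^+ k.
  have -> : (M ^ k = \sum_i #|[pred f | g f == i]|)%N.
    rewrite -{1}(card_ord M) -[k in LHS]card_ord -card_ffun -sum1_card (partition_big g xpredT)//=.
    by apply: eq_bigr => i _; rewrite -sum1_card; apply: eq_bigl => f; rewrite inE.
  rewrite natr_sum; apply: ler_sum => i _.
  apply: le_trans (_ : ((Num.truncn (M%:R * d i / (2 * r))).+1 ^ k)%:R <= _).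
    by rewrite ler_nat cnt.
  have r0' := ltW r0; have d0' := ltW (d0 i).
  rewrite natrX lerXn2r ?nnegrE ?ler0n ?divr_ge0 ?mulr_ge0//.
  rewrite -natr1; have := Md i.
  have : (Num.truncn (M%:R * d i / (2 * r)))%:R <= M%:R * d i / (2 * r).
    by rewrite truncn_le (le_trans ler01).
  have -> : M%:R * d i / r = M%:R * d i / (2 * r) + M%:R * d i / (2 * r).
    by field; rewrite gt_eqF.
  lra.
rewrite -(ler_pM2l (exprn_gt0 k (divr_gt0 M0 r0))).
rewrite -exprMn divfK ?gt_eqF// -natrX (le_trans tot)// mulr_sumr.
by apply: ler_sum => i _; rewrite -exprMn mulrAC.
Qed.

Lemma exprD_le k (a b : R) : 0 <= a -> 0 <= b -> (a + b) ^+ k <= 2 ^+ k * (a ^+ k + b ^+ k).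
Proof.
wlog ab : a b / a <= b => [h a0 b0|a0 b0].
  have [|/ltW] := leP a b => ab; first exact: h.
  by rewrite addrC [X in _ * X]addrC; exact: h.
apply: (@le_trans _ _ ((2 * b) ^+ k)).
  by rewrite lerXn2r ?nnegrE ?addr_ge0 ?mulr_ge0//; lra.
by rewrite exprMn ler_wpM2l ?exprn_ge0// lerDr exprn_ge0.
Qed.

Lemma sum_half_le n (t : R) : 0 <= t -> \sum_(i < n) t / 2 ^+ i.+1 <= t.
Proof.
move=> t0; suff -> : \sum_(i < n) t / 2 ^+ i.+1 = t - t / 2 ^+ n.
  by rewrite gerBl divr_ge0// exprn_ge0.
elim: n => [|n IH]; first by rewrite big_ord0 expr0 divr1 subrr.
rewrite big_ord_recr /= IH exprS; field.
by rewrite expf_neq0// pnatr_eq0.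
Qed.

(** The coordinates do not increase distances, so a cover of Q projects to a cover of the cube by
    sets of no larger extent. These are enlarged slightly to open sets; compactness leaves finitely
    many of them, to which [cube_cover_lower] applies. *)
Lemma hausdorff_cube_lower k : exists2 C : R, 0 < C &
  forall m (Q : set 'rV[R]_m) (c : 'I_k -> 'rV[R]_m -> R) (r : R), 0 < r ->
  (forall i z z', `|c i z - c i z'| <= enorm (z - z')) ->
  (forall y : 'I_k -> R, (forall i, `|y i| <= r) ->
     exists2 z, Q z & forall i, c i z = y i) ->
  ((C * r ^+ k)%:E <= hausdorff k Q)%E.
Proof.
have w0 : 0 < unit_ball_volume k :> R := unit_ball_volume_gt0 _.
have sum_ge (u : nat -> \bar R) n : (forall i, 0 <= u i)%E ->
    (\sum_(i < n) u i <= \sum_(i <oo) u i)%E.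
  by move=> u0; rewrite -(big_mkord xpredT u); exact: nneseries_lim_ge.
(* One 2 ^ k comes from the radius in [hausdorff_size], another from [exprD_le], and the last 2 from
   absorbing the enlargement. *)
exists (unit_ball_volume k / 2 ^+ k / 2 ^+ k.+1) => [|m Q c r r0 cl cs].
  by rewrite !divr_gt0 ?exprn_gt0.
apply: (le_trans _ (@hausdorff_premeasure_le R m k 1 Q ltr01)).
apply: le_ereal_inf_tmp => _ [U [dU QU] <-].
have size0 i : (0 <= hausdorff_size k (U i))%E := hausdorff_size_ge0 _ _.
case: k => [|k] in c cl cs w0 size0 *.
  have [z Qz _] := cs (fun=> 0) (fun=> ltac:(by rewrite normr0 ltW)).
  have [i _ Uz] := QU _ Qz.
  apply: le_trans (sum_ge _ i.+1 size0).
  rewrite big_ord_recr /= (le_trans _ (leeDr _ _))//; last by apply: sume_ge0.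
  rewrite /hausdorff_size ifF; last by apply/negbTE/set0P; exists z.
  by rewrite lee_fin /= !expr0 !mulr1 !divr1 expr1 ler_pdivrMr// mul1r; lra.
pose de i : R := if U i == set0 then 0 else fine (ediam (U i)).
have de0 i : 0 <= de i.
  by rewrite /de; case: ifPn => // /set0P U0; rewrite fine_ge0// ediam_ge0.
have deU i z z' : U i z -> U i z' -> enorm (z - z') <= de i.
  move=> Uz Uz'; have Un : U i !=set0 by exists z.
  rewrite /de ifF; last by apply/negbTE/set0P.
  rewrite -lee_fin fineK; first by apply: ereal_sup_ubound; exists (z, z').
  by rewrite ge0_fin_numE ?ediam_ge0// (le_lt_trans (dU i))// ltry.
have sizeE i : hausdorff_size k.+1 (U i) = (unit_ball_volume k.+1 * (de i / 2) ^+ k.+1)%:E.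
  by rewrite /hausdorff_size /de; case: ifP => //; rewrite mul0r exprS mul0r mulr0.
(* The total enlargement: half of what remains after [exprD_le], so that it can be absorbed, and at
   most 1, so that powers of [et i] are bounded by [et i]. *)
pose th : R := Num.min 1 (r ^+ k.+1 / 2 ^+ k.+2).
have th0 : 0 < th by rewrite lt_min ltr01 divr_gt0 ?exprn_gt0.
pose et i : R := th / 2 ^+ i.+1.
have et0 i : 0 < et i by rewrite divr_gt0 ?exprn_gt0.
have et1 i : et i <= 1.
  rewrite ler_pdivrMr ?exprn_gt0// mul1r (@le_trans _ _ 1) ?ge_min ?lexx//.
  by rewrite exprn_ege1// ler1n.
pose W i : set 'rV[R]_k.+1 := [set y | exists2 z, U i z & enorm (\row_j c j z - y) < et i / 2].
have Wo i : open (W i).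
  apply/enorm_openP => y [z Uz zy]; exists (et i / 2 - enorm (\row_j c j z - y)).
    by rewrite subr_gt0.
  move=> y' y'y; exists z => //; apply: le_lt_trans (enorm_triangle _ y _) _.
  by rewrite (enormB y); lra.
pose cube : set 'rV[R]_k.+1 := [set y | forall j, `[- r, r]%classic (y ord0 j)].
have cubeW : cube `<=` \bigcup_i W i.
  move=> y /= cy; have [|z Qz zy] := cs (fun j => y ord0 j).
    by move=> i; have := cy i; rewrite /= in_itv /= ler_norml.
  have [i _ Uz] := QU _ Qz; exists i => //; exists z => //.
  have -> : \row_j c j z - y = 0 by apply/rowP => j; rewrite !mxE zy subrr.
  by rewrite enorm0 divr_gt0.
have : compact cube by apply: (@rV_compact _ _ (fun=> `[- r, r]%classic)) => j; exact: segment_compact.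
rewrite compact_cover => /(_ _ setT W (fun i _ => Wo i) cubeW)[D _ cD].
pose n := (\max_(i <- finmap.enum_fset D) i).+1.
have cn y : (forall j, `|y j| <= r) -> exists i : 'I_n, W i (\row_j y j).
  move=> yr; have [|i /= iD Wi] := cD (\row_j y j).
    by move=> j; rewrite /= mxE in_itv /= -ler_norml.
  have ltin : (i < n)%N by rewrite ltnS; apply: leq_bigmax_seq.
  by exists (Ordinal ltin).
have main : r ^+ k.+1 <= \sum_(i < n) (de i + et i) ^+ k.+1.
  apply: (@cube_cover_lower _ _ (fun i y => W i (\row_j y j))) => // [i|i y y' j].
    by rewrite ltr_wpDl.
  move=> [z Uz zy] [z' Uz' zy'].
  have := coord_le_enorm (\row_j c j z - \row_j y j) j; rewrite !mxE => h1.
  have := coord_le_enorm (\row_j c j z' - \row_j y' j) j; rewrite !mxE => h2.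
  have h3 := le_trans (cl j z z') (deU _ _ _ Uz Uz').
  have -> : y j - y' j = (c j z - c j z') - (c j z - y j) + (c j z' - y' j) by ring.
  apply: le_trans (ler_normD _ _) _.
  apply: le_trans (lerD (ler_normB _ _) (lexx _)) _.
  by move: h1 h2 h3 zy zy' => h1 h2 h3 h4 h5; lra.
apply: le_trans (sum_ge _ n size0); under eq_bigr do rewrite sizeE.
rewrite sumEFin lee_fin -mulr_sumr -!mulrA ler_wpM2l ?(ltW w0)//.
under eq_bigr do rewrite exprMn exprVn; rewrite -mulr_suml [leRHS]mulrC.
rewrite ler_wpM2l ?invr_ge0 ?exprn_ge0//.
have s1 : \sum_(i < n) (de i + et i) ^+ k.+1 <=
    2 ^+ k.+1 * (\sum_(i < n) de i ^+ k.+1 + th).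
  apply: (@le_trans _ _ (\sum_(i < n) 2 ^+ k.+1 * (de i ^+ k.+1 + et i))).
    apply: ler_sum => i _; apply: le_trans (exprD_le _ _ _) _ => //; first exact: ltW.
    rewrite ler_wpM2l ?exprn_ge0// lerD2l exprS.
    by have e0 := ltW (et0 i); rewrite ler_piMr// exprn_ile1.
  rewrite -mulr_sumr ler_wpM2l ?exprn_ge0// big_split lerD2l.
  by apply: sum_half_le; exact: ltW.
have th1 : th <= r ^+ k.+1 / 2 ^+ k.+2 by rewrite ge_min lexx orbT.
have := le_trans main s1; rewrite -ler_pdivrMl ?exprn_gt0//.
have -> : (2 ^+ k.+1)^-1 * r ^+ k.+1 = 2 * (r ^+ k.+1 / 2 ^+ k.+2).
  by rewrite (exprS _ k.+1) invfM; field; rewrite expf_neq0// pnatr_eq0.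
rewrite [X in X <= _ -> _](_ : _ = (2^+ k.+2)^-1 * r ^+ k.+1 + r ^+ k.+1 / 2 ^+ k.+2); last ring.
by rewrite [X in _ -> X <= _]mulrC; lra.
Qed.

End HausdorffLower.

(** * Borel sets are Caratheodory measurable for Hausdorff measure *)

Section MetricOuterMeasure.
Context {R : realType}.
Local Open Scope ereal_scope.

Lemma nneseries_le_of_partial (u : nat -> \bar R) c : (forall i, 0 <= u i) ->
  (forall n, \sum_(i < n) u i <= c) -> \sum_(i <oo) u i <= c.
Proof.
move=> u0 h; apply: lime_le; first by apply: is_cvg_nneseries.
by apply: nearW => n; rewrite big_mkord.
Qed.

Lemma nneseries_ge_partial (u : nat -> \bar R) n : (forall i, 0 <= u i) ->
  \sum_(i < n) u i <= \sum_(i <oo) u i.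
Proof. by move=> u0; rewrite -(big_mkord xpredT u); exact: nneseries_lim_ge. Qed.

Lemma premeasure_antitone m k (e1 e2 : R) (A : set 'rV[R]_m) : (e1 <= e2)%R ->
  hausdorff_premeasure k e2 A <= hausdorff_premeasure k e1 A.
Proof.
move=> e12; apply: le_ereal_inf_tmp => _ [U [dU AU] <-].
apply: ereal_inf_lbound; exists U => //; split=> // i.
by apply: le_trans (dU i) _; rewrite lee_fin.
Qed.

Lemma hausdorff_le_premeasure m k (A : set 'rV[R]_m) c (e0 : R) : (0 < e0)%R ->
  (forall e : R, (0 < e <= e0)%R -> hausdorff_premeasure k e A <= c) ->
  hausdorff k A <= c.
Proof.
move=> e00 h; apply: ge_ereal_sup => _ [e /= ep <-].
apply: le_trans (premeasure_antitone k A (_ : (Num.min e e0 <= e)%R)) (h _ _).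
  by rewrite ge_min lexx.
by rewrite lt_min ep e00 ge_min lexx orbT.
Qed.

(** A covering set of diameter at most e < d cannot meet both A and B, so a cover of the union
    splits into covers of the two. *)
Lemma premeasure_separated m k (e d : R) (A B : set 'rV[R]_m) : (e < d)%R ->
  (forall x y, A x -> B y -> (d <= enorm (x - y))%R) ->
  hausdorff_premeasure k e A + hausdorff_premeasure k e B <=
  hausdorff_premeasure k e (A `|` B).
Proof.
move=> ed AB; apply: le_ereal_inf_tmp => _ [U [dU ABU] <-].
pose S (C : set 'rV[R]_m) i := if `[< exists2 x, U i x & C x >] then U i else set0.
have S0 C i : 0 <= hausdorff_size k (S C i) by exact: hausdorff_size_ge0.
have SC C : C `<=` A `|` B -> hausdorff_premeasure k e C <= \sum_(i <oo) hausdorff_size k (S C i).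
  move=> CAB; apply: ereal_inf_lbound; exists (S C) => //; split => [i|x Cx].
    by rewrite /S; case: ifP => // _; rewrite ediam0 leNye.
  have [i _ Ux] := ABU _ (CAB _ Cx); exists i => //; rewrite /S ifT//.
  by apply/asboolP; exists x.
apply: (le_trans (leeD (SC A (@subsetUl _ _ _)) (SC B (@subsetUr _ _ _)))).
rewrite -nneseriesD//; apply: lee_nneseries => [i _ _|i _]; first by rewrite adde_ge0.
rewrite {1}/S; case: asboolP => [[x Ux Ax]|_]; last first.
  by rewrite {1}/hausdorff_size eqxx add0e /S; case: ifP => // _; rewrite {1}/hausdorff_size eqxx hausdorff_size_ge0.
rewrite /S ifF ?{2}/hausdorff_size ?eqxx ?adde0//.
apply/asboolP => -[y Uy By].
have := AB _ _ Ax By; apply/negP; rewrite -ltNge; apply: le_lt_trans ed.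
by rewrite -lee_fin; apply: le_trans (dU i); apply: ereal_sup_ubound; exists (x, y).
Qed.

Lemma hausdorff_separated m k (d : R) (A B : set 'rV[R]_m) : (0 < d)%R ->
  (forall x y, A x -> B y -> (d <= enorm (x - y))%R) ->
  hausdorff k A + hausdorff k B <= hausdorff k (A `|` B).
Proof.
move=> d0 AB.
have [ABoo|ABoo] := eqVneq (hausdorff k (A `|` B)) +oo; first by rewrite ABoo leey.
have fin C : C `<=` A `|` B -> hausdorff k C \is a fin_num.
  move=> CAB; rewrite ge0_fin_numE ?hausdorff_ge0//.
  by apply: (le_lt_trans (le_hausdorff k CAB)); rewrite ltey.
have fA := fin A (@subsetUl _ _ _); have fB := fin B (@subsetUr _ _ _).
have fpm (C : set 'rV[R]_m) (e : R) : hausdorff k C \is a fin_num -> (0 < e)%R ->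
    hausdorff_premeasure k e C \is a fin_num.
  move=> fC e0; rewrite ge0_fin_numE ?hausdorff_premeasure_ge0//.
  by apply: (le_lt_trans (hausdorff_premeasure_le k C e0)); rewrite ltey_eq fC.
rewrite -leeBrDr//; apply: ge_ereal_sup => _ [e1 /= e10 <-].
rewrite leeBrDr// addeC -leeBrDr ?fpm//; apply: ge_ereal_sup => _ [e2 /= e20 <-].
rewrite leeBrDr ?fpm// addeC.
pose e : R := (Num.min (Num.min e1 e2) (d / 2))%R.
have e0 : (0 < e)%R by rewrite !lt_min e10 e20 divr_gt0.
apply: le_trans (hausdorff_premeasure_le k (A `|` B) e0).
have ed : (e < d)%R by rewrite /e gt_min ltr_pdivrMr// ltr_pMr// ltr1n orbT.
apply: (le_trans _ (premeasure_separated k ed AB)).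
by apply: leeD; apply: premeasure_antitone; rewrite /e !ge_min lexx ?orbT.
Qed.

Lemma hausdorff_separated_seq m k (P : nat -> set 'rV[R]_m) (E : set 'rV[R]_m) :
  (forall n, P n `<=` E) ->
  (forall n, exists2 d : R, (0 < d)%R & forall n' x y, (n < n')%N -> P n x -> P n' y ->
    (d <= enorm (x - y))%R) ->
  forall n, \sum_(i < n) hausdorff k (P i) <= hausdorff k E.
Proof.
move=> PE Psep n.
suff h j : \sum_(i < n) hausdorff k (P (j + i)%N) <=
    hausdorff k (\bigcup_(i in [set i | j <= i]%N) P i).
  apply: (le_trans (h 0%N)); apply: le_hausdorff; exact: bigcup_sub.
elim: n j => [|n IH] j; first by rewrite big_ord0 hausdorff_ge0.
rewrite big_ord_recl addn0.
under eq_bigr do rewrite lift0 addnS -addSn.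
apply: (le_trans (leeD2l _ (IH j.+1))).
have [d d0 sep] := Psep j.
apply: (le_trans (@hausdorff_separated _ k d (P j) _ d0 _)).
  by move=> x y Px [n' /= jn' Py]; exact: sep jn' Px Py.
apply: le_hausdorff => x [Px|[i /= ji Px]]; first by exists j => //=.
by exists i => //=; exact: ltnW.
Qed.

(* Caratheodory's criterion: additivity on separated sets, and the rings between
   two distances 1/n from C whose total measure is at most twice that of E. *)
Lemma closed_caratheodory m k (C : set 'rV[R]_m) : closed C ->
  (@hausdorff R m k).-caratheodory C.
Proof.
move=> cC; apply: le_caratheodory_measurable => E.
change (hausdorff k (E `&` C) + hausdorff k (E `&` ~` C) <= hausdorff k E).
have [->|Eoo] := eqVneq (hausdorff k E) +oo; first by rewrite leey.
pose far n : set 'rV[R]_m := [set x | E x /\ forall y, C y -> (n.+1%:R^-1 <= enorm (x - y))%R].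
pose ring n := far n.+1 `\` far n.
have inv_lt (i j : nat) : (i < j)%N -> (j.+1%:R^-1 < i.+1%:R^-1 :> R)%R.
  by move=> ij; rewrite ltf_pV2 ?posrE// ltr_nat ltnS.
have inv_le (i j : nat) : (i <= j)%N -> (j.+1%:R^-1 <= i.+1%:R^-1 :> R)%R.
  by move=> ij; rewrite lef_pV2 ?posrE// ler_nat ltnS.
have far_mono i j : (i <= j)%N -> far i `<=` far j.
  by move=> ij x [Ex h]; split=> // y Cy; apply: le_trans (h y Cy); exact: inv_le.
have sep n n' x y : (n.+1 < n')%N -> ring n x -> ring n' y ->
    (n.+2%:R^-1 - n.+3%:R^-1 <= enorm (x - y))%R.
  move=> nn' [[Ex hx] _] [[Ey _] /not_andP[//|]].
  move=> /existsNP[z /not_implyP[Cz /negP]]; rewrite -ltNge => yz.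
  have := hx _ Cz; have := enorm_triangle x y z.
  have := inv_le _ _ nn'; move: yz.
  move: (n.+2%:R^-1)%R (n.+3%:R^-1)%R (n'.+1%:R^-1)%R => p q r; lra.
(* Rings whose indices differ by at least 2 are at positive distance, so the rings of one parity add
   up to at most the measure of E. *)
have bound b n : \sum_(i < n) hausdorff k (ring (b + i.*2)%N) <= hausdorff k E.
  apply: (@hausdorff_separated_seq m k (fun i => ring (b + i.*2)%N)) => [i x [[]]//|i].
  exists ((b + i.*2).+2%:R^-1 - (b + i.*2).+3%:R^-1)%R; first by rewrite subr_gt0 inv_lt.
  move=> j x y ij; apply: sep; rewrite -addnS ltn_add2l.
  by rewrite -doubleS leq_double in ij *.
have fE : hausdorff k E \is a fin_num by rewrite ge0_fin_numE ?hausdorff_ge0// ltey.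
have summable : \sum_(i <oo) hausdorff k (ring i) < +oo.
  apply: (@le_lt_trans _ _ (hausdorff k E + hausdorff k E)); last first.
    by rewrite ltey_eq fin_numD fE.
  apply: nneseries_le_of_partial => [i|n]; first exact: hausdorff_ge0.
  apply: le_trans (leeD (bound 0%N n) (bound 1%N n)); rewrite -big_split /=.
  apply: (@le_trans _ _ (\sum_(i < n.*2) hausdorff k (ring i))).
    rewrite -!(big_mkord xpredT (fun i => hausdorff k (ring i))).
    apply: lee_sum_nneg_natr => // [i _ _|]; first exact: hausdorff_ge0.
    by rewrite -addnn leq_addr.
  elim: n => [|n IH]; first by rewrite !big_ord0.
  by rewrite doubleS !big_ord_recr /= -addeA leeD// add0n add1n.
have tail := nneseries_tail_cvg summable (fun i _ => hausdorff_ge0 k (ring i)).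
apply/lee_addgt0Pr => t t0.
have [N _ tN] : \forall N \near \oo, \sum_(N <= i <oo) hausdorff k (ring i) < t%:E.
  by apply: (tail [set x | x < t%:E]); apply: open_ereal_lt'; rewrite lte_fin.
have tN' := tN N (leqnn N).
(* As C is closed, each point of E outside C lies in some [far n]; unless it is already in [far N],
   the least such n places it in a ring. *)
have cover : E `&` ~` C `<=` far N `|` \bigcup_(n in ~` `I_N) ring n.
  move=> x [Ex Cx].
  have [n nx] : exists n, far n x.
    have : open (~` C) by exact: closed_openC.
    move=> /enorm_openP /(_ x Cx)[e e0 h].
    exists (Num.truncn e^-1); split => // y Cy; rewrite leNgt; apply/negP => yx.
    apply: (h y) => //; rewrite enormB; apply: lt_trans yx _.
    by rewrite invf_plt ?posrE// truncnS_gt.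
  have [xN|xN] := pselect (far N x); [by left|right].
  have ex : exists n, `[< far n x >] by exists n; apply/asboolP.
  case: (ex_minnP ex) => -[|j] /asboolP fj jmin; first by case: xN; exact: far_mono fj.
  exists j.
    move=> /= jN; apply: xN; exact: far_mono fj.
  by split => // fx; have := jmin j (introT (asboolP _) fx); rewrite ltnn.
apply: (@le_trans _ _ (hausdorff k (E `&` C) + (hausdorff k (far N) + t%:E))).
  rewrite leeD2l// (le_trans (le_hausdorff k cover))//.
  apply: (le_trans (outer_measureU2 _ _ _)); rewrite leeD2l//.
  apply: le_trans (ltW tN'); exact: outer_measure_sigma_subadditive_tail.
rewrite addeA leeD2r// addeC.
apply: le_trans (@hausdorff_separated _ k N.+1%:R^-1 _ _ _ _) _; first by rewrite invr_gt0.
  by move=> x y [_ h] [_ Cy]; exact: h.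
by apply: le_hausdorff => x [[]|[]].
Qed.

(** Stated for preimages because the Borel partitions live in R^l, while the measure lives on pairs
    (x, n): f will be the first projection. *)
Lemma borel_caratheodory m n k (f : 'rV[R]_n -> 'rV[R]_m) (A : set 'rV[R]_m) :
  continuous f -> <<s [set U : set 'rV[R]_m | open U] >> A ->
  (@hausdorff R n k).-caratheodory (f @^-1` A).
Proof.
move=> cf; have Csigma : sigma_algebra setT
    [set A | (@hausdorff R n k).-caratheodory (f @^-1` A)].
  split => [|B mB|B mB] /=.
  - by rewrite preimage_set0; exact: caratheodory_measurable_set0.
  - rewrite setTD preimage_setC; exact: caratheodory_measurable_setC.
  - rewrite preimage_bigcup; exact: caratheodory_measurable_bigcup.
move=> sA; apply: (smallest_sub Csigma _ sA) => U /= oU.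
rewrite -(setCK U) preimage_setC; apply: caratheodory_measurable_setC.
apply: closed_caratheodory; change (closed (~` (f @^-1` U))); apply: open_closedC.
by move: oU; apply: open_comp => x _; exact: cf.
Qed.

End MetricOuterMeasure.

(** * Gaps of a compact set of reals *)

Section Gaps.
Context {R : realType}.
Implicit Types (K : set R).

(** For closed K these are the bounded components of the complement. *)
Definition gap K a b := [/\ K a, K b, a < b & forall t, a < t < b -> ~ K t].

Lemma gap_disjoint K a b a' b' : gap K a b -> gap K a' b' -> (a', b') != (a, b) ->
  b' <= a \/ b <= a'.
Proof.
move=> [Ka Kb ab h] [Ka' Kb' ab' h'] ne.
have [|ab1] := leP b' a; first by left.
have [|a'b] := leP b a'; first by right.
exfalso; move/eqP: ne; apply.
have aa' : a' = a.
  apply: le_anti; apply/andP; split; rewrite leNgt; apply/negP => l.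
    by apply: (h a') => //; rewrite l a'b.
  by apply: (h' a) => //; rewrite l ab1.
rewrite aa'; congr pair; apply: le_anti; apply/andP; split; rewrite leNgt; apply/negP => l.
  by apply: (h' b) => //; rewrite aa' ab l.
by apply: (h b') => //; rewrite l ab1.
Qed.

(** Induction on the number of gaps: the first one, from a to b, splits the others into those within
    [p, a] and those within [b, q]. *)
Lemma gap_sum_le K (s : seq (R * R)) p q : p <= q -> uniq s ->
  (forall g, g \in s -> [/\ gap K g.1 g.2, p <= g.1 & g.2 <= q]) ->
  \sum_(g <- s) (g.2 - g.1) <= q - p.
Proof.
have [n] := ubnP (size s); elim: n s p q => // n IH [|[a b] s] p q sn pq.
  by rewrite big_nil subr_ge0.
rewrite ltnS /= in sn => /= /andP[nab us] h.
have [gab pa bq] := h (a, b) (mem_head _ _); rewrite /= in gab pa bq.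
have hs g : g \in s -> [/\ gap K g.1 g.2, p <= g.1 & g.2 <= q].
  by move=> gs; apply: h; rewrite inE gs orbT.
have dis g : g \in s -> g.2 <= a \/ b <= g.1.
  move=> gs; have [gg _ _] := hs g gs; case: g gs gg => a' b' gs gg.
  by apply: gap_disjoint gab gg _; apply: contraNneq nab => <-.
rewrite big_cons /= (bigID (fun g => g.2 <= a)) /= -!(big_filter s).
have size_f (P : pred (R * R)) : (size (seq.filter P s) < n)%N.
  by rewrite (leq_ltn_trans _ sn)// size_filter count_size.
have h1 : \sum_(g <- [seq g <- s | g.2 <= a]) (g.2 - g.1) <= a - p.
  apply: IH => //; first exact: filter_uniq.
  by move=> g; rewrite mem_filter => /andP[ga /hs[? ? _]].
have h2 : \sum_(g <- [seq g <- s | ~~ (g.2 <= a)]) (g.2 - g.1) <= q - b.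
  apply: IH => //; first exact: filter_uniq.
  move=> g; rewrite mem_filter => /andP[ga gs]; have [? _ ?] := hs _ gs.
  by split => //; case: (dis _ gs) => // ga'; rewrite ga' in ga.
by move: h1 h2; lra.
Qed.

(** A duplicate-free list of greatest length omits nothing, as it could be extended otherwise. *)
Lemma bounded_card_seq (T : eqType) (P : T -> Prop) N :
  (forall s, uniq s -> (forall x, x \in s -> P x) -> (size s <= N)%N) ->
  exists s, uniq s /\ forall x, x \in s <-> P x.
Proof.
move=> h.
pose Q n := `[< exists s, [/\ uniq s, forall x, x \in s -> P x & size s = n] >].
have Q0 : exists n, Q n by exists 0%N; apply/asboolP; exists [::].
have QN n : Q n -> (n <= N)%N by move=> /asboolP[s [us sP <-]]; exact: h.
case: (ex_maxnP Q0 QN) => n /asboolP[s [us sP <-]] smax.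
exists s; split => // x; split; first exact: sP.
move=> Px; apply/negPn/negP => xs.
suff : ((size s).+1 <= size s)%N by rewrite ltnn.
apply: smax; apply/asboolP; exists (x :: s); split => //=; first by rewrite xs.
by move=> y; rewrite inE => /orP[/eqP ->|/sP].
Qed.

Definition long_gap K d : R * R -> Prop := fun g => gap K g.1 g.2 /\ d < g.2 - g.1.

(** A list fixed by choice. For bounded K and d > 0 it exists by [gaps_spec], and the default is not
    met. *)
Definition gaps K d : seq (R * R) :=
  xget [::] [set s | uniq s /\ forall g, g \in s <-> long_gap K d g].

Definition gap_count K d := size (gaps K d).

Section Bounded.
Variables (K : set R) (p q : R).
Hypotheses (Kpq : K `<=` `[p, q]).

Let gapPQ g : gap K g.1 g.2 -> p <= g.1 /\ g.2 <= q.
Proof. by move=> [/Kpq + /Kpq]; rewrite /= !in_itv /= => /andP[? _] /andP[]. Qed.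

Lemma gaps_spec d : 0 < d ->
  uniq (gaps K d) /\ forall g, g \in gaps K d <-> long_gap K d g.
Proof.
move=> d0; rewrite /gaps; case: xgetP => //= /(_ _) none; exfalso.
have : exists s, uniq s /\ forall g, g \in s <-> long_gap K d g.
  apply: (@bounded_card_seq _ _ (Num.truncn ((q - p) / d))) => s us sP.
  case: s us sP => [//|g s] us sP.
  have pq : p <= q.
    have [[Ka _ _ _] _] := sP g (mem_head _ _).
    by have := Kpq Ka; rewrite /= in_itv /= => /andP[]; exact: le_trans.
  have : \sum_(x <- g :: s) (x.2 - x.1) <= q - p.
    apply: (@gap_sum_le K) => // x xs; have [gx _] := sP _ xs.
    by have [? ?] := gapPQ gx.
  move=> h1; rewrite truncn_ge_nat ?divr_ge0 ?subr_ge0// ?(ltW d0)// ler_pdivlMr//.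
  apply: le_trans h1; rewrite [leLHS]mulr_natl -iter_addr_0 -count_predT -big_const_seq.
  rewrite big_seq [leRHS]big_seq; apply: ler_sum => x /sP[_ /ltW]//.
by move=> [s hs]; exact: (none s).
Qed.

Lemma gaps_uniq d : 0 < d -> uniq (gaps K d). Proof. by case/gaps_spec. Qed.

Lemma mem_gaps d g : 0 < d -> g \in gaps K d <-> long_gap K d g.
Proof. by case/gaps_spec. Qed.

Lemma gaps_sum_le d (P : pred (R * R)) : 0 < d -> p <= q ->
  \sum_(g <- gaps K d | P g) (g.2 - g.1) <= q - p.
Proof.
move=> d0 pq; rewrite -big_filter; apply: (@gap_sum_le K) => //.
  by rewrite filter_uniq// gaps_uniq.
by move=> g; rewrite mem_filter => /andP[_ /(mem_gaps _ d0)[gg _]]; have [] := gapPQ gg.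
Qed.

Lemma gap_count_ge d (s : seq (R * R)) : 0 < d -> uniq s ->
  (forall g, g \in s -> long_gap K d g) -> (size s <= gap_count K d)%N.
Proof. by move=> d0 us h; apply: uniq_leq_size => // g /h /(mem_gaps _ d0). Qed.

Lemma gap_count_antitone d d' : 0 < d -> d <= d' -> (gap_count K d' <= gap_count K d)%N.
Proof.
move=> d0 dd'; have d'0 := lt_le_trans d0 dd'.
apply: gap_count_ge => //; first exact: gaps_uniq.
by move=> g /(mem_gaps _ d'0)[gg lg]; split => //; exact: le_lt_trans lg.
Qed.

Lemma gap_lengths_countable : countable [set e : R | exists a b, gap K a b /\ b - a = 2 * e].
Proof.
have -> : [set e : R | exists a b, gap K a b /\ b - a = 2 * e] =
    \bigcup_n (fun g : R * R => (g.2 - g.1) / 2) @` [set` gaps K n.+1%:R^-1].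
  apply/seteqP; split => [e [a [b [gab ab]]]|e [n _ [g /= gs <-]]].
    have [_ _ ltab _] := gab.
    exists (Num.truncn (b - a)^-1) => //; exists (a, b); last by rewrite /= ab mulrC mulKf.
    rewrite /= mem_gaps ?invr_gt0//; split => //=.
    by rewrite invf_plt ?posrE ?subr_gt0// truncnS_gt.
  move/mem_gaps : gs => /(_ _)[|gg _]; first by rewrite invr_gt0.
  by exists g.1, g.2; split => //; rewrite mulrC divfK.
apply: bigcup_countable => // n _; apply/finite_set_countable/finite_image.
exact: finite_seq.
Qed.

(* Dyadic decomposition: there are at most O(x ^ -s) gaps with lengths between
   2x and 4x, where x = e / 2 ^ j. *)
Lemma small_gap_sum_le (s t d e : R) (S : seq (R * R)) n :
  s < 1 -> 0 < e < d ->
  (forall x, 0 < x < d -> x `^ s * (gap_count K (2 * x))%:R <= t) ->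
  uniq S -> (forall g, g \in S -> gap K g.1 g.2 /\ 2 * e / 2 ^+ n < g.2 - g.1 <= 2 * e) ->
  \sum_(g <- S) (g.2 - g.1) <=
    4 * t * e `^ (1 - s) * \sum_(i < n) (2 `^ (s - 1)) ^+ i.+1.
Proof.
move=> s1 /andP[e0 ed] ht; elim: n S => [|n IH] S uS hS.
  case: S uS hS => [|g S] uS hS; first by rewrite big_nil big_ord0 mulr0.
  have [_] := hS g (mem_head _ _); rewrite expr0 divr1 => /andP[/lt_le_trans h /h].
  by rewrite ltxx.
pose x := e / 2 ^+ n.+1.
have x0 : 0 < x by rewrite divr_gt0 ?exprn_gt0.
have xd : x < d.
  apply: le_lt_trans ed; rewrite ler_pdivrMr ?exprn_gt0// ler_peMr ?(ltW e0)//.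
  by rewrite exprn_ege1// ler1n.
have x2 : 2 * e / 2 ^+ n = 4 * x.
  by rewrite /x exprS; field; rewrite expf_neq0// pnatr_eq0.
have x1 : 2 * e / 2 ^+ n.+1 = 2 * x by rewrite /x mulrA.
(* Gaps longer than 4x = 2e / 2 ^ n go to the induction hypothesis; those with length in ]2x, 4x]
   form the last dyadic block. *)
rewrite (bigID (fun g => g.2 - g.1 <= 4 * x)) /= big_ord_recr /= addrC mulrDr.
apply: lerD.
  rewrite -big_filter; apply: IH; first exact: filter_uniq.
  move=> g; rewrite mem_filter -ltNge x2 => /andP[h1 /hS[gg /andP[_ ->]]].
  by rewrite h1.
rewrite -big_filter; set S' := seq.filter _ _.
have cS' : (size S' <= gap_count K (2 * x)%R)%N.
  apply: gap_count_ge; first by rewrite mulr_gt0.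
    exact: filter_uniq.
  by move=> g; rewrite mem_filter => /andP[_ /hS[gg /andP[+ _]]]; rewrite x1.
apply: (@le_trans _ _ (\sum_(g <- S') 4 * x)).
  rewrite big_seq [leRHS]big_seq; apply: ler_sum => g.
  by rewrite mem_filter => /andP[].
rewrite big_const_seq count_predT iter_addr_0 -[leLHS]mulr_natl.
apply: (@le_trans _ _ ((gap_count K (2 * x))%:R * (4 * x))).
  by rewrite ler_wpM2r ?mulr_ge0 ?ler_nat// ltW.
have hx := ht x; rewrite x0 xd in hx; have {}hx := hx isT.
have xs : 0 < x `^ s by rewrite powR_gt0.
have -> : 4 * t * e `^ (1 - s) * (2 `^ (s - 1)) ^+ n.+1 = 4 * t * (x / x `^ s).
  rewrite -mulrA; congr (_ * _).
  have -> : x / x `^ s = x `^ (1 - s).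
    by rewrite powRB ?powRr1 ?ltW// gt_eqF.
  rewrite /x powRM ?invr_ge0 ?exprn_ge0 ?(ltW e0)//; congr (_ * _).
  rewrite -powR_mulrn ?powR_ge0// -powRrM -[X in _ = X `^ _]powR_inv1 ?exprn_ge0//.
  rewrite -powR_mulrn// -!powRrM; congr powR; ring.
rewrite mulrCA -mulrA ler_wpM2l// [leRHS]mulrCA [leLHS]mulrC ler_wpM2l ?(ltW x0)//.
by rewrite ler_pdivlMr// mulrC.
Qed.

Lemma geometric_sum_le (r : R) n : 0 <= r < 1 -> \sum_(i < n) r ^+ i.+1 <= (1 - r)^-1.
Proof.
move=> /andP[r0 r1].
have h : \sum_(i < n) r ^+ i.+1 <= (1 - r ^+ n) / (1 - r).
  have r10 : 0 < 1 - r by rewrite subr_gt0.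
  elim: n => [|n IH]; first by rewrite big_ord0 expr0 subrr mul0r.
  rewrite big_ord_recr /=; apply: (le_trans (lerD IH (lexx _))).
  rewrite -lerBrDl -mulrBl ler_pdivlMr//.
  have -> : 1 - r ^+ n.+1 - (1 - r ^+ n) = r ^+ n * (1 - r) by rewrite exprS; ring.
  rewrite ler_wpM2r ?(ltW r10)// exprS ler_piMl ?exprn_ge0// ltW//.
apply: (le_trans h); rewrite ler_piMl ?invr_ge0 ?subr_ge0 ?(ltW r1)//.
by rewrite gerBl exprn_ge0.
Qed.

(* In the upper bound for the total curvature, a gap of length g contributes a
   band of width min(1, g / 2e) of the sphere of directions; the gaps
   shorter than 2eh are dealt with together. *)
Definition gap_energy e h :=
  \sum_(g <- gaps K (2 * e * h)) Num.min 1 ((g.2 - g.1) / (2 * e)).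

Lemma gap_energy_ge0 e h : 0 < e -> 0 < h -> 0 <= gap_energy e h.
Proof.
move=> e0 h0; rewrite /gap_energy big_seq; apply: sumr_ge0 => g.
move=> /(mem_gaps _ (mulr_gt0 (mulr_gt0 (ltr0n _ 2) e0) h0))[[_ _ ab _] _].
by rewrite le_min ler01 divr_ge0 ?mulr_ge0 ?subr_ge0// ltW.
Qed.

Lemma gap_energy_le_length e h : p <= q -> 0 < e -> 0 < h ->
  gap_energy e h <= (q - p) / (2 * e).
Proof.
move=> pq e0 h0; have e2 : 0 < 2 * e by rewrite mulr_gt0.
have d0 : 0 < 2 * e * h by rewrite mulr_gt0.
apply: (@le_trans _ _ (\sum_(g <- gaps K (2 * e * h)) (g.2 - g.1) / (2 * e))).
  by apply: ler_sum => g _; rewrite ge_min lexx orbT.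
rewrite -mulr_suml ler_wpM2r ?invr_ge0 ?(ltW e2)//; exact: gaps_sum_le.
Qed.

(** A gap longer than 2e counts for at most 1, and the shorter ones are summed dyadically. The bound
    does not depend on h, so the mesh of the cover can later go to 0 at fixed e. *)
Lemma gap_energy_le_count (s t d e h : R) : s < 1 -> 0 < e < d -> 0 < h -> 0 <= t ->
  (forall x, 0 < x < d -> x `^ s * (gap_count K (2 * x))%:R <= t) ->
  gap_energy e h <=
    (gap_count K (2 * e))%:R + 2 / (1 - 2 `^ (s - 1)) * t * e `^ (- s).
Proof.
move=> s1 /andP[e0 ed] h0 t0 ht; have e2 : 0 < 2 * e by rewrite mulr_gt0.
have d0 : 0 < 2 * e * h by rewrite mulr_gt0.
rewrite /gap_energy (bigID (fun g => 2 * e < g.2 - g.1)) /=; apply: lerD.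
  apply: (@le_trans _ _ (\sum_(g <- gaps K (2 * e * h) | 2 * e < g.2 - g.1) 1)).
    by apply: ler_sum => g _; rewrite ge_min lexx.
  rewrite -big_filter big_const_seq count_predT iter_addr_0 ler_nat.
  apply: gap_count_ge => //; first by rewrite filter_uniq// gaps_uniq.
  by move=> g; rewrite mem_filter => /andP[lg /(mem_gaps _ d0)[gg _]].
apply: (@le_trans _ _ (\sum_(g <- gaps K (2 * e * h) | ~~ (2 * e < g.2 - g.1)) (g.2 - g.1) / (2 * e))).
  by apply: ler_sum => g _; rewrite ge_min lexx orbT.
rewrite -mulr_suml ler_pdivrMr//.
(* Enough dyadic blocks to reach down to the cutoff 2eh. *)
pose n := (Num.truncn h^-1).+1.
have hn : (2 ^+ n)^-1 <= h.
  rewrite invf_ple ?posrE ?exprn_gt0//; apply: ltW.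
  apply: lt_le_trans (truncnS_gt _) _; rewrite -natrX ler_nat -/n ltnW//.
  exact: ltn_expl.
rewrite -big_filter.
have r1 : (0 : R) <= 2 `^ (s - 1) < 1.
  rewrite powR_ge0 /= -opprB powRN invf_lt1 ?powR_gt0// -[X in X < _](congr1 (fun f : R -> R => f (1 - s)) (powR1 R)).
  by rewrite gt0_ltr_powR ?nnegrE//; lra.
apply: (le_trans (@small_gap_sum_le s t d e _ n s1 _ ht _ _)).
- by rewrite e0.
- by rewrite filter_uniq// gaps_uniq.
- move=> g; rewrite mem_filter -leNgt => /andP[lg /(mem_gaps _ d0)[gg hg]].
  split => //; rewrite lg andbT; apply: le_lt_trans hg.
  by rewrite ler_wpM2l// ltW.
have -> : 2 / (1 - 2 `^ (s - 1)) * t * e `^ (- s) * (2 * e) =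
    4 * t * e `^ (1 - s) * (1 - 2 `^ (s - 1))^-1.
  rewrite [e `^ (1 - s)]powRD ?powRr1 ?(ltW e0)//; last by rewrite lt0r_neq0 ?implybT.
  ring.
rewrite ler_wpM2l ?mulr_ge0 ?powR_ge0//; exact: geometric_sum_le.
Qed.

(** The summand 1 stands for the right end of K, which contributes like a long gap; it excludes s =
    0 even when K has no gaps. *)
Definition gap_decay s := 0 <= s /\ forall t, 0 < t -> exists2 d, 0 < d &
  forall e, 0 < e < d -> e `^ s * (1 + (gap_count K (2 * e))%:R) <= t.

(* For s > 1 no hypothesis on the gaps is needed, as their lengths are summable. *)
Lemma gap_energy_decay s : p <= q -> (gap_decay s /\ s < 1) \/ 1 < s ->
  forall t, 0 < t -> exists2 d, 0 < d & forall e h, 0 < e < d -> 0 < h ->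
  e `^ s * (1 + gap_energy e h) <= t.
Proof.
move=> pq [[[s0 sd] s1]|s1] t t0.
  pose c := 2 / (1 - 2 `^ (s - 1)) : R.
  have c0 : 0 <= c.
    rewrite divr_ge0// subr_ge0 -[leRHS](powRr0 2).
    by rewrite ler_powR//; lra.
  (* The hypothesis is used for the long gaps, at cost t / (1 + c), and for the short ones, at cost
     c t / (1 + c). *)
  have tc0 : 0 < t / (1 + c) by rewrite divr_gt0// ltr_pwDl.
  have [d d0 hd] := sd _ tc0; exists d => // e h ed h0.
  have e0 : 0 < e by case/andP: ed.
  have es0 : 0 < e `^ s by rewrite powR_gt0.
  have := gap_energy_le_count s1 ed h0 (ltW tc0).
  have ht x : 0 < x < d -> x `^ s * (gap_count K (2 * x))%:R <= t / (1 + c).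
    move=> /hd; apply: le_trans; rewrite ler_wpM2l ?powR_ge0//; lra.
  move=> /(_ ht) en; apply: (@le_trans _ _ (e `^ s * (1 + ((gap_count K (2 * e))%:R + c * (t / (1 + c)) * e `^ (- s))))).
    by rewrite ler_wpM2l ?(ltW es0)// lerD2l.
  rewrite addrA mulrDr -lerBrDr; apply: (le_trans (hd e ed)).
  have -> : e `^ s * (c * (t / (1 + c)) * e `^ (- s)) = c * (t / (1 + c)).
    by rewrite powRN mulrCA divff ?mulr1// gt_eqF.
  have -> : c * (t / (1 + c)) = t - t / (1 + c).
    by field; rewrite gt_eqF// ltr_pwDl.
  by rewrite subKr.
pose A := 1 + (q - p) / 2 : R.
have A0 : 0 < A by rewrite /A; lra.
have s10 : 0 < s - 1 by rewrite subr_gt0.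
(* For e <= 1 the quantity is at most e ^ (s - 1) A; this is the solution of e ^ (s - 1) A <= t. *)
exists (Num.min 1 ((t / A) `^ (s - 1)^-1)).
  by rewrite lt_min ltr01 powR_gt0// divr_gt0.
move=> e h /andP[e0]; rewrite lt_min => /andP[e1 ed] h0.
apply: (@le_trans _ _ (e `^ s * (1 + (q - p) / (2 * e)))).
  by rewrite ler_wpM2l ?powR_ge0// lerD2l gap_energy_le_length.
have es : e `^ s = e `^ (s - 1) * e.
  by rewrite -{3}(powRr1 (ltW e0)) -powRD ?subrK// lt0r_neq0 ?implybT.
have eA : e `^ (s - 1) <= t / A.
  have tA : 0 <= t / A by rewrite divr_ge0 ?(ltW t0)// ltW.
  have <- : (t / A) `^ ((s - 1)^-1 * (s - 1)) = t / A.
    by rewrite mulVf ?powRr1// lt0r_neq0.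
  rewrite powRrM; apply: ge0_ler_powR; rewrite ?nnegrE ?(ltW s10) ?(ltW e0) ?powR_ge0 ?(ltW ed)//.
rewrite es -mulrA mulrDr mulr1.
have -> : e * ((q - p) / (2 * e)) = (q - p) / 2 by field; rewrite gt_eqF.
apply: (@le_trans _ _ (e `^ (s - 1) * A)); last by rewrite -ler_pdivlMr.
by rewrite ler_wpM2l ?powR_ge0// /A lerD2r ltW.
Qed.

End Bounded.

Lemma compact_has_min (A : set R) : compact A -> A !=set0 ->
  exists2 x, A x & forall y, A y -> x <= y.
Proof.
move=> cA A0.
have cid : {within A, continuous (id : R -> R)} by apply: continuous_subspaceT => x.
have [x xA h] := compact_EVT_min A0 cA cid.
by exists x => [|y Ay]; [rewrite inE in xA|apply: h; rewrite inE].
Qed.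

Lemma compact_has_max (A : set R) : compact A -> A !=set0 ->
  exists2 x, A x & forall y, A y -> y <= x.
Proof.
move=> cA A0.
have cid : {within A, continuous (id : R -> R)} by apply: continuous_subspaceT => x.
have [x xA h] := compact_EVT_max A0 cA cid.
by exists x => [|y Ay]; [rewrite inE in xA|apply: h; rewrite inE].
Qed.

(** * Distance from a compact set of reals *)

Section Distance.
Variable K : set R.
Hypotheses (cK : compact K) (K0 : K !=set0).

Definition dist1 t := inf [set `|t - k| | k in K].

Lemma dist1_spec t : (exists2 k, K k & dist1 t = `|t - k|) /\
  forall k, K k -> dist1 t <= `|t - k|.
Proof.
have lb : has_lbound [set `|t - k| | k in K] by exists 0 => _ [k _ <-].
have le k : K k -> dist1 t <= `|t - k|.
  by move=> Kk; apply: ge_inf => //; exists k.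
split => //.
have cf : {within K, continuous (fun k : R => `|t - k|)}.
  apply: continuous_subspaceT => x; apply: cvg_norm; apply: cvgB; [exact: cvg_cst|exact: cvg_id].
have [k kK h] := compact_EVT_min K0 cK cf; rewrite inE in kK.
exists k => //; apply: le_anti; rewrite le//=.
by apply: lb_le_inf; [exists `|t - k|, k|move=> _ [k' Kk' <-]; apply: h; rewrite inE].
Qed.

Lemma dist1_le t k : K k -> dist1 t <= `|t - k|.
Proof. by have [_] := dist1_spec t; exact. Qed.

Lemma dist1_attained t : exists2 k, K k & dist1 t = `|t - k|.
Proof. by have [] := dist1_spec t. Qed.

Lemma dist1_ge t r : (forall k, K k -> r <= `|t - k|) -> r <= dist1 t.
Proof. by move=> h; have [k Kk ->] := dist1_attained t; exact: h. Qed.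

Lemma dist1_ge0 t : 0 <= dist1 t.
Proof. by have [k _ ->] := dist1_attained t. Qed.

Let slice (a b : R) : compact (K `&` `[a, b]).
Proof. by apply: compact_closedI => //; exact: itv_closed. Qed.

Lemma right_gap k k' d : K k -> K k' -> k < k' -> 0 < d ->
  (forall t, k < t < k + d -> ~ K t) ->
  exists b, [/\ gap K k b, k + d <= b & b <= k'].
Proof.
move=> Kk Kk' kk' d0 h.
have kd : k + d <= k'.
  by rewrite leNgt; apply/negP => l; apply: (h k') => //; rewrite kk' l.
have [|b [Kb]] := @compact_has_min (K `&` `[k + d, k']) (@slice _ _).
  by exists k'; split => //; rewrite /= in_itv /= kd lexx.
rewrite /= in_itv /= => /andP[db bk'] bmin.
exists b; split => //; split => //; first by apply: lt_le_trans db; rewrite ltrDl.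
move=> t /andP[kt tb] Kt.
have [td|dt] := ltP t (k + d); first by apply: (h t) => //; rewrite kt td.
suff : b <= t by rewrite leNgt tb.
by apply: bmin; split => //; rewrite /= in_itv /= dt (le_trans (ltW tb)).
Qed.

Lemma left_gap k k' d : K k -> K k' -> k' < k -> 0 < d ->
  (forall t, k - d < t < k -> ~ K t) ->
  exists a, [/\ gap K a k, a <= k - d & k' <= a].
Proof.
move=> Kk Kk' kk' d0 h.
have kd : k' <= k - d.
  by rewrite leNgt; apply/negP => l; apply: (h k') => //; rewrite kk' l.
have [|a [Ka]] := @compact_has_max (K `&` `[k', k - d]) (@slice _ _).
  by exists k'; split => //; rewrite /= in_itv /= kd lexx.
rewrite /= in_itv /= => /andP[k'a ad] amax.
exists a; split => //; split => //; first by rewrite (le_lt_trans ad)// gtrBl.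
move=> t /andP[at_ tk] Kt.
have [dt|td] := ltP (k - d) t; first by apply: (h t) => //; rewrite dt tk.
suff : t <= a by rewrite leNgt at_.
by apply: amax; split => //; rewrite /= in_itv /= td (le_trans k'a (ltW at_)).
Qed.

(* The half-lengths of the gaps are the critical values of the distance from K. *)
Definition noncritical e := 0 < e /\ forall a b, gap K a b -> b - a <> 2 * e.

(** Only the finitely many gaps longer than e can have length close to 2e, so none of the lengths
    comes arbitrarily close to 2e. *)
Lemma noncritical_margin e : noncritical e ->
  exists e1 e2, [/\ 0 < e1, e1 < e, e < e2 &
    forall a b, gap K a b -> 2 * e1 <= b - a -> 2 * e2 <= b - a].
Proof.
move=> [e0 he].
have [p [q Kpq]] : exists p q, K `<=` `[p, q].
  have [p _ hp] := compact_has_min cK K0; have [q _ hq] := compact_has_max cK K0.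
  by exists p, q => x Kx; rewrite /= in_itv /= hp// hq.
have margin (s : seq (R * R)) : (forall g, g \in s -> g.2 - g.1 <> 2 * e) ->
    exists2 mu, 0 < mu & forall g, g \in s -> mu <= `|(g.2 - g.1) - 2 * e|.
  elim: s => [|g s IH] hs; first by exists 1.
  have [g' gs'|mu mu0 hmu] := IH; first by apply: hs; rewrite inE gs' orbT.
  exists (Num.min mu `|(g.2 - g.1) - 2 * e|).
    rewrite lt_min mu0 normr_gt0 subr_eq0; apply/eqP/hs; exact: mem_head.
  move=> g'; rewrite inE => /orP[/eqP ->|/hmu h]; first by rewrite ge_min lexx orbT.
  by rewrite ge_min h.
have [|mu mu0 hmu] := margin (gaps K e).
  by move=> g /(mem_gaps Kpq _ e0)[gg _]; exact: he gg.
pose nu := Num.min mu e; have nu0 : 0 < nu by rewrite lt_min mu0.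
have nue : nu <= e by rewrite ge_min lexx orbT.
have numu : nu <= mu by rewrite ge_min lexx.
(* As nu <= e, a gap of length at least 2 (e - nu / 3) is longer than e, hence in the list; its
   length differs from 2e by at least nu, so it exceeds 2 (e + nu / 3). *)
exists (e - nu / 3), (e + nu / 3); split; try lra.
move=> a b gab ab.
have /hmu /= : (a, b) \in gaps K e by apply/(mem_gaps Kpq _ e0); split => //=; lra.
by rewrite ler_normr => /orP[]; lra.
Qed.

(** Walk from t away from its nearest point k, up to distance r from k. The next point of K on that
    side ends a gap of length at least 2 [dist1 t] >= 2 e1, hence at least 2 e2 >= 2r, so k stays
    nearest. *)
Lemma noncritical_escape e : noncritical e ->
  exists e1 e2, [/\ 0 < e1, e1 < e, e < e2 & forall t r, e1 <= dist1 t ->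
    dist1 t <= r -> r <= e2 ->
    exists2 t', `|t' - t| <= r - dist1 t & r <= dist1 t'].
Proof.
move=> /noncritical_margin[e1 [e2 [e10 e1e ee2 hm]]]; exists e1, e2; split => // t r e1t tr re2.
have [k Kk tk] := dist1_attained t.
have dt k' : K k' -> dist1 t <= `|t - k'| by exact: dist1_le.
have [kt|kt] := ltP k t.
  have tE : t = k + dist1 t by rewrite tk gtr0_norm ?subr_gt0//; lra.
  exists (k + r); first by rewrite ger0_norm; lra.
  apply: dist1_ge => k' Kk'; have [k'k|k'k] := leP k' k.
    by rewrite ger0_norm; lra.
  have [||b [gb db bk']] := @right_gap k k' (2 * dist1 t) Kk Kk' k'k; first lra.
    move=> x /andP[kx xd] /dt; apply/negP; rewrite -ltNge ltr_norml.
    by apply/andP; split; lra.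
  have := hm _ _ gb; have : 2 * e1 <= b - k by lra.
  move=> h1 /(_ h1) h2; rewrite ler0_norm; lra.
have tE : t = k - dist1 t by rewrite tk ler0_norm ?subr_le0//; lra.
exists (k - r); first by rewrite ler0_norm; lra.
apply: dist1_ge => k' Kk'; have [k'k|k'k] := leP k k'.
  by rewrite ler0_norm; lra.
have [||a [ga da ak']] := @left_gap k k' (2 * dist1 t) Kk Kk' k'k; first lra.
  move=> x /andP[kx xd] /dt; apply/negP; rewrite -ltNge ltr_norml.
  by apply/andP; split; lra.
have := hm _ _ ga; have : 2 * e1 <= k - a by lra.
move=> h1 /(_ h1) h2; rewrite ger0_norm; lra.
Qed.

End Distance.
End Gaps.

(** * Parallel sets of a compact subset of a line *)

Section LineGeometry.
Context {R : realType} {m : nat}.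
Variables (x0 u : 'rV[R]_m) (K : set R).
Hypotheses (u1 : edot u u = 1) (cK : compact K) (K0 : K !=set0).

Definition axial (y : 'rV[R]_m) : R := edot (y - x0) u.
Definition transverse (y : 'rV[R]_m) := y - x0 - axial y *: u.
Definition axis_point (k : R) := x0 + k *: u.

(** By Pythagoras, the distance from y to the points x0 + k u with k in K. *)
Definition line_dist (y : 'rV[R]_m) : R :=
  Num.sqrt (dist1 K (axial y) ^+ 2 + edot (transverse y) (transverse y)).

Lemma edot_transverse y : edot (transverse y) u = 0.
Proof. by rewrite /transverse edotBl edotZl u1 mulr1 subrr. Qed.

Lemma sub_axis_point y k : y - axis_point k = (axial y - k) *: u + transverse y.
Proof.
rewrite /transverse /axis_point scalerBl opprD addrA [RHS]addrC.
by rewrite addrA subrK.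
Qed.

Lemma edot_sub_axis_point y k :
  edot (y - axis_point k) (y - axis_point k) =
  (axial y - k) ^+ 2 + edot (transverse y) (transverse y).
Proof.
rewrite sub_axis_point; move: (edot_transverse y).
move: (transverse y) => q qu; rewrite !edotE (edotC u q) qu u1; ring.
Qed.

Lemma axialD y v : axial (y + v) = axial y + edot v u.
Proof. by rewrite /axial -edotDl; congr edot; apply/rowP => i; rewrite !mxE; ring. Qed.

Lemma transverseD y v : transverse (y + v) = transverse y + (v - edot v u *: u).
Proof. by rewrite /transverse axialD; apply/rowP => i; rewrite !mxE; ring. Qed.

Lemma line_dist_sqr y : line_dist y ^+ 2 =
  dist1 K (axial y) ^+ 2 + edot (transverse y) (transverse y).
Proof. by rewrite sqr_sqrtr// addr_ge0 ?sqr_ge0 ?edot_ge0. Qed.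

Lemma line_dist_ge0 y : 0 <= line_dist y. Proof. exact: sqrtr_ge0. Qed.

Lemma line_dist_le y k : K k -> line_dist y <= enorm (y - axis_point k).
Proof.
move=> Kk; apply: ler_wsqrtr; rewrite edot_sub_axis_point lerD2r.
rewrite -[leRHS]real_normK ?num_real// ler_sqr ?nnegrE ?dist1_ge0//.
exact: dist1_le.
Qed.

Lemma line_dist_attained y : exists2 k, K k & line_dist y = enorm (y - axis_point k).
Proof.
have [k Kk h] := dist1_attained cK K0 (axial y); exists k => //.
by rewrite /line_dist h real_normK ?num_real// /enorm edot_sub_axis_point.
Qed.

Lemma line_dist_ge y r : (forall k, K k -> r <= enorm (y - axis_point k)) -> r <= line_dist y.
Proof. by move=> h; have [k Kk ->] := line_dist_attained y; exact: h. Qed.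

Lemma line_dist_lip y y' : line_dist y <= line_dist y' + enorm (y - y').
Proof.
have [k Kk ->] := line_dist_attained y'; apply: (le_trans (line_dist_le y Kk)).
by rewrite [leRHS]addrC; exact: enorm_triangle.
Qed.

Lemma line_dist_axis_eq y k : 0 < line_dist y ->
  enorm (y - axis_point k) = line_dist y -> `|axial y - k| = dist1 K (axial y).
Proof.
move=> _ /(congr1 (fun r => r ^+ 2)); rewrite enorm_sqr edot_sub_axis_point line_dist_sqr.
move=> /addIr h; apply/eqP; rewrite -(@eqrXn2 _ 2)//; last exact: dist1_ge0.
by rewrite real_normK ?num_real// h.
Qed.

Variable e : R.
Hypothesis he : noncritical K e.

Let e0 : 0 < e. Proof. by case: he. Qed.

(* Near level e the squared distance can be increased at a definite rate: away
   from the line if the point is off the line, along it otherwise. *)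
Lemma line_dist_slope : exists c d, [/\ 0 < c, 0 < d & forall y h, 0 <= h ->
  e ^+ 2 - d <= line_dist y ^+ 2 -> line_dist y ^+ 2 + h <= e ^+ 2 + d ->
  exists2 y', line_dist y ^+ 2 + h <= line_dist y' ^+ 2 & enorm (y' - y) <= h / c].
Proof.
have [e1 [e2 [e10 e1e ee2 esc]]] := noncritical_escape cK K0 he.
have e1e' : e1 ^+ 2 < e ^+ 2 by rewrite ltr_sqr ?nnegrE ?(ltW e10) ?(ltW e0).
have ee2' : e ^+ 2 < e2 ^+ 2 by rewrite ltr_sqr ?nnegrE ?(ltW e0)// (ltW (lt_trans e0 ee2)).
(* The half leaves room for both cases: if |q| ^ 2 < d, the distance along the line is still at
   least e1, and the target level r stays below e2. *)
pose d := Num.min (e ^+ 2 - e1 ^+ 2) (e2 ^+ 2 - e ^+ 2) / 2.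
have d0 : 0 < d by rewrite divr_gt0// lt_min !subr_gt0 e1e'.
have d1 : 2 * d <= e ^+ 2 - e1 ^+ 2 by rewrite /d mulrC divfK// ge_min lexx.
have d2 : 2 * d <= e2 ^+ 2 - e ^+ 2 by rewrite /d mulrC divfK// ge_min lexx orbT.
(* Off the line the step has length h / 2|q| with |q| >= sqrt d; along the line it has length at
   most r - D = h / (r + D) with r + D >= 2 e1. *)
pose c := Num.min (2 * Num.sqrt d) (2 * e1).
have c0 : 0 < c by rewrite lt_min !mulr_gt0// sqrtr_gt0.
exists c, d; split => // y h h0; rewrite line_dist_sqr.
have qu : edot (transverse y) u = 0 by exact: edot_transverse.
have [q qE] : exists q, q = transverse y by eexists.
rewrite -qE in qu *; move=> h1 h2.
have [dq|qd] := leP d (edot q q).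
  have q0 : 0 < edot q q by exact: lt_le_trans dq.
  have qn0 : 0 < enorm q by rewrite sqrtr_gt0.
  pose s := h / (2 * edot q q).
  have s0 : 0 <= s by rewrite divr_ge0// mulr_ge0// ltW.
  exists (y + s *: q).
    rewrite line_dist_sqr axialD transverseD edotZl qu mulr0 addr0 scale0r subr0 -qE.
    rewrite -addrA lerD2l !edotE.
    have -> : h = 2 * s * edot q q by rewrite /s; field; rewrite gt_eqF.
    have : 0 <= s * (s * edot q q) by exact: mulr_ge0 s0 (mulr_ge0 s0 (ltW q0)).
    lra.
  rewrite addrC addKr enormZ ger0_norm//.
  have -> : s * enorm q = h / (2 * enorm q).
    by rewrite /s -enorm_sqr; field; rewrite gt_eqF.
  rewrite ler_wpM2l// lef_pV2 ?posrE ?mulr_gt0//.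
  rewrite /c ge_min ler_pM2l//; apply/orP; left; exact: ler_wsqrtr.
set D := dist1 K (axial y) in h1 h2 *.
have D0 : 0 <= D by exact: dist1_ge0.
have q0 := edot_ge0 q.
have De1 : e1 <= D.
  by rewrite -(@ler_sqr _ e1 D) ?nnegrE ?(ltW e10)//; lra.
pose r := Num.sqrt (D ^+ 2 + h).
have r2 : r ^+ 2 = D ^+ 2 + h by rewrite sqr_sqrtr// addr_ge0// sqr_ge0.
have r0 : 0 <= r by exact: sqrtr_ge0.
have Dr : D <= r by rewrite -(@ler_sqr _ D r)// r2 lerDl.
have re2 : r <= e2.
  by rewrite -(@ler_sqr _ r e2) ?nnegrE ?(ltW (lt_trans e0 ee2))// r2; lra.
have [t' tt' rt'] := esc (axial y) r De1 Dr re2.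
exists (y + (t' - axial y) *: u).
  rewrite line_dist_sqr axialD transverseD edotZl u1 mulr1 subrr addr0 -qE.
  have -> : axial y + (t' - axial y) = t' by ring.
  have : r ^+ 2 <= dist1 K t' ^+ 2 by rewrite ler_sqr ?nnegrE ?dist1_ge0.
  rewrite r2; lra.
rewrite addrC addKr enormZ.
have -> : enorm u = 1 by apply: enorm_eq; rewrite // u1 expr1n.
rewrite mulr1; apply: (le_trans tt').
rewrite ler_pdivlMr//; apply: (@le_trans _ _ ((r - D) * (r + D))).
  rewrite ler_wpM2l ?subr_ge0//; apply: (@le_trans _ _ (2 * e1)); last lra.
  by rewrite ge_min lexx orbT.
by rewrite -subr_sqr r2 addrC addKr.
Qed.

Let X : set 'rV[R]_m := [set y | e <= line_dist y].

(** By [line_dist_slope] the distance has no local maximum at level e, so every point of that level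
    is a limit of points strictly outside. *)
Lemma closure_outside : closure (~` [set y | line_dist y <= e]) = X.
Proof.
apply/seteqP; split => y.
  move=> /enorm_closureP cy; rewrite /X /= leNgt; apply/negP => ye.
  have := cy (e - line_dist y); rewrite subr_gt0 => /(_ ye)[y' /negP].
  rewrite /= -ltNge => ey' yy'; have := line_dist_lip y' y; lra.
rewrite /X /= le_eqVlt => /orP[/eqP ye|ye]; last first.
  by apply: subset_closure => /= /(lt_le_trans ye); rewrite ltxx.
apply/enorm_closureP => r r0.
have [c [d [c0 d0 slope]]] := line_dist_slope.
pose h := Num.min d (c * r / 2).
have h0 : 0 < h by rewrite lt_min d0 divr_gt0// mulr_gt0.
have hd : h <= d by rewrite ge_min lexx.
have [||y' y1 y2] := slope y h (ltW h0); rewrite -?ye; [lra|lra|].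
exists y'.
  move=> /= y'e; have : line_dist y' ^+ 2 <= e ^+ 2.
    by rewrite ler_sqr ?nnegrE ?line_dist_ge0// ltW.
  rewrite -ye in y1; lra.
apply: (le_lt_trans y2); rewrite ltr_pdivrMr// mulrC.
have : h <= c * r / 2 by rewrite ge_min lexx orbT.
have := mulr_gt0 c0 r0; lra.
Qed.

Lemma closed_outside : closed X.
Proof. by rewrite -closure_outside; exact: closed_closure. Qed.

Lemma line_dist_boundary_outside y : boundary X y -> line_dist y = e.
Proof.
move=> [cX /enorm_closureP cnX]; apply: le_anti; apply/andP; split; last first.
  by have := closed_outside; rewrite closure_id => XE; rewrite -XE in cX.
rewrite leNgt; apply/negP => ey.
have := cnX (line_dist y - e); rewrite subr_gt0 => /(_ ey)[y' /negP].
rewrite -ltNge => y'e yy'; have := line_dist_lip y y'; rewrite enormB; lra.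
Qed.

(** Moving along v increases the distance from every p with (v, x - p) > 0. The remaining points of
    K form the compact set [K1], whose distance from x exceeds e by a fixed margin, so for short
    steps x + s v stays in X. *)
Lemma tangent_cone_outside x v : line_dist x = e ->
  (forall k, K k -> enorm (x - axis_point k) = e -> 0 < edot v (x - axis_point k)) ->
  tangent_cone X x v.
Proof.
move=> xe hv.
have pd k : K k -> e <= enorm (x - axis_point k) by rewrite -xe; exact: line_dist_le.
have [s0 s00 hs] : exists2 s0, 0 < s0 & forall s, 0 <= s <= s0 -> X (x + s *: v).
  pose K1 := K `&` [set k | edot v (x - axis_point k) <= 0].
  have outK1 s k : K k -> ~ K1 k -> 0 <= s -> e <= enorm (x + s *: v - axis_point k).
    move=> Kk K1k s0; have vk : 0 < edot v (x - axis_point k).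
      by rewrite ltNge; apply/negP => vk; apply: K1k.
    apply: (le_trans (pd k Kk)); rewrite enorm_ge ?enorm_ge0// enorm_sqr addrAC.
    move: (x - axis_point k) vk => w vk; rewrite !edotE (edotC w v).
    have := edot_ge0 v; have := mulr_ge0 s0 (ltW vk).
    have : 0 <= s * (s * edot v v) by rewrite !mulr_ge0// edot_ge0.
    lra.
  have [K10|/set0P K1n] := eqVneq K1 set0.
    exists 1 => // s /andP[s0 _]; apply: line_dist_ge => k Kk.
    by apply: outK1 => //; rewrite K10.
  have cK1 : compact K1.
    apply: compact_closedI => //.
    apply: (@closed_comp _ _ (fun k : R => edot v (x - axis_point k)) [set r | r <= 0]); last exact: closed_le.
    move=> k _; apply: (@lipschitz_continuous _ _ (`|edot v u|)) => a b.
    by rewrite -edotBr /axis_point (_ : _ - _ = (b - a) *: u) ?edotZr ?normrM 1?distrC 1?mulrC//; apply/rowP => i; rewrite !mxE; ring.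
  have cf : {within K1, continuous (fun k : R => enorm (x - axis_point k))}.
    apply: continuous_subspaceT; apply: (@lipschitz_continuous _ _ 1) => a b.
    rewrite mul1r ler_norml; apply/andP.
    have := enorm_triangleB (x - axis_point a) (x - axis_point b).
    have := enorm_triangleB (x - axis_point b) (x - axis_point a).
    rewrite [enorm (x - axis_point b - _)]enormB (_ : x - axis_point a - _ = (b - a) *: u); last first.
      by rewrite /axis_point; apply/rowP => i; rewrite !mxE; ring.
    rewrite enormZ [enorm u](@enorm_eq _ _ _ 1) ?expr1n// mulr1 distrC; lra.
  have [k0 k0K h] := compact_EVT_min K1n cK1 cf; rewrite inE in k0K.
  set M := enorm (x - axis_point k0) in h.
  have eM : e < M.
    rewrite lt_neqAle pd ?andbT; last by case: k0K.
    apply/eqP => eM; have := hv k0 (proj1 k0K) (esym eM).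
    by rewrite ltNge (proj2 k0K).
  have v1 : 0 < enorm v + 1 by rewrite ltr_wpDl// enorm_ge0.
  exists ((M - e) / (enorm v + 1)); first by rewrite divr_gt0// subr_gt0.
  move=> s /andP[s0]; rewrite ler_pdivlMr// => sM; apply: line_dist_ge => k Kk.
  have [K1k|K1k] := pselect (K1 k); last exact: outK1.
  have Mk : M <= enorm (x - axis_point k) by apply: h; rewrite inE.
  have := enorm_triangleB (x - axis_point k) (- s *: v).
  rewrite scaleNr opprK enormN enormZ ger0_norm// addrAC.
  have : s * enorm v <= s * (enorm v + 1) by rewrite ler_wpM2l// lerDl.
  lra.
move=> r r0; have v1 : 0 < enorm v + 1 by rewrite ltr_wpDl// enorm_ge0.
pose s := Num.min s0 (r / (enorm v + 1)).
have s1 : 0 < s by rewrite lt_min s00 divr_gt0.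
exists (x + s *: v), s^-1; split.
- by apply: hs; rewrite (ltW s1) ge_min lexx.
- by rewrite invr_gt0.
- rewrite addrC addKr enormZ gtr0_norm//.
  have : s <= r / (enorm v + 1) by rewrite ge_min lexx orbT.
  rewrite ler_pdivlMr//; lra.
- by rewrite [x + _]addrC addrK scalerA mulVf ?gt_eqF// scale1r subrr enorm0.
Qed.

End LineGeometry.

(** * Positive reach of the complement *)

Section Reach.
Context {R : realType} {m : nat}.
Variables (x0 u : 'rV[R]_m) (K : set R).
Hypotheses (u1 : edot u u = 1) (cK : compact K) (K0 : K !=set0).
Variable e : R.
Hypothesis he : noncritical K e.
Local Notation ld := (line_dist x0 u K).

Let e0 : 0 < e. Proof. by case: he. Qed.

Lemma closed_ball_compact (X : set 'rV[R]_m) y r : closed X ->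
  compact (X `&` [set x | enorm (y - x) <= r]).
Proof.
move=> cX; apply: bounded_closed_compact.
  exists (`|y| + `|r|); split; first exact: num_real.
  move=> M rM x [_ /= xr]; apply: le_trans (ltW rM).
  rewrite -[x in leLHS](subKr y) (le_trans (ler_normB _ _))// lerD2l.
  by rewrite (le_trans (normr_le_enorm _))// (le_trans xr)// ler_norm.
apply: closedI => //.
apply: (@closed_comp _ _ (fun x : 'rV[R]_m => enorm (y - x) : R) [set t | t <= r]); last exact: closed_le.
move=> x _; under eq_fun do rewrite enormB; exact: enorm_continuous.
Qed.

Lemma nearest_point (X : set 'rV[R]_m) y : closed X -> X !=set0 ->
  exists2 x, X x & forall x', X x' -> enorm (y - x) <= enorm (y - x').
Proof.
move=> cX [x1 X1].
have cA := @closed_ball_compact X y (enorm (y - x1)) cX.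
have cf : {within X `&` [set x | enorm (y - x) <= enorm (y - x1)],
    continuous (fun x => enorm (y - x))}.
  apply: continuous_subspaceT => x; under eq_fun do rewrite enormB; exact: enorm_continuous.
have [|x xA h] := compact_EVT_min _ cA cf; first by exists x1; split => /=.
rewrite inE in xA; exists x => [|x' X']; first by case: xA.
have [l|l] := leP (enorm (y - x')) (enorm (y - x1)); first by apply: h; rewrite inE.
by case: xA => _ /= /le_trans; apply; exact: ltW.
Qed.

(* If x and x' are two nearest points, the squared distance from the line set at
   their midpoint z is at least e ^ 2 - |x - x'| ^ 2 / 4, being a minimum of functions
   |. - p| ^ 2; by the slope lemma z can be moved into X at cost O(|x - x'| ^ 2),
   which is less than what is gained by passing from x to z. *)
Lemma positive_reach_outside : positive_reach [set y | e <= ld y].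
Proof.
have cX := @closed_outside R m x0 u K u1 cK K0 e he; split; first exact: cX.
have [c [d [c0 d0 slope]]] := line_dist_slope x0 u1 cK K0 he.
(* sqrt d keeps the level at the midpoint z in the range of the slope lemma. With c / 2 one has |y -
   x| + |y - z| < c, so the correction h / c <= (|y - x| ^ 2 - |y - z| ^ 2) / c is less than |y - x|
   - |y - z|. *)
exists (Num.min (c / 2) (Num.sqrt d)); split.
  by rewrite lt_min divr_gt0// sqrtr_gt0.
move=> y /ereal_inf_lt[_ [x1 X1 <-]]; rewrite lte_fin => x1r.
have [|x Xx xmin] := nearest_point y cX; first by exists x1.
have dE : edist y [set y | e <= ld y] = (enorm (y - x))%:E.
  apply: le_anti; apply/andP; split; first by apply: ereal_inf_lbound; exists x.
  by apply: le_ereal_inf_tmp => _ [x' X' <-]; rewrite lee_fin xmin.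
have xr : enorm (y - x) < Num.min (c / 2) (Num.sqrt d) by exact: le_lt_trans (xmin _ X1) x1r.
move: xr; rewrite lt_min => /andP[xc xd].
exists x; split; first by split => //; rewrite dE enormB.
move=> x' [/= X' ]; rewrite dE enormB => -[x'E].
apply/eqP/negPn/negP => ne.
pose w := x - x'; have w0 : 0 < edot w w.
  by rewrite -enorm_sqr exprn_gt0// enorm_gt0// subr_eq0.
pose z := 2^-1 *: (x + x').
have mid (p : 'rV[R]_m) : edot (z - p) (z - p) =
    (edot (x - p) (x - p) + edot (x' - p) (x' - p)) / 2 - edot w w / 4.
  have -> : z - p = 2^-1 *: ((x - p) + (x' - p)).
    by apply/rowP => i; rewrite !mxE; field.
  have -> : w = (x - p) - (x' - p) by apply/rowP => i; rewrite !mxE; ring.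
  move: (x - p) (x' - p) => a b; rewrite !edotE (edotC b a); by field.
have zy : enorm (y - z) ^+ 2 = enorm (y - x) ^+ 2 - edot w w / 4.
  rewrite (enormB y z) (enorm_sqr (z - y)) mid -!enorm_sqr x'E (enormB x y); by field.
have ldz : e ^+ 2 - edot w w / 4 <= ld z ^+ 2.
  have [k Kk ->] := line_dist_attained x0 u1 cK K0 z.
  rewrite enorm_sqr mid lerD2r -!enorm_sqr.
  have h1 : e ^+ 2 <= enorm (x - axis_point x0 u k) ^+ 2.
    rewrite ler_sqr ?nnegrE ?enorm_ge0 ?(ltW e0)//; apply: (le_trans Xx); exact: line_dist_le.
  have h2 : e ^+ 2 <= enorm (x' - axis_point x0 u k) ^+ 2.
    rewrite ler_sqr ?nnegrE ?enorm_ge0 ?(ltW e0)//; apply: (le_trans X'); exact: line_dist_le.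
  lra.
have be := enorm_ge0 (y - z); have de := enorm_ge0 (y - x).
have bd : enorm (y - z) < enorm (y - x).
  by rewrite -ltr_sqr ?nnegrE// zy; lra.
have [ez|ze] := leP e (ld z).
  by have := xmin _ ez; rewrite leNgt bd.
have ld0 := line_dist_ge0 x0 u K z.
have ze2 : ld z ^+ 2 < e ^+ 2 by rewrite ltr_sqr ?nnegrE ?(ltW e0).
pose h := e ^+ 2 - ld z ^+ 2.
have dsq : enorm (y - x) ^+ 2 < d.
  by rewrite -[ltRHS](sqr_sqrtr (ltW d0)) ltr_sqr ?nnegrE ?sqrtr_ge0.
have b2 := sqr_ge0 (enorm (y - z)).
have [|||y' ly' yy'] := slope z h; rewrite ?/h; [lra|lra|lra|].
have X'' : e <= ld y'.
  rewrite -ler_sqr ?nnegrE ?line_dist_ge0 ?(ltW e0)//; move: ly'; rewrite /h; lra.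
have := xmin _ X''; rewrite leNgt => /negP; apply.
apply: le_lt_trans (enorm_triangle _ z _) _.
rewrite (enormB z y'); apply: le_lt_trans (lerD (lexx _) yy') _.
rewrite -ltrBrDl ltr_pdivrMr// /h.
apply: (@le_lt_trans _ _ ((enorm (y - x) - enorm (y - z)) * (enorm (y - x) + enorm (y - z)))).
  rewrite -subr_sqr zy; lra.
rewrite ltr_pM2l ?subr_gt0//; lra.
Qed.

End Reach.

(** * The boundary as a Lipschitz manifold *)

Section Manifold.
Context {R : realType} {n : nat}.

Definition lin_frame (b : 'I_n.+1 -> 'rV[R]_n.+1) (v : 'rV[R]_n) :=
  \sum_i v 0 i *: b (lift ord0 i).

(* The surface is the graph of [Num.sqrt \o G] over the hyperplane orthogonal to
   [b ord0]. *)
Lemma graph_chart (b : 'I_n.+1 -> 'rV[R]_n.+1) (M U : set 'rV[R]_n.+1) x p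
    (G : 'rV[R]_n -> R) (eta C : R) :
  (forall i j, edot (b i) (b j) = (i == j)%:R) ->
  (forall x, x = \sum_i edot x (b i) *: b i) ->
  0 < eta -> open U -> U x -> open [set v | eta ^+ 2 < G v] ->
  (forall v v', eta ^+ 2 < G v -> eta ^+ 2 < G v' -> `|G v - G v'| <= C * enorm (v - v')) ->
  (forall h v, M (p + (h *: b ord0 + lin_frame b v)) /\ U (p + (h *: b ord0 + lin_frame b v)) <->
     eta < h /\ h ^+ 2 = G v) ->
  exists (U : set 'rV[R]_n.+1) (V : set 'rV[R]_n) (f : 'rV[R]_n -> 'rV[R]_n.+1)
      (c C : R),
    [/\ open U /\ U x, open V, f @` V = M `&` U, 0 < c &
        forall u v, V u -> V v ->
          c * enorm (u - v) <= enorm (f u - f v) <= C * enorm (u - v)].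
Proof.
move=> bb bE eta0 oU Ux oV GC MU.
have decomp y : y = p + (edot (y - p) (b ord0) *: b ord0 +
    lin_frame b (\row_i edot (y - p) (b (lift ord0 i)))).
  rewrite -[LHS](subrK p) [LHS]addrC; congr (_ + _).
  rewrite {1}(bE (y - p)) big_ord_recl; congr (_ + _).
  by apply: eq_bigr => i _; rewrite mxE.
(* eta keeps G away from 0, where the square root is not Lipschitz; above eta ^ 2 its Lipschitz
   constant is 1 / 2 eta. The lower constant is 1 because the chart is inverted by an orthogonal
   projection. *)
exists U, [set v | eta ^+ 2 < G v],
  (fun v => p + (Num.sqrt (G v) *: b ord0 + lin_frame b v)), 1, (C / (2 * eta) + 1).
have Gpos v : eta ^+ 2 < G v -> 0 <= G v.
  by move=> h; rewrite (le_trans _ (ltW h))// sqr_ge0.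
have Geta v : eta ^+ 2 < G v -> eta < Num.sqrt (G v).
  move=> h; rewrite -ltr_sqr ?nnegrE ?sqrtr_ge0 ?(ltW eta0)//.
  by rewrite sqr_sqrtr// Gpos.
have nrm h v : edot (h *: b ord0 + lin_frame b v) (h *: b ord0 + lin_frame b v) =
    h ^+ 2 + edot v v.
  pose a i := if unlift ord0 i is Some j then v 0 j else h.
  have -> : h *: b ord0 + lin_frame b v = \sum_i a i *: b i.
    rewrite big_ord_recl /a unlift_none; congr (_ + _).
    by apply: eq_bigr => i _; rewrite liftK.
  rewrite (frame_edot _ bb bE) big_ord_recl edot_frame_coord// /a unlift_none.
  congr (_ + _); apply: eq_bigr => i _.
  by rewrite edot_frame_coord// liftK expr2.
have nrm_le a w : enorm (a *: b ord0 + lin_frame b w) <= `|a| + enorm w.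
  rewrite enorm_le ?addr_ge0 ?enorm_ge0// nrm sqrrD real_normK ?num_real// enorm_sqr.
  by rewrite lerD2r lerDl mulrn_wge0// mulr_ge0 ?enorm_ge0.
split => //.
- apply/seteqP; split => [_ [v Vv <-]|y [My Uy]].
    by apply/MU; split; [exact: Geta|rewrite sqr_sqrtr// Gpos].
  have := MU (edot (y - p) (b ord0)) (\row_i edot (y - p) (b (lift ord0 i))).
  rewrite -decomp => -[/(_ (conj My Uy))[h1 h2] _].
  exists (\row_i edot (y - p) (b (lift ord0 i))).
    by rewrite /= -h2 ltr_sqr ?nnegrE ?(ltW eta0)// ltW// (lt_trans eta0).
  by rewrite -h2 sqrtr_sqr gtr0_norm ?(lt_trans eta0)// -decomp.
- move=> v v' Vv Vv'.
  have -> : p + (Num.sqrt (G v) *: b ord0 + lin_frame b v) -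
      (p + (Num.sqrt (G v') *: b ord0 + lin_frame b v')) =
      (Num.sqrt (G v) - Num.sqrt (G v')) *: b ord0 + lin_frame b (v - v').
    have -> : lin_frame b (v - v') = lin_frame b v - lin_frame b v'.
      rewrite /lin_frame -sumrB; apply: eq_bigr => i _.
      by rewrite !mxE -scalerBl.
    by apply/rowP => i; rewrite !mxE; ring.
  rewrite mul1r; apply/andP; split.
    by rewrite enorm_le ?enorm_ge0// enorm_sqr nrm lerDr sqr_ge0.
  apply: (@le_trans _ _ (`|Num.sqrt (G v) - Num.sqrt (G v')| + enorm (v - v'))).
    exact: nrm_le.
  rewrite mulrDl mul1r lerD2r mulrAC ler_pdivlMr ?mulr_gt0//.
  apply: le_trans (GC v v' Vv Vv').
  rewrite -{2}(sqr_sqrtr (Gpos _ Vv)) -{2}(sqr_sqrtr (Gpos _ Vv')) subr_sqr normrM.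
  rewrite ler_wpM2l// ger0_norm ?addr_ge0 ?sqrtr_ge0//.
  by have := Geta _ Vv; have := Geta _ Vv'; lra.
Qed.

End Manifold.

Section ParallelManifold.
Context {R : realType} {n : nat}.
Variables (x0 u : 'rV[R]_n.+1) (K : set R).
Hypotheses (u1 : edot u u = 1) (cK : compact K) (K0 : K !=set0).
Variable e : R.
Hypothesis he : noncritical K e.
Local Notation ld := (line_dist x0 u K).
Local Notation ax := (axial x0 u).
Local Notation pt := (axis_point x0 u).

Let e0 : 0 < e. Proof. by case: he. Qed.

Lemma boundary_parallel : boundary [set y | ld y <= e] = [set y | ld y = e].
Proof.
have cP : closure [set y | ld y <= e] = [set y | ld y <= e].
  apply/esym; rewrite -closure_id.
  apply: (@closed_comp _ _ (ld : 'rV[R]_n.+1 -> R) [set t | t <= e]); last exact: closed_le.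
  move=> x _; apply: (@lipschitz_continuous_enorm _ _ _ 1) => a b.
  have := line_dist_lip x0 u1 cK K0 a b; have := line_dist_lip x0 u1 cK K0 b a.
  by rewrite mul1r ler_norml (enormB b a) => h1 h2; apply/andP; split; lra.
rewrite /boundary cP closure_outside//; apply/seteqP; split => y /=.
  by move=> [? ?]; apply: le_anti; apply/andP.
by move=> ->; rewrite lexx.
Qed.

(** Since k + s e is at distance e from K, no point of K lies strictly within 2e of k on the side s;
    noncriticality improves 2e to a larger bound. *)
Lemma one_sided_gap (s k : R) : s ^+ 2 = 1 -> K k -> dist1 K (k + s * e) = e ->
  exists2 e2, e < e2 & forall k', K k' -> s * (k' - k) <= 0 \/ 2 * e2 <= s * (k' - k).
Proof.
move=> s1 Kk De.
have [e1 [e2 [e10 e1e ee2 hm]]] := noncritical_margin cK K0 he.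
have dk k' : K k' -> e <= `|k + s * e - k'| by rewrite -{1}De; exact: dist1_le.
exists e2 => // k' Kk'; have [|sk] := leP (s * (k' - k)) 0; [by left|right].
move/eqP: s1; rewrite sqrf_eq1 => /orP[] /eqP sE; rewrite sE in dk sk *.
  have [|||b [gb db bk]] := @right_gap R K cK k k' (2 * e) Kk Kk'; [lra|lra| |].
    move=> t /andP[kt tk] /dk; apply/negP; rewrite -ltNge ltr_norml; apply/andP; split; lra.
  have := hm _ _ gb; lra.
have [|||a [ga da ak]] := @left_gap R K cK k k' (2 * e) Kk Kk'; [lra|lra| |].
  move=> t /andP[kt tk] /dk; apply/negP; rewrite -ltNge ltr_norml; apply/andP; split; lra.
have := hm _ _ ga; lra.
Qed.

(** Near a boundary point on the line the boundary is part of one sphere of radius e. Off the line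
    it is a graph in the transverse direction, however many points of K are close. *)
Lemma lipschitz_manifold_parallel : lipschitz_manifold n (boundary [set y | ld y <= e]).
Proof.
rewrite boundary_parallel => x /= xe.
have e0' : 0 < e by exact: e0.
have ldc : continuous ld.
  apply: (@lipschitz_continuous_enorm _ _ _ 1) => a b.
  have := line_dist_lip x0 u1 cK K0 a b; have := line_dist_lip x0 u1 cK K0 b a.
  by rewrite mul1r ler_norml (enormB b a) => h1 h2; apply/andP; split; lra.
have linB (b : 'I_n.+1 -> 'rV[R]_n.+1) v w : lin_frame b v - lin_frame b w = lin_frame b (v - w).
  rewrite /lin_frame -sumrB; apply: eq_bigr => i _.
  by rewrite !mxE -scalerBl.
have lin_norm (b : 'I_n.+1 -> 'rV[R]_n.+1) v :
    (forall i j, edot (b i) (b j) = (i == j)%:R) ->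
    edot (lin_frame b v) (lin_frame b v) = edot v v /\ edot (lin_frame b v) (b ord0) = 0.
  move=> bb; rewrite /lin_frame.
  have lb w : edot (\sum_i v 0 i *: b (lift ord0 i)) w = \sum_i v 0 i * edot (b (lift ord0 i)) w.
    rewrite (big_morph (fun y => edot y w) (fun y z => edotDl y z _) (edot0l _)).
    by apply: eq_bigr => i _; rewrite edotZl.
  split; rewrite lb.
    apply: eq_bigr => i _; congr (_ * _); rewrite edotC lb (bigD1 i)//= bb eqxx mulr1.
    by rewrite big1 ?addr0// => j ji; rewrite bb (inj_eq lift_inj) (negPf ji) mulr0.
  by rewrite big1// => i _; rewrite bb mulr0.
have [q0|q0] := eqVneq (transverse x0 u x) 0.
  have [k Kk xk] := line_dist_attained x0 u1 cK K0 x.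
  pose s := (ax x - k) / e.
  have s1 : s ^+ 2 = 1.
    rewrite /s expr_div_n; have := edot_sub_axis_point x0 u1 x k.
    rewrite -enorm_sqr -xk xe q0 edot0l addr0 => <-.
    by rewrite divff// expf_neq0// gt_eqF.
  have axE : ax x = k + s * e by rewrite /s divfK ?gt_eqF// addrC subrK.
  have De : dist1 K (k + s * e) = e.
    have := line_dist_sqr x0 u K x; rewrite xe q0 edot0l addr0 -axE => /eqP.
    by rewrite eqrXn2 ?dist1_ge0 ?(ltW e0)// => /eqP ->.
  have [e2 ee2 clear] := one_sided_gap s1 Kk De.
  have su1 : edot (s *: u) (s *: u) = 1 by rewrite !edotE u1 mulr1 -expr2.
  have [b [b0 bb bE]] := orthonormal_frame su1.
  have hE h v : edot (pt k + (h *: b ord0 + lin_frame b v) - pt k) (b ord0) = h.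
    by rewrite addrC addKr edotDl edotZl bb eqxx mulr1 (lin_norm b v bb).2 addr0.
  (* At heights between 0 and e2 above [pt k] no point of K is nearer than k, by the choice of e2,
     so in U the distance is that from [pt k]. *)
  pose U := [set y | e / 2 < edot (y - pt k) (b ord0)] `&` [set y | edot (y - pt k) (b ord0) < e2].
  have hc : continuous (fun y : 'rV[R]_n.+1 => edot (y - pt k) (b ord0) : R).
    apply: (@lipschitz_continuous_enorm _ _ _ 1) => y z.
    rewrite -edotBl (_ : y - pt k - _ = y - z); last by apply/rowP => i; rewrite !mxE; ring.
    apply: (le_trans (edot_abs _ _)); rewrite [enorm (b ord0)](@enorm_eq _ _ _ 1) ?bb ?expr1n//.
    by rewrite mulrC.
  apply: (@graph_chart _ _ b _ U x (pt k) (fun v => e ^+ 2 - edot v v) (e / 2) (2 * e) bb bE).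
  - by rewrite divr_gt0.
  - apply: openI.
      by apply: (@open_comp _ _ (fun y : 'rV[R]_n.+1 => edot (y - pt k) (b ord0) : R) [set t | e / 2 < t]) => [y _|]; [exact: hc|exact: open_gt].
    by apply: (@open_comp _ _ (fun y : 'rV[R]_n.+1 => edot (y - pt k) (b ord0) : R) [set t | t < e2]) => [y _|]; [exact: hc|exact: open_lt].
  - have -> : x = pt k + (e *: b ord0 + lin_frame b 0).
      have -> : lin_frame b 0 = 0 by rewrite /lin_frame big1// => i _; rewrite mxE scale0r.
      rewrite addr0 b0 scalerA -[LHS](subrK (pt k)) sub_axis_point q0 addr0 axE.
      by rewrite addrC; congr (_ + _ *: _); ring.
    by rewrite /U; split; rewrite /= hE// ltr_pdivrMr// ltr_pMr// ltr1n.
  - have vc : continuous (fun v : 'rV[R]_n => enorm v : R).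
      by move=> v; have := @enorm_continuous R n 0 v; under eq_fun do rewrite subr0.
    have -> : [set v : 'rV[R]_n | (e / 2) ^+ 2 < e ^+ 2 - edot v v] =
        [set v | enorm v < Num.sqrt (e ^+ 2 - (e / 2) ^+ 2)].
      apply/seteqP; split => v /=; rewrite enorm_lt ?sqrtr_ge0// sqr_sqrtr; try lra.
        by have := exprn_gt0 2 e0; lra.
      by have := exprn_gt0 2 e0; lra.
    by apply: (@open_comp _ _ (fun v : 'rV[R]_n => enorm v : R) [set t | t < _]) => [y _|]; [exact: vc|exact: open_lt].
  - move=> v v' hv hv'.
    have le (v1 : 'rV[R]_n) : (e / 2) ^+ 2 < e ^+ 2 - edot v1 v1 -> enorm v1 <= e.
      by move=> h; rewrite enorm_le ?(ltW e0)//; have := sqr_ge0 (e / 2); lra.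
    have -> : e ^+ 2 - edot v v - (e ^+ 2 - edot v' v') = edot v' v' - edot v v by ring.
    rewrite -!enorm_sqr subr_sqr normrM mulrC.
    apply: ler_pM => //.
      rewrite ger0_norm ?addr_ge0 ?enorm_ge0//; have := le v hv; have := le v' hv'; lra.
    have := enorm_triangleB v v'; have := enorm_triangleB v' v.
    rewrite (enormB v' v) => h1 h2; rewrite ler_norml; apply/andP; split; lra.
  - move=> h v; rewrite /U /= hE.
    set y := pt k + _.
    have yk : edot (y - pt k) (y - pt k) = h ^+ 2 + edot v v.
      rewrite /y addrC addKr !edotE (lin_norm b v bb).1 (edotC (b ord0)) (lin_norm b v bb).2.
      by rewrite bb eqxx /=; ring.
    have axy : ax y = k + s * h.
      have ax_pt : ax (pt k) = k.
        by rewrite /axial /axis_point addrAC subrr add0r edotZl u1 mulr1.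
      have yu : s * edot (y - pt k) u = h by rewrite -edotZr -b0 hE.
      rewrite -[y](subrK (pt k)) addrC axialD ax_pt -yu mulrA -expr2 s1 mul1r.
      by [].
    have ydist : e / 2 < h -> h < e2 -> ld y ^+ 2 = edot (y - pt k) (y - pt k).
      move=> h1 h2; rewrite edot_sub_axis_point// line_dist_sqr//; congr (_ + _).
      have -> : dist1 K (ax y) = `|ax y - k|; last by rewrite real_normK ?num_real.
      apply: le_anti; rewrite dist1_le//=; apply: dist1_ge => // k' Kk'.
      have n1 : `|s| = 1 by apply/eqP; rewrite -(@eqrXn2 _ 2)// real_normK ?num_real// s1 expr1n.
      rewrite -[leRHS]mul1r -{1}n1 -normrM axy.
      have -> : k + s * h - k = s * h by ring.
      have -> : s * (k + s * h - k') = s ^+ 2 * h - s * (k' - k) by ring.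
      rewrite s1 mul1r normrM n1 mul1r gtr0_norm; last lra.
      rewrite ler_normr; apply/orP.
      by case: (clear k' Kk') => hk; [left|right]; lra.
    split.
      move=> [ye [h1 h2]]; split => //.
      by have := ydist h1 h2; rewrite ye yk; lra.
    move=> [h1 h2]; have h3 : h < e2.
      apply: le_lt_trans ee2; rewrite -ler_sqr ?nnegrE ?(ltW e0)//; last lra.
      by rewrite h2; have := edot_ge0 v; lra.
    split => //; apply/eqP; rewrite -(@eqrXn2 _ 2) ?line_dist_ge0 ?(ltW e0)//.
    by rewrite ydist// yk h2 subrK.
pose q := transverse x0 u x.
have qn0 : 0 < enorm q by exact: enorm_gt0.
have [ev evE] : exists ev, ev = (enorm q)^-1 *: q by eexists.
have ev1 : edot ev ev = 1.
  by rewrite evE edotZl edotZr -enorm_sqr; field; rewrite gt_eqF.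
have qu : edot q u = 0 by exact: edot_transverse.
have evu : edot ev u = 0 by rewrite evE edotZl qu mulr0.
have [b [b0 bb bE]] := orthonormal_frame ev1.
have hE h v : edot (x0 + (h *: b ord0 + lin_frame b v) - x0) (b ord0) = h.
  by rewrite addrC addKr edotDl edotZl bb eqxx mulr1 (lin_norm b v bb).2 addr0.
have hc : continuous (fun y : 'rV[R]_n.+1 => edot (y - x0) (b ord0) : R).
  apply: (@lipschitz_continuous_enorm _ _ _ 1) => y z.
  rewrite -edotBl (_ : y - x0 - _ = y - z); last by apply/rowP => i; rewrite !mxE; ring.
  apply: (le_trans (edot_abs _ _)); rewrite [enorm (b ord0)](@enorm_eq _ _ _ 1) ?bb ?expr1n//.
  by rewrite mulrC.
pose base v := x0 + lin_frame b v.
(* [b ord0] is orthogonal to the line, so moving along it keeps the nearest points and only adds to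
   the squared transverse length. The level set becomes h ^ 2 = e ^ 2 - ld (base v) ^ 2. *)
have ldE h v : ld (x0 + (h *: b ord0 + lin_frame b v)) ^+ 2 = h ^+ 2 + ld (base v) ^+ 2.
  have -> : x0 + (h *: b ord0 + lin_frame b v) = base v + h *: ev.
    by rewrite /base b0 -addrA [lin_frame b v + _]addrC.
  rewrite !line_dist_sqr// axialD transverseD edotZl evu mulr0 addr0 scale0r subr0.
  have -> : edot (transverse x0 u (base v) + h *: ev) (transverse x0 u (base v) + h *: ev) =
     edot (transverse x0 u (base v)) (transverse x0 u (base v)) + h ^+ 2.
    have tv : edot (transverse x0 u (base v)) ev = 0.
      rewrite /transverse /base (_ : x0 + lin_frame b v - x0 = lin_frame b v); last by rewrite addrC addKr.
      rewrite edotBl edotZl (edotC u) evu mulr0 subr0.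
      by rewrite -b0 (lin_norm b v bb).2.
    move: (transverse x0 u (base v)) tv => w tv.
    by rewrite !edotE (edotC ev w) tv ev1; ring.
  by rewrite addrCA addrA [RHS]addrA; ring.
have base_lip v w : `|ld (base v) - ld (base w)| <= enorm (v - w).
  have bvw : enorm (base v - base w) = enorm (v - w).
    rewrite /base opprD addrACA subrr add0r linB; apply: enorm_eq; rewrite ?enorm_ge0//.
    by rewrite (lin_norm b _ bb).1 enorm_sqr.
  have := line_dist_lip x0 u1 cK K0 (base v) (base w).
  have := line_dist_lip x0 u1 cK K0 (base w) (base v).
  by rewrite (enormB (base w)) bvw => h1 h2; rewrite ler_distl lerBlDr h1 h2.
pose U := [set y | enorm q / 2 < edot (y - x0) (b ord0)].
have eta0 : 0 < enorm q / 2 by rewrite divr_gt0.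
apply: (@graph_chart _ _ b _ U x x0 (fun v => e ^+ 2 - ld (base v) ^+ 2) (enorm q / 2) (2 * e) bb bE) => //.
- by apply: (@open_comp _ _ (fun y : 'rV[R]_n.+1 => edot (y - x0) (b ord0) : R) [set t | enorm q / 2 < t]) => [y _|]; [exact: hc|exact: open_gt].
- rewrite /U /= b0; have -> : x - x0 = q + ax x *: u by rewrite /q /transverse subrK.
  rewrite edotDl edotZl (edotC u) evu mulr0 addr0 evE edotZr -enorm_sqr expr2 mulKf ?gt_eqF//.
  lra.
- have lc : continuous (fun v : 'rV[R]_n => ld (base v) : R).
    by apply: (@lipschitz_continuous_enorm _ _ _ 1) => a c; rewrite mul1r.
  apply: (@open_comp _ _ (fun v : 'rV[R]_n => ld (base v) : R)
    [set t | (enorm q / 2) ^+ 2 < e ^+ 2 - t ^+ 2]) => [y _|]; first exact: lc.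
  apply: (@open_comp _ _ (fun t : R => e ^+ 2 - t ^+ 2) [set t | _ < t]) => [t _|]; last exact: open_gt.
  by apply: cvgB; [exact: cvg_cst|apply: cvgM; exact: cvg_id].
- move=> v v' hv hv'.
  have le (v1 : 'rV[R]_n) : (enorm q / 2) ^+ 2 < e ^+ 2 - ld (base v1) ^+ 2 -> ld (base v1) <= e.
    move=> h; rewrite -ler_sqr ?nnegrE ?line_dist_ge0 ?(ltW e0)//.
    by have := sqr_ge0 (enorm q / 2); lra.
  have -> : e ^+ 2 - ld (base v) ^+ 2 - (e ^+ 2 - ld (base v') ^+ 2) =
      ld (base v') ^+ 2 - ld (base v) ^+ 2 by ring.
  rewrite subr_sqr normrM mulrC.
  apply: ler_pM => //; last by rewrite distrC.
  rewrite ger0_norm ?addr_ge0 ?line_dist_ge0//; have := le v hv; have := le v' hv'; lra.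
- move=> h v; rewrite /U /= hE; split => -[h1 h2].
    by split => //; have := ldE h v; rewrite h1; lra.
  split => //; apply/eqP; rewrite -(@eqrXn2 _ 2) ?line_dist_ge0 ?(ltW e0)//.
  by rewrite ldE h2 subrK.
Qed.

End ParallelManifold.

(** * Unit normals of the complement *)

Section Normals.
Context {R : realType} {m : nat}.
Variables (x0 u : 'rV[R]_m) (K : set R).
Hypotheses (u1 : edot u u = 1) (cK : compact K) (K0 : K !=set0).
Variable e : R.
Hypothesis he : noncritical K e.
Local Notation ld := (line_dist x0 u K).
Local Notation ax := (axial x0 u).
Local Notation pt := (axis_point x0 u).
Local Notation X := [set y | e <= ld y].

(** The polar cone of an open half-space is a ray, so a single nearest point leaves one unit normal.
    The proof tests n with w + d' A, where w is the part of n orthogonal to A and d' is small. *)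
Lemma polar_ray (A n : 'rV[R]_m) : edot A A = e ^+ 2 -> edot n n = 1 ->
  (forall v, 0 < edot v A -> edot v n <= 0) -> A = - e *: n.
Proof.
have [e0 _] := he => AA nn h.
have en : e != 0 by rewrite gt_eqF.
have e20 : e ^+ 2 != 0 by rewrite expf_neq0.
have c0 : edot A n <= 0 by apply: h; rewrite AA exprn_gt0.
pose c := edot A n.
have [w wE] : exists w, w = n - (c / e ^+ 2) *: A by eexists.
have wA : edot w A = 0 by rewrite wE !edotE AA (edotC n A) -/c divfK// subrr.
have wn : edot w n = edot w w.
  have -> : n = w + (c / e ^+ 2) *: A by rewrite wE subrK.
  by rewrite !edotE wA mulr0 addr0.
have w0 : w = 0.
  apply: edot_eq0; apply: le_anti; rewrite edot_ge0 andbT.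
  apply/ler_addgt0Pl => d d0.
  have [d' [d'0 d'd]] : exists d', 0 < d' /\ - (d' * c) <= d.
    exists (d / (1 - c)); have c1 : 0 < 1 - c by rewrite subr_gt0 (le_lt_trans c0).
    split; first by rewrite divr_gt0.
    rewrite -mulrN mulrAC ler_pdivrMr// ler_wpM2l ?(ltW d0)//; lra.
  have : edot (w + d' *: A) n <= 0.
    by apply: h; rewrite !edotE wA AA add0r mulr_gt0// exprn_gt0.
  rewrite !edotE wn -/c; lra.
have nE : n = (c / e ^+ 2) *: A by apply/eqP; rewrite -subr_eq0 -wE w0.
have c2 : c ^+ 2 = e ^+ 2.
  move: nn; rewrite nE !edotE AA => h1.
  have : (c / e ^+ 2) * ((c / e ^+ 2) * e ^+ 2) * e ^+ 2 = e ^+ 2 by rewrite h1 mul1r.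
  by move=> <-; field.
have cE : c = - e.
  by move/eqP: c2; rewrite eqf_sqr => /orP[] /eqP //; move: c0; rewrite -/c; lra.
by rewrite nE cE scalerA (_ : - e * (- e / e ^+ 2) = 1) ?scale1r//; field.
Qed.

(** The polar of a wedge is spanned by the polars of its two half-spaces: n = p u - t q with |p| <=
    t D. With p ^ 2 + t ^ 2 |q| ^ 2 = 1 and D ^ 2 + |q| ^ 2 = e ^ 2 this gives t >= 1 / e and then
    |p| <= D / e. *)
Lemma polar_wedge (q n : 'rV[R]_m) D : edot q u = 0 -> q != 0 -> 0 < D ->
  D ^+ 2 + edot q q = e ^+ 2 -> edot n n = 1 ->
  (forall v, 0 < edot v (D *: u + q) -> 0 < edot v (- D *: u + q) -> edot v n <= 0) ->
  exists t, [/\ e^-1 <= t, n = edot n u *: u - t *: q & `|edot n u| <= D / e].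
Proof.
have [e0 _] := he => qu q0 D0 Dq nn h.
have Q0 : 0 < edot q q by rewrite -enorm_sqr exprn_gt0// enorm_gt0.
have [p [t [w [nE wu wq]]]] : exists p t w, [/\ n = p *: u - t *: q + w, edot w u = 0 & edot w q = 0].
  exists (edot n u), (- edot n q / edot q q), (n - edot n u *: u - (edot n q / edot q q) *: q); split.
  - by apply/rowP => i; rewrite !mxE; ring.
  - by rewrite !edotE u1 qu; ring.
  - by rewrite !edotE (edotC u q) qu; field; rewrite gt_eqF.
(* Test vectors w + a u + c q, which lie in the wedge iff |a| D < c |q| ^ 2. With a = 0, c = 1 they
   show t >= 0; with a = 0 and c tending to 0, w = 0; with a = sg p |q| ^ 2 and c tending to D, |p|
   <= t D. *)
have test a c : 0 < c -> `|a| * D < c * edot q q ->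
    edot w w + a * p - (c * t) * edot q q <= 0.
  move=> c0 ac.
  have /andP[a1 a2] : - (c * edot q q) < a * D < c * edot q q.
    by rewrite -ltr_norml normrM (gtr0_norm D0).
  have [v vE] : exists v, v = w + a *: u + c *: q by eexists.
  have v1 : edot v (D *: u + q) = a * D + c * edot q q.
    by rewrite vE !edotE wu wq qu (edotC u q) qu u1; ring.
  have v2 : edot v (- D *: u + q) = - (a * D) + c * edot q q.
    by rewrite vE !edotE wu wq qu (edotC u q) qu u1; ring.
  have <- : edot v n = edot w w + a * p - (c * t) * edot q q.
    by rewrite vE nE !edotE (edotC u q) (edotC u w) (edotC q w) wu wq qu u1; ring.
  by apply: h; rewrite ?v1 ?v2; lra.
have t0 : 0 <= t.
  have := test 0 1 ltr01; rewrite normr0 mul0r mul1r mul0r addr0 => /(_ Q0).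
  have := edot_ge0 w; rewrite mul1r => h1 h2.
  rewrite -(pmulr_lge0 _ Q0); lra.
have w0 : w = 0.
  apply: edot_eq0; apply: le_anti; rewrite edot_ge0 andbT.
  apply/ler_addgt0Pl => d d0.
  have tq : 0 < t * edot q q + 1 by rewrite ltr_wpDl// mulr_ge0// ltW.
  have c0 : 0 < d / (t * edot q q + 1) by rewrite divr_gt0.
  have := test 0 _ c0; rewrite normr0 mul0r => /(_ (mulr_gt0 c0 Q0)).
  set c := d / _ in c0 *; have : c * (t * edot q q + 1) = d by rewrite divfK ?gt_eqF.
  lra.
have pt : `|p| <= t * D.
  apply/ler_addgt0Pl => d' d'0.
  have t1 : 0 < t + 1 by rewrite ltr_wpDl.
  pose d := d' / (t + 1); have d0 : 0 < d by rewrite divr_gt0.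
  have td : t * d <= d'.
    by rewrite /d mulrCA ler_piMr ?(ltW d'0)// ler_pdivrMr// mul1r lerDl.
  have Dd : 0 < D + d by rewrite addr_gt0.
  have := test (Num.sg p * edot q q) (D + d) Dd; rewrite w0 edot0l add0r.
  rewrite mulrAC -normrEsg => /(_ _) h1.
  have {}h1 : `|p| * edot q q - (D + d) * t * edot q q <= 0.
    apply: h1; rewrite normrM (gtr0_norm Q0).
    apply: (@le_lt_trans _ _ (1 * edot q q * D)).
      by rewrite -!mulrA ler_wpM2r ?mulr_ge0 ?(ltW Q0) ?(ltW D0)// normr_sg lern1 leq_b1.
    by rewrite mul1r mulrC ltr_pM2r// ltrDl.
  have : `|p| <= (D + d) * t by rewrite -(ler_pM2r Q0) -subr_le0.
  lra.
have nn2 : p ^+ 2 + t ^+ 2 * edot q q = 1.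
  rewrite -nn nE w0 addr0 !edotE (edotC u q) qu u1; ring.
have p2 : p ^+ 2 <= t ^+ 2 * D ^+ 2.
  by rewrite -exprMn -[leLHS]real_normK ?num_real// ler_sqr ?nnegrE ?mulr_ge0// ltW.
have te : 1 <= t * e.
  rewrite -ler_sqr ?nnegrE ?mulr_ge0 ?(ltW e0)// expr1n exprMn -Dq; lra.
have nu : edot n u = p by rewrite nE w0 addr0 !edotE qu u1; ring.
exists t; split; first by rewrite -[leLHS]mul1r ler_pdivrMr.
  by rewrite nu {1}nE w0 addr0.
rewrite nu -ler_sqr ?nnegrE ?divr_ge0 ?(ltW D0) ?(ltW e0)// real_normK ?num_real//.
rewrite expr_div_n ler_pdivlMr ?exprn_gt0//.
have -> : p ^+ 2 = 1 - t ^+ 2 * edot q q by lra.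
have -> : D ^+ 2 = e ^+ 2 - edot q q by lra.
have t2e : 1 <= t ^+ 2 * e ^+ 2 by rewrite -exprMn exprn_ege1.
rewrite mulrBl mul1r lerD2l lerN2 mulrAC.
by rewrite ler_peMl// ltW.
Qed.

(** The first two conditions say that x is at distance e from both ends of the gap, that is, on the
    edge where two balls meet; the others record what [polar_wedge] gives for n. *)
Definition edge_normal a b (x n : 'rV[R]_m) :=
  [/\ ax x = (a + b) / 2,
      ((b - a) / 2) ^+ 2 + edot (transverse x0 u x) (transverse x0 u x) = e ^+ 2,
      `|edot n u| <= (b - a) / (2 * e) &
      exists2 t, e^-1 <= t & n = edot n u *: u - t *: transverse x0 u x].

(* Either x has a single nearest point in the line set, and then n points to it,
   or it is equidistant from the two ends of a gap. *)
Lemma nor_cases (x n : 'rV[R]_m) : ld x = e -> edot n n = 1 -> normal_cone X x n ->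
  (exists k, [/\ K k, enorm (x - pt k) = e & x = pt k - e *: n]) \/
  (exists a b, [/\ gap K a b, b - a < 2 * e & edge_normal a b x n]).
Proof.
have [e0 hcrit] := he => xe nn hn.
(* Directions at an acute angle to x - p for every nearest point p are tangent, so n is in their
   polar. *)
have PH v : (forall k, K k -> enorm (x - pt k) = e -> 0 < edot v (x - pt k)) -> edot v n <= 0.
  by move=> hv; apply: hn; apply: tangent_cone_outside.
have [k Kk kx] := line_dist_attained x0 u1 cK K0 x; rewrite xe in kx.
have near k' : K k' -> enorm (x - pt k') = e -> `|ax x - k'| = dist1 K (ax x).
  by move=> Kk' h; apply: line_dist_axis_eq; rewrite ?xe.
have [[k' [Kk' k'x kk']]|uniq] := pselect (exists k', [/\ K k', enorm (x - pt k') = e & k' <> k]).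
  right; have h1 := near _ Kk (esym kx); have h2 := near _ Kk' k'x.
  set D := dist1 K (ax x) in h1 h2.
  have D0 : 0 < D.
    rewrite lt_neqAle dist1_ge0// andbT eq_sym; apply/eqP => D0; apply: kk'.
    by move: h1 h2; rewrite D0 => /normr0_eq0 h1 /normr0_eq0 h2; lra.
  have [a [b [Ka Kb aE bE both]]] : exists a b, [/\ K a, K b, a = ax x - D, b = ax x + D &
      forall c, K c -> enorm (x - pt c) = e -> c = a \/ c = b].
    have two c : K c -> enorm (x - pt c) = e -> c = ax x - D \/ c = ax x + D.
      move=> Kc /(near _ Kc) h; move/eqP: h; rewrite eqr_norml => /andP[/orP[] /eqP h _]; [left|right]; rewrite /D; lra.
    have [Ka Kb] : K (ax x - D) /\ K (ax x + D).
      case: (two _ Kk (esym kx)) (two _ Kk' k'x) => E1 [] E2; rewrite -?E1 -?E2; split => //.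
        by exfalso; apply: kk'; rewrite E2.
      by exfalso; apply: kk'; rewrite E2.
    by exists (ax x - D), (ax x + D).
  have gab : gap K a b.
    split => //; first by rewrite aE bE; lra.
    move=> t /andP[a_t tb] Kt; have := @dist1_le R K cK K0 (ax x) t Kt.
    rewrite -/D leNgt => /negP; apply; rewrite ltr_distl; apply/andP; split; lra.
  have ldq : D ^+ 2 + edot (transverse x0 u x) (transverse x0 u x) = e ^+ 2.
    by rewrite -xe line_dist_sqr.
  (* Otherwise x would be the midpoint of a gap of length 2e. *)
  have q0 : transverse x0 u x != 0.
    apply/eqP => q0; move: ldq; rewrite q0 edot0l addr0 => /eqP.
    rewrite eqrXn2 ?(ltW D0) ?(ltW e0)// => /eqP De.
    by apply: (hcrit a b gab); rewrite aE bE De; ring.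
  have De : D < e.
    rewrite -ltr_sqr ?nnegrE ?(ltW D0) ?(ltW e0)// -ldq ltrDl -enorm_sqr exprn_gt0//.
    exact: enorm_gt0.
  have [|t [t1 nE n1]] := polar_wedge (edot_transverse x0 u1 x) q0 D0 ldq nn.
    move=> v va vb; apply: PH => c Kc cx; rewrite sub_axis_point//.
    case: (both _ Kc cx) => ->; rewrite ?aE ?bE.
      by rewrite (_ : ax x - (ax x - D) = D)//; ring.
    by rewrite (_ : ax x - (ax x + D) = - D)//; ring.
  exists a, b; split => //; first by rewrite aE bE; lra.
  have abD : b - a = 2 * D by rewrite aE bE; ring.
  split; last by exists t.
  - by rewrite aE bE; field.
  - by rewrite abD mulrC mulKf// pnatr_eq0.
  - by rewrite abD -mulf_div divff ?mul1r// pnatr_eq0.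
left; exists k; split => //.
have AA : edot (x - pt k) (x - pt k) = e ^+ 2 by rewrite -enorm_sqr -kx.
have A : x - pt k = - e *: n.
  apply: polar_ray AA nn _ => v v0; apply: PH => k' Kk' k'x.
  have [->//|k'k] := pselect (k' = k).
  by exfalso; apply: uniq; exists k'.
by rewrite -scaleNr -A addrC subrK.
Qed.

End Normals.

(** * Lower bound for the total curvature *)

Section TangentOfNormalBundle.
Context {R : realType} {k : nat}.
Variables (x0 u : 'rV[R]_k.+1) (K : set R).
Hypotheses (u1 : edot u u = 1) (cK : compact K) (K0 : K !=set0).
Variable e : R.
Hypothesis he : noncritical K e.
Local Notation ld := (line_dist x0 u K).
Local Notation ax := (axial x0 u).
Local Notation pt := (axis_point x0 u).
Local Notation X := [set y : 'rV[R]_k.+1 | e <= ld y].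

(** The room 2s beyond 2e keeps the balls about later points of K away from a neighbourhood of the
    hemisphere to the right of a. *)
Definition right_free a s := [/\ K a, 0 < s & forall c, K c -> a < c -> a + 2 * e + 2 * s <= c].

(** Normals of the complement point into the ball, whence the minus sign. *)
Definition sphere_point a (n : 'rV[R]_k.+1) := row_mx (pt a - e *: n) n.

Lemma axial_axis_point a : ax (pt a) = a.
Proof. by rewrite /axial /axis_point addrAC subrr add0r edotZl u1 mulr1. Qed.

Lemma axial_sphere_point a n : ax (pt a - e *: n) = a - e * edot n u.
Proof. by rewrite axialD axial_axis_point edotNl edotZl. Qed.

(* To the right of a gap end, the parallel set is locally a half ball of radius e,
   so that its complement has all principal curvatures equal to -1/e there. *)
Lemma nor_sphere_point a s n : right_free a s -> edot n n = 1 -> edot n u < 0 ->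
  nor X (sphere_point a n).
Proof.
have [e0 _] := he => -[Ka s0 free] nn nu.
have n1 : -1 <= edot n u.
  have := edot_abs n u; rewrite !(@enorm_eq _ _ _ 1) ?expr1n// mulr1 ler_norml.
  by move=> /andP[].
have far c : K c -> e <= enorm (pt a - e *: n - pt c).
  move=> Kc; rewrite enorm_ge ?(ltW e0)// edot_sub_axis_point// axial_sphere_point.
  have -> : e ^+ 2 = (a - e * edot n u - a) ^+ 2 + edot (transverse x0 u (pt a - e *: n)) (transverse x0 u (pt a - e *: n)).
    have := edot_sub_axis_point x0 u1 (pt a - e *: n) a.
    rewrite axial_sphere_point => <-.
    rewrite (_ : pt a - e *: n - pt a = - e *: n); last by apply/rowP => i; rewrite !mxE; ring.
    by rewrite !edotE nn; ring.
  rewrite lerD2r; have en : 0 < - (e * edot n u) by rewrite -mulrN mulr_gt0// oppr_gt0.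
  have en1 : - (e * edot n u) <= e by rewrite -mulrN ler_piMr ?(ltW e0)//; lra.
  rewrite -[leRHS]real_normK ?num_real// -[leLHS]real_normK ?num_real// ler_sqr ?nnegrE//.
  rewrite [leLHS]gtr0_norm; last lra.
  have [ca|ac] := leP c a; first by rewrite ger0_norm; lra.
  have := free _ Kc ac => h1; rewrite ler0_norm; lra.
have ldX : X (pt a - e *: n) by apply: line_dist_ge.
split; rewrite /sphere_point ?row_mxKl ?row_mxKr.
- split; first exact: subset_closure.
  apply/enorm_closureP => r r0.
  pose t := Num.min (e / 2) (r / 2).
  have t0 : 0 < t by rewrite lt_min !divr_gt0.
  have te : t <= e / 2 by rewrite ge_min lexx.
  have tr : t <= r / 2 by rewrite ge_min lexx orbT.
  have nn1 : enorm n = 1 by apply: enorm_eq; rewrite ?expr1n.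
  exists (pt a - (e - t) *: n).
    apply/negP; rewrite -ltNge; apply: (le_lt_trans (line_dist_le x0 u1 cK K0 _ Ka)).
    rewrite addrAC subrr add0r enormN enormZ nn1 mulr1 ger0_norm; lra.
  have -> : pt a - (e - t) *: n - (pt a - e *: n) = t *: n.
    by apply/rowP => i; rewrite !mxE; ring.
  rewrite enormZ nn1 mulr1 gtr0_norm//; lra.
- by apply/esphereE.
- move=> v hv; rewrite leNgt; apply/negP => vn.
  have ev : 0 < (enorm v + 1) / (2 * e) + 1.
    by rewrite addr_gt0// divr_gt0 ?mulr_gt0// ltr_wpDl// enorm_ge0.
  pose c := Num.min 1 (edot v n / ((enorm v + 1) / (2 * e) + 1) / 2).
  have c0 : 0 < c by rewrite lt_min ltr01 !divr_gt0.
  have c1 : c <= 1 by rewrite ge_min lexx.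
  have cv : c * ((enorm v + 1) / (2 * e) + 1) <= edot v n / 2.
    rewrite -ler_pdivlMr// mulrAC; by rewrite ge_min lexx orbT.
  have [y [r [Xy r0 yc rv]]] := hv c c0.
  pose dy := y - (pt a - e *: n).
  (* X avoids the open ball of radius e about [pt a]. The right-hand side is of second order along
     points approaching x, so (v, n) <= 0 for tangent v. *)
  have dyn : 2 * e * edot dy n <= edot dy dy.
    have : e ^+ 2 <= edot (y - pt a) (y - pt a).
      by rewrite -enorm_ge ?(ltW e0)//; apply: (le_trans Xy); exact: line_dist_le.
    have -> : y - pt a = dy - e *: n by apply/rowP => i; rewrite !mxE; ring.
    by move: dy => w; rewrite !edotE nn (edotC n w); lra.
  have rdy : r * enorm dy <= enorm v + 1.
    rewrite -[r in r * _]gtr0_norm// -enormZ.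
    have := enorm_triangleB (r *: dy) v; rewrite -/dy in rv; lra.
  have h1 : edot v n <= r * edot dy n + c.
    have := edot_abs (v - r *: dy) n; rewrite (@enorm_eq _ _ n 1) ?expr1n// mulr1.
    rewrite enormB => /(le_trans (ler_norm _)); rewrite edotBl edotZl -/dy in rv *; lra.
  have h2 : r * edot dy n <= c * ((enorm v + 1) / (2 * e)).
    rewrite mulrA ler_pdivlMr ?mulr_gt0//.
    apply: (@le_trans _ _ (r * edot dy dy)); first by rewrite -mulrA ler_wpM2l ?(ltW r0)// mulrC.
    rewrite -enorm_sqr expr2 mulrA mulrC ler_pM ?enorm_ge0 ?mulr_ge0 ?(ltW r0) ?enorm_ge0//.
    exact: ltW.
  lra.
Qed.

(** In this range of axial coordinates a is the only possible nearest point, and no gap shorter than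
    2e has its midpoint there, so there are no edges. *)
Lemma nor_local a s (z : 'rV[R]_(k.+1 + k.+1)) : right_free a s -> nor X z ->
  a < ax (lsubmx z) -> ax (lsubmx z) < a + e + s ->
  z = sphere_point a (rsubmx z) /\ edot (rsubmx z) u < 0.
Proof.
have [e0 _] := he => -[Ka s0 free] [bz /esphereE nn cz] az zs.
have ldz : ld (lsubmx z) = e by exact: line_dist_boundary_outside bz.
suff zE : lsubmx z = pt a - e *: rsubmx z.
  split; first by rewrite /sphere_point -zE hsubmxK.
  move: az; rewrite zE axial_sphere_point; rewrite ltrBrDl -ltrBrDr subrr pmulr_rlt0//.
case: (nor_cases u1 cK K0 he ldz nn cz) => [[c [Kc cx ->]]|[c [b [[Kc Kb cb gcb] bc2 [tE _ _ _]]]]].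
  suff -> : c = a by [].
  have h1 : `|ax (lsubmx z) - c| = dist1 K (ax (lsubmx z)).
    by apply: line_dist_axis_eq; rewrite ?ldz.
  have h2 := dist1_le cK K0 (ax (lsubmx z)) Ka.
  have h3 : dist1 K (ax (lsubmx z)) <= e.
    rewrite -(@ler_sqr _ _ e) ?nnegrE ?dist1_ge0 ?(ltW e0)// -ldz line_dist_sqr lerDl.
    exact: edot_ge0.
  rewrite gtr0_norm ?subr_gt0// in h2.
  have [ca|ac|//] := ltgtP c a.
    by rewrite gtr0_norm in h1; lra.
  have := free _ Kc ac => h4; rewrite ler0_norm in h1; lra.
exfalso; have ac : a <= c.
  rewrite leNgt; apply/negP => ca; apply: (gcb a) => //; rewrite ca /=; lra.
have := free b Kb; rewrite (le_lt_trans ac)// => /(_ isT); lra.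
Qed.

Lemma le0_of_small (x c : R) : 0 <= c -> (forall r, 0 < r <= 1 -> x <= c * r) -> x <= 0.
Proof.
move=> c0 h; apply/ler_addgt0Pl => d d0; rewrite addr0.
have c1 : 0 < c + 1 by rewrite ltr_wpDl.
apply: (le_trans (h (Num.min 1 (d / (c + 1))) _)).
  by rewrite lt_min ltr01 divr_gt0//= ge_min lexx.
apply: (@le_trans _ _ (c * (d / (c + 1)))); first by rewrite ler_wpM2l// ge_min lexx orbT.
by rewrite mulrCA ler_piMr ?(ltW d0)// ler_pdivrMr// mul1r lerDl.
Qed.

Lemma sphere_pointB a n n' : sphere_point a n' - sphere_point a n =
  row_mx (- e *: (n' - n)) (n' - n).
Proof.
rewrite /sphere_point opp_row_mx add_row_mx; congr row_mx.
by apply/rowP => i; rewrite !mxE; ring.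
Qed.

(** Locally the bundle is the image of the unit sphere under n |-> (pt a - e n, n), so its tangent
    space is the graph of v |-> - e v over the vectors orthogonal to n. *)
Lemma tangent_cone_nor a s n : right_free a s -> edot n n = 1 -> edot n u < 0 ->
  tangent_cone (nor X) (sphere_point a n) =
  [set w | exists2 v, edot v n = 0 & w = row_mx (- e *: v) v].
Proof.
have [e0 _] := he => fa nn nu; have [_ s0 _] := fa.
have un : enorm u = 1 by apply: enorm_eq; rewrite ?expr1n.
have n_n : enorm n = 1 by apply: enorm_eq; rewrite ?expr1n.
have n1 : -1 <= edot n u.
  by have := edot_abs n u; rewrite un n_n mulr1 ler_norml => /andP[].
apply/seteqP; split => [w hw|_ [v vn ->]].
  have [w1 w1E] : exists w1, w1 = lsubmx w by eexists.
  have [w2 w2E] : exists w2, w2 = rsubmx w by eexists.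
  have approx r0 : 0 < r0 -> enorm (w1 + e *: w2) <= (1 + e) * r0 /\
      `|edot w2 n| <= r0 + (enorm w2 + r0) * r0.
    move=> r00.
    (* Points of the bundle within d have axial coordinate strictly between a and a + e + s, so that
       [nor_local] applies to them. *)
    pose d := Num.min r0 (Num.min s (e * - edot n u)).
    have d0 : 0 < d by rewrite !lt_min r00 s0 mulr_gt0// oppr_gt0.
    have [y [r [Ny rp yd rw]]] := hw d d0.
    have dr0 : d <= r0 by rewrite ge_min lexx.
    have ds : d <= s by rewrite /d !ge_min lexx orbT.
    have dn : d <= e * - edot n u by rewrite /d !ge_min lexx !orbT.
    have axy : `|ax (lsubmx y) - ax (pt a - e *: n)| < d.
      rewrite /axial -edotBl; apply: (le_lt_trans (edot_abs _ _)); rewrite un mulr1.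
      apply: le_lt_trans yd; apply: le_trans (enorm_lsubmx _).
      rewrite [lsubmx (_ - _)]raddfB /= /sphere_point row_mxKl (_ : lsubmx y - x0 - _ = lsubmx y - (pt a - e *: n))//.
      by apply/rowP => i; rewrite !mxE; ring.
    move: axy; rewrite axial_sphere_point ltr_distl => /andP[ay1 ay2].
    have en1 : - (e * edot n u) <= e by rewrite -mulrN ler_piMr ?(ltW e0)//; lra.
    have [||yE nu'] := nor_local fa Ny; [lra|lra|].
    have nn' : edot (rsubmx y) (rsubmx y) = 1 by case: Ny => _ /esphereE.
    move: (rsubmx y) nn' yE => n' nn' yE.
    have [dl dlE] : exists dl, dl = n' - n by eexists.
    rewrite yE sphere_pointB -dlE in yd rw.
    have dld : enorm dl < d.
      by apply: le_lt_trans yd; have := enorm_rsubmx (row_mx (- e *: dl) dl); rewrite row_mxKr.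
    have r1 : enorm (w1 + (r * e) *: dl) < d.
      apply: le_lt_trans rw; have := enorm_lsubmx (r *: row_mx (- e *: dl) dl - w).
      rewrite [lsubmx (_ - _)]raddfB /= scale_row_mx row_mxKl -w1E -enormN.
      by rewrite (_ : - (r *: (- e *: dl) - w1) = w1 + (r * e) *: dl)//; apply/rowP => i; rewrite !mxE; ring.
    have r2 : enorm (w2 - r *: dl) < d.
      apply: le_lt_trans rw; have := enorm_rsubmx (r *: row_mx (- e *: dl) dl - w).
      by rewrite [rsubmx (_ - _)]raddfB /= scale_row_mx row_mxKr -w2E -enormN opprB.
    have dn2 : edot dl n = - (edot dl dl / 2).
      by rewrite dlE !edotE nn nn' (edotC n n'); field.
    have rdl : r * enorm dl <= enorm w2 + d.
      rewrite -[r in r * _]gtr0_norm// -enormZ.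
      by have := enorm_triangleB (r *: dl) w2; rewrite enormB; lra.
    split.
      have -> : w1 + e *: w2 = (w1 + (r * e) *: dl) + e *: (w2 - r *: dl).
        by apply/rowP => i; rewrite !mxE; ring.
      apply: (le_trans (enormD _ _)); rewrite enormZ gtr0_norm// mulrDl mul1r.
      apply: lerD; first lra.
      by rewrite ler_wpM2l ?(ltW e0)//; lra.
    have -> : edot w2 n = edot (w2 - r *: dl) n - r * (edot dl dl / 2).
      by rewrite edotBl edotZl dn2; ring.
    apply: (le_trans (ler_normB _ _)); apply: lerD.
      by apply: (le_trans (edot_abs _ _)); rewrite n_n mulr1; lra.
    rewrite normrM gtr0_norm// -enorm_sqr normrM ger0_norm ?sqr_ge0// expr2 !mulrA.
    rewrite [X in _ * X]gtr0_norm ?invr_gt0// ler_pdivrMr//.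
    have en := enorm_ge0 dl; have ew := enorm_ge0 w2.
    apply: (@le_trans _ _ ((enorm w2 + r0) * r0)).
      by apply: ler_pM => //; [rewrite mulr_ge0 ?(ltW rp)|lra|lra].
    by rewrite ler_peMr ?mulr_ge0 ?addr_ge0 ?(ltW r00)//; lra.
  exists w2.
    apply/eqP; rewrite -normr_le0; apply: (@le0_of_small _ (2 + enorm w2)).
      by rewrite addr_ge0 ?enorm_ge0.
    move=> r /andP[r0 r1]; have [_ h] := approx r r0; apply: (le_trans h).
    have : r * r <= r by rewrite ler_piMr ?(ltW r0).
    lra.
  have : w1 + e *: w2 = 0.
    apply: enorm_eq0; apply: le_anti; rewrite enorm_ge0 andbT.
    apply: (@le0_of_small _ (1 + e)); first by rewrite addr_ge0 ?(ltW e0).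
    by move=> r /andP[r0 _]; have [] := approx r r0.
  move=> /eqP; rewrite addr_eq0 => /eqP w12.
  by rewrite -[LHS]hsubmxK -w1E -w2E w12 scaleNr.
move=> r0 r00.
have [V VE] : exists V, V = edot v v by eexists.
have V0 : 0 <= V by rewrite VE edot_ge0.
have v0 := enorm_ge0 v.
pose B := enorm v + V + 1; have B1 : 1 <= B by rewrite /B; lra.
have nu0 : 0 < - edot n u by rewrite oppr_gt0.
pose t := Num.min (r0 / (2 * (1 + e) * B)) (- edot n u / (4 * B)).
have B0 : 0 < B by lra.
have e1 : 0 < 1 + e by rewrite addr_gt0.
have t0 : 0 < t by rewrite lt_min !divr_gt0 ?mulr_gt0.
have tr : t * B * (1 + e) <= r0 / 2.
  have : t <= r0 / (2 * (1 + e) * B) by rewrite ge_min lexx.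
  rewrite ler_pdivlMr ?mulr_gt0//; lra.
have tB : t * B <= - edot n u / 4.
  have : t <= - edot n u / (4 * B) by rewrite ge_min lexx orbT.
  rewrite ler_pdivlMr ?mulr_gt0//; lra.
have tv : t * enorm v <= t * B by rewrite ler_wpM2l ?(ltW t0)// /B; lra.
have tV : t * V <= t * B by rewrite ler_wpM2l ?(ltW t0)// /B; lra.
have t1 : t <= t * B by rewrite ler_peMr ?(ltW t0).
have [c cE] : exists c, c = t * (t * V) / 4 by eexists.
have c0 : 0 <= c by rewrite cE divr_ge0// !mulr_ge0 ?(ltW t0).
have c1 : c <= 1 / 16.
  have : t * (t * V) <= 1 / 4 * (t * V) by rewrite ler_wpM2r ?mulr_ge0 ?(ltW t0)//; lra.
  rewrite cE; lra.
have c10 : 0 < 1 + c by lra.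
have c1n : 1 + c != 0 by rewrite gt_eqF.
(* A stereographic parametrization of the great circle through n in direction v: (1 - c) ^ 2 + t ^ 2
   |v| ^ 2 = (1 + c) ^ 2, so this is a unit vector without square roots. *)
pose n' := (1 + c)^-1 *: ((1 - c) *: n + t *: v).
have nn' : edot n' n' = 1.
  rewrite /n' !edotE nn (edotC n v) vn -VE; have -> : V = 4 * c / t ^+ 2.
    by rewrite cE; field; rewrite gt_eqF.
  by field; rewrite c1n gt_eqF.
have vu : edot v u <= enorm v by have := edot_le v u; rewrite un mulr1.
have nu' : edot n' u < 0.
  rewrite /n' !edotE pmulr_rlt0 ?invr_gt0//.
  have : t * edot v u <= t * enorm v by rewrite ler_wpM2l ?(ltW t0).
  have : (1 - c) * (- edot n u) >= (1 / 2) * - edot n u.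
    by rewrite ler_wpM2r ?(ltW nu0)//; lra.
  lra.
have n'E : n' - n = (t / (1 + c)) *: (v - (t * V / 2) *: n).
  have -> : t * V / 2 = 2 * c / t by rewrite cE; field; rewrite gt_eqF.
  by apply/rowP => i; rewrite /n' !mxE; field; rewrite c1n gt_eqF.
have dE : enorm (n' - n) <= t * B.
  rewrite n'E enormZ ger0_norm ?divr_ge0 ?(ltW t0) ?(ltW c10)//.
  apply: (@le_trans _ _ (t * (enorm v + t * V / 2))).
    apply: ler_pM; rewrite ?enorm_ge0 ?divr_ge0 ?(ltW t0) ?(ltW c10)//.
      by rewrite ler_pdivrMr// ler_peMr ?(ltW t0)//; lra.
    apply: (le_trans (enormD _ _)); rewrite enormN enormZ n_n mulr1 ger0_norm//.
    by rewrite divr_ge0// mulr_ge0// ltW.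
  rewrite ler_wpM2l ?(ltW t0)// /B.
  have : t * V <= 1 / 4 * V + 0 by rewrite addr0 ler_wpM2r//; lra.
  lra.
exists (sphere_point a n'), ((1 + c) / t); split.
- exact: nor_sphere_point fa nn' nu'.
- by rewrite divr_gt0.
- rewrite sphere_pointB; apply: (le_lt_trans (enorm_row_mx _ _)).
  rewrite enormZ normrN gtr0_norm//.
  have : enorm (n' - n) * (1 + e) <= t * B * (1 + e) by rewrite ler_wpM2r ?(ltW e1).
  lra.
- rewrite sphere_pointB n'E scale_row_mx opp_row_mx add_row_mx.
  apply: (le_lt_trans (enorm_row_mx _ _)).
  have -> : ((1 + c) / t) *: ((t / (1 + c)) *: (v - (t * V / 2) *: n)) - v = - (t * V / 2) *: n.
    by apply/rowP => i; rewrite !mxE; field; rewrite c1n gt_eqF.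
  have -> : ((1 + c) / t) *: (- e *: ((t / (1 + c)) *: (v - (t * V / 2) *: n))) - - e *: v =
      (e * (t * V / 2)) *: n.
    by apply/rowP => i; rewrite !mxE; field; rewrite c1n gt_eqF.
  rewrite !enormZ n_n !mulr1 normrN !ger0_norm ?mulr_ge0 ?(ltW e0) ?(ltW t0)//.
  have : t * V * (1 + e) <= t * B * (1 + e) by rewrite ler_wpM2r ?(ltW e1).
  lra.
Qed.

End TangentOfNormalBundle.

(** * Curvature along a hemisphere *)

Section CurvatureLower.
Context {R : realType} {k : nat}.
Variables (x0 u : 'rV[R]_k.+1) (K : set R).
Hypotheses (u1 : edot u u = 1) (cK : compact K) (K0 : K !=set0).
Variable e : R.
Hypothesis he : noncritical K e.
Local Notation ld := (line_dist x0 u K).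
Local Notation ax := (axial x0 u).
Local Notation pt := (axis_point x0 u).
Local Notation X := [set y : 'rV[R]_k.+1 | e <= ld y].

Definition theta : R := - e^-1 / Num.sqrt (1 + (- e^-1) ^+ 2).

Let root := Num.sqrt (1 + (- e^-1) ^+ 2).

Let root0 : 0 < root.
Proof. by rewrite sqrtr_gt0 ltr_wpDr// sqr_ge0. Qed.

Let en : e != 0.
Proof. by case: he => e0 _; rewrite gt_eqF. Qed.

Lemma theta_lt0 : theta < 0.
Proof.
by case: he => e0 _; rewrite /theta mulNr oppr_lt0 divr_gt0// invr_gt0.
Qed.

(** |theta| = 1 / sqrt (1 + e ^ 2), so the density [theta ^+ k] on a hemisphere stays away from 0 as
    e tends to 0. *)
Lemma theta_ge : e <= 1 -> 1 / 2 <= `|theta|.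
Proof.
case: he => e0 _ e1.
have r0 := root0; rewrite /theta -/root ltr0_norm; last exact: theta_lt0.
rewrite mulNr opprK ler_pdivlMr//.
rewrite -ler_sqr ?nnegrE ?mulr_ge0 ?invr_ge0 ?(ltW e0) ?(ltW r0)//.
rewrite exprMn sqr_sqrtr ?addr_ge0 ?sqr_ge0// sqrrN.
have : 1 <= e^-1 ^+ 2 by rewrite exprn_ege1// invf_ge1.
move: (e^-1 ^+ 2) => t ht; lra.
Qed.

(** A curvature vector in the graph of v |-> (- e v, v) has curvature -1/e, since infinite curvature
    would force a zero direction. Conversely, any orthonormal basis of the vectors orthogonal to n
    serves as principal directions. *)
Lemma principal_curvatures_sphere a s n : right_free K e a s -> edot n n = 1 -> edot n u < 0 ->
  principal_curvatures X (sphere_point x0 u e a n) = [set fun=> (- e^-1)%:E].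
Proof.
move=> fa nn nu; have tc := tangent_cone_nor x0 u1 cK K0 he fa nn nu.
pose g (b : 'rV[R]_k.+1) := curvature_vector (- e^-1)%:E b.
have gE b : g b = theta *: row_mx (- e *: b) b.
  rewrite /g /curvature_vector scale_row_mx; congr row_mx.
  by rewrite scalerA /theta; congr (_ *: _); rewrite mulrAC mulrNN mulVf// mul1r.
have th0 : theta != 0 by rewrite lt_eqF// theta_lt0.
apply/seteqP; split => [kap [a' [kinf aa tE]]|_ ->].
  apply/funext => i.
  have : (tangent_cone (nor X) (sphere_point x0 u e a n)) (curvature_vector (kap i) (a' i)).
    by rewrite tE /=; apply: memv_span; apply: map_f; rewrite mem_enum.
  rewrite tc => -[v vn].
  have aii := aa i i; rewrite eqxx in aii; have ki := kinf i.
  case: (kap i) ki => [r _|_|//] /eq_row_mx[].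
    set q := Num.sqrt _ => h1 h2; congr EFin.
    have q0 : 0 < q by rewrite sqrtr_gt0 ltr_wpDr// sqr_ge0.
    have h3 : edot (q^-1 *: a' i) (a' i) = edot ((- e * (r / q)) *: a' i) (a' i).
      by rewrite h1 -h2 scalerA.
    move: h3; rewrite !edotZl aii /= !mulr1 => h3.
    have h4 : 1 = - e * r.
      by rewrite -(divff (lt0r_neq0 q0)) h3; field; rewrite gt_eqF.
    apply: (mulfI en); rewrite mulrN divff//; lra.
  move=> h1 h2; exfalso; have v0 : v = 0.
    by move/esym/eqP: h1; rewrite scaler_eq0 oppr_eq0 (negPf en) => /eqP.
  by move: aii; rewrite h2 v0 edot0l /= => /esym/eqP; rewrite oner_eq0.
have [b [b0 bb bE]] := orthonormal_frame nn.
exists (fun i => b (lift ord0 i)); split.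
- by move=> i; rewrite ltNyr.
- by move=> i j; rewrite bb (inj_eq lift_inj).
rewrite tc; apply/seteqP; split => [_ [v vn ->]|w /= wS].
  rewrite /= (bE v) big_ord_recl b0 vn scale0r add0r.
  have -> : row_mx (- e *: (\sum_(i < k) edot v (b (lift ord0 i)) *: b (lift ord0 i)))
      (\sum_(i < k) edot v (b (lift ord0 i)) *: b (lift ord0 i)) =
      \sum_(i < k) (edot v (b (lift ord0 i)) / theta) *: g (b (lift ord0 i)).
    rewrite scaler_sumr.
    rewrite (eq_bigr (fun i => row_mx (- e *: (edot v (b (lift ord0 i)) *: b (lift ord0 i))) (edot v (b (lift ord0 i)) *: b (lift ord0 i)))); last first.
      move=> i _; rewrite gE scalerA divfK// scale_row_mx; congr row_mx.
      by rewrite !scalerA mulrC.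
    elim/big_rec3 : _ => [|i y1 y2 y3 _ <-]; first by rewrite row_mx0.
    by rewrite add_row_mx.
  apply: memv_suml => i _; apply: memvZ; apply: memv_span.
  by apply: (map_f (fun i : 'I_k => g (b (lift ord0 i)))); rewrite mem_enum.
pose s' := [seq curvature_vector (- e^-1)%:E (b (lift ord0 i)) | i : 'I_k].
have Qsum (I : Type) (r : seq I) (P : pred I) (f : I -> 'rV[R]_(k.+1 + k.+1)) :
    (forall i, P i -> exists2 v, edot v n = 0 & f i = row_mx (- e *: v) v) ->
    exists2 v, edot v n = 0 & \sum_(i <- r | P i) f i = row_mx (- e *: v) v.
  move=> h; elim/big_ind : _ => [|x y [v vn ->] [v' v'n ->]|i Pi]; last exact: h.
    by exists 0; rewrite ?edot0l// scaler0 row_mx0.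
  by exists (v + v'); rewrite ?edotDl ?vn ?v'n ?addr0// add_row_mx scalerDr.
have := @coord_span _ _ _ (in_tuple s') w wS => ->.
apply: Qsum => i _.
have /mapP[j _ ->] : (in_tuple s')`_i \in s' by apply: mem_nth.
exists ((coord (in_tuple s') i w * theta) *: b (lift ord0 j)).
  by rewrite edotZl -b0 bb mulr0.
rewrite -/(g _) gE scalerA !scale_row_mx; congr row_mx.
by rewrite !scalerA mulrC.
Qed.

Lemma curvature_density_sphere a s n : right_free K e a s -> edot n n = 1 -> edot n u < 0 ->
  curvature_density X (sphere_point x0 u e a n) = theta ^+ k.
Proof.
move=> fa nn nu; rewrite /curvature_density (principal_curvatures_sphere fa nn nu).
rewrite image_set1; have -> : \prod_(i < k.+1.-1) curvature_factor (- e^-1)%:E = theta ^+ k.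
  by rewrite prodr_const card_ord.
by case: xgetP => [y _ ->//|/(_ (theta ^+ k))]; case.
Qed.

(** Width e takes in the whole hemisphere to the right of a, while slabs at different ends remain
    disjoint, the next point of K being more than 2e away. *)
Definition slab a := [set y : 'rV[R]_k.+1 | a < ax y] `&` [set y | ax y <= a + e].

Definition cap a := nor X `&` [set z : 'rV[R]_(k.+1 + k.+1) | slab a (lsubmx z)].

(** Without boundaries and cones in its description, the cap is an intersection of two closed sets
    and an open one, hence measurable. *)
Lemma capE a s : right_free K e a s -> cap a =
  [set z | [/\ lsubmx z + e *: rsubmx z = pt a, edot (rsubmx z) (rsubmx z) = 1 & edot (rsubmx z) u < 0]].
Proof.
case: (he) => e0 _ fa; have [_ s0 _] := fa.
apply/seteqP; split => [z [nz [az za]]|z [zE nn nu]].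
  have [||zE nu] := nor_local u1 cK K0 he fa nz; [by []|by rewrite (le_lt_trans za)// ltrDl|].
  split => //; last by case: nz => _ /esphereE.
  by rewrite {1}zE /sphere_point row_mxKl subrK.
have zE' : z = sphere_point x0 u e a (rsubmx z).
  by rewrite /sphere_point -zE addrK hsubmxK.
split; first by rewrite zE'; exact: nor_sphere_point fa nn nu.
rewrite /slab /= -(addrK (e *: rsubmx z) (lsubmx z)) zE axial_sphere_point//.
have un : enorm u = 1 by apply: enorm_eq; rewrite ?expr1n.
have n_n : enorm (rsubmx z) = 1 by apply: enorm_eq; rewrite ?expr1n.
have : -1 <= edot (rsubmx z) u.
  by have := edot_abs (rsubmx z) u; rewrite un n_n mulr1 ler_norml => /andP[].
move=> n1; split => /=; first by rewrite ltrDl -mulrN mulr_gt0// oppr_gt0.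
by rewrite lerD2l -mulrN ler_piMr ?(ltW e0)//; lra.
Qed.

Lemma axial_continuous : continuous (ax : 'rV[R]_k.+1 -> R).
Proof.
apply: (@lipschitz_continuous_enorm _ _ _ 1) => y z.
rewrite -edotBl (_ : y - x0 - _ = y - z); last by apply/rowP => i; rewrite !mxE; ring.
by rewrite mulrC; apply: (le_trans (edot_abs _ _)); rewrite [enorm u](@enorm_eq _ _ _ 1) ?expr1n.
Qed.

Lemma slab_borel a : <<s [set U : set 'rV[R]_k.+1 | open U] >> (slab a).
Proof.
have [s0 sC sU] := smallest_sigma_algebra setT [set U : set 'rV[R]_k.+1 | open U].
have oG c : open [set y : 'rV[R]_k.+1 | c < ax y].
  by apply: (@open_comp _ _ (ax : 'rV[R]_k.+1 -> R) [set t | c < t]) => [y _|]; [exact: axial_continuous|exact: open_gt].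
have sO U : open U -> <<s [set U : set 'rV[R]_k.+1 | open U] >> U by move=> ?; exact: sub_sigma_algebra.
have -> : slab a = setT `\` (\bigcup_n (if n is 0%N then setT `\` [set y | a < ax y] else [set y | a + e < ax y])).
  apply/seteqP; split => y; rewrite /slab /=.
    move=> [y1 y2]; split => // -[[|n] _] /=; first by case.
    by rewrite ltNge y2.
  move=> [_ h]; split; first by apply: contrapT => y1; apply: h; exists 0%N.
  by rewrite leNgt; apply/negP => y1; apply: h; exists 1%N.
apply: (sC); apply: sU => -[|n]; last exact: sO.
by apply: (sC); exact: sO.
Qed.

Lemma cap_measurable a s : right_free K e a s ->
  (@hausdorff R (k.+1 + k.+1) k).-caratheodory (cap a).
Proof.
move=> fa; rewrite (capE fa).
have -> : [set z : 'rV[R]_(k.+1 + k.+1) | [/\ lsubmx z + e *: rsubmx z = pt a, edot (rsubmx z) (rsubmx z) = 1 & edot (rsubmx z) u < 0]] =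
    [set z | enorm (lsubmx z + e *: rsubmx z - pt a) = 0] `&` [set z | enorm (rsubmx z) = 1] `&` ~` [set z | 0 <= edot (rsubmx z) u].
  apply/seteqP; split => z /=.
    move=> [-> nn nu]; split; [split|]; first by rewrite subrr enorm0.
      by apply: enorm_eq; rewrite ?expr1n.
    by rewrite leNgt nu.
  move=> [[h1 h2] h3]; split; last by rewrite ltNge; apply/negP.
    by apply/eqP; rewrite -subr_eq0; apply/eqP/enorm_eq0.
  by rewrite -enorm_sqr h2 expr1n.
case: (he) => e0 _.
have cl (f : 'rV[R]_(k.+1 + k.+1) -> R) c A : (forall x y, `|f x - f y| <= c * enorm (x - y)) -> closed A -> closed (f @^-1` A).
  move=> fc cA; apply: (@closed_comp _ _ f A) => // z _; exact: lipschitz_continuous_enorm fc _.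
have lsubB (x y : 'rV[R]_(k.+1 + k.+1)) : lsubmx (x - y) = lsubmx x - lsubmx y by rewrite [LHS]raddfB.
have rsubB (x y : 'rV[R]_(k.+1 + k.+1)) : rsubmx (x - y) = rsubmx x - rsubmx y by rewrite [LHS]raddfB.
have enB (v w : 'rV[R]_k.+1) c : enorm (v - w) <= c -> `|enorm v - enorm w| <= c.
  move=> h; rewrite ler_distl lerBlDr.
  have := enorm_triangleB v w; have := enorm_triangleB w v; rewrite (enormB w v) => h1 h2.
  by apply/andP; split; lra.
apply: caratheodory_measurable_setI; first apply: caratheodory_measurable_setI.
- apply: closed_caratheodory.
  apply: (@cl (fun z => enorm (lsubmx z + e *: rsubmx z - pt a)) (1 + e) [set 0]); last exact: closed_eq.
  move=> x y; apply: enB.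
  have -> : lsubmx x + e *: rsubmx x - pt a - (lsubmx y + e *: rsubmx y - pt a) = lsubmx (x - y) + e *: rsubmx (x - y).
    by rewrite lsubB rsubB; apply/rowP => i; rewrite !mxE; ring.
  apply: (le_trans (enormD _ _)); rewrite enormZ gtr0_norm// mulrDl mul1r.
  by apply: lerD; [exact: enorm_lsubmx|rewrite ler_wpM2l ?(ltW e0)// enorm_rsubmx].
- apply: closed_caratheodory.
  apply: (@cl (fun z => enorm (rsubmx z)) 1 [set 1]); last exact: closed_eq.
  by move=> x y; apply: enB; rewrite -rsubB mul1r enorm_rsubmx.
- apply: caratheodory_measurable_setC; apply: closed_caratheodory.
  apply: (@cl (fun z => edot (rsubmx z) u) 1 [set t | 0 <= t]); last exact: closed_ge.
  move=> x y; rewrite -edotBl -rsubB mul1r.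
  apply: (le_trans (edot_abs _ _)); rewrite [enorm u](@enorm_eq _ _ _ 1) ?expr1n// mulr1.
  exact: enorm_rsubmx.
Qed.

(** The integrand vanishes off the cap, so the integral over [nor X], whose measurability is not
    established, becomes that of a constant over a measurable set. *)
Lemma integral_cap a s : right_free K e a s ->
  (\int[@hausdorff_measure R (k.+1 + k.+1) k]_(z in nor X)
     (\1_(slab a) (lsubmx z) * curvature_density X z)%:E =
   (theta ^+ k)%:E * hausdorff k (cap a))%E.
Proof.
move=> fa; have mcap : measurable (cap a : set (caratheodory_type (@hausdorff R (k.+1 + k.+1) k))).
  exact: cap_measurable fa.
rewrite -[hausdorff k (cap a)]/(@hausdorff_measure R (k.+1 + k.+1) k (cap a)).
rewrite -integral_cst//.
rewrite [LHS]integral_mkcond [RHS]integral_mkcond; congr integral.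
apply/funext => z; rewrite /patch.
have [zn|zn] := pselect (nor X z); last first.
  by rewrite !memNset// => -[].
rewrite (mem_set zn); have [hz|hz] := pselect (cap a z).
  rewrite (mem_set hz); have := hz; rewrite (capE fa) => -[zE nn nu].
  have -> : \1_(slab a) (lsubmx z) = 1 :> R by rewrite indicE mem_set//; case: hz.
  rewrite mul1r /cst; have -> : z = sphere_point x0 u e a (rsubmx z).
    by rewrite /sphere_point -zE addrK hsubmxK.
  by rewrite (curvature_density_sphere fa)// /sphere_point row_mxKr.
rewrite (memNset hz); have -> : \1_(slab a) (lsubmx z) = 0 :> R; last by rewrite mul0r.
by rewrite indicE memNset// => sz; apply: hz; split.
Qed.

End CurvatureLower.

Section LowerBound.
Context {R : realType}.

(** The bound on y gives sum y_i ^ 2 <= 1 / 4, which leaves room for a nonzero coordinate along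
    [b ord0], taken negative. *)
Lemma sphere_over_cube k (b : 'I_k.+1 -> 'rV[R]_k.+1) (y : 'I_k -> R) :
  (forall i j, edot (b i) (b j) = (i == j)%:R) ->
  (forall x, x = \sum_i edot x (b i) *: b i) ->
  (forall i, `|y i| <= 1 / (2 * k.+1%:R)) ->
  exists n, [/\ edot n n = 1, edot n (b ord0) < 0 & forall i, edot n (b (lift ord0 i)) = y i].
Proof.
move=> bb bE yr; pose r : R := 1 / (2 * k.+1%:R).
have k1 : 1 <= k.+1%:R :> R by rewrite ler1n.
have kr : k%:R * r ^+ 2 <= 1 / 4.
  apply: (@le_trans _ _ (k.+1%:R * r ^+ 2)).
    by rewrite ler_wpM2r ?sqr_ge0// ler_nat.
  have -> : k.+1%:R * r ^+ 2 = 1 / (4 * k.+1%:R) by rewrite /r; field; rewrite gt_eqF.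
  by rewrite ler_pdivrMr ?mulr_gt0//; lra.
have Sy : \sum_i y i ^+ 2 <= 1 / 4.
  apply: le_trans kr; apply: (@le_trans _ _ (\sum_(i < k) r ^+ 2)).
    apply: ler_sum => i _; rewrite -[leLHS]real_normK ?num_real// ler_sqr ?nnegrE//.
    by rewrite /r divr_ge0// mulr_ge0.
  by rewrite sumr_const card_ord mulr_natl.
pose t := Num.sqrt (1 - \sum_i y i ^+ 2).
have t0 : 0 < t by rewrite sqrtr_gt0; lra.
pose c i := if unlift ord0 i is Some j then y j else - t.
exists (\sum_i c i *: b i); split.
- rewrite (frame_edot _ bb bE) big_ord_recl edot_frame_coord// {1}/c unlift_none sqrrN.
  rewrite sqr_sqrtr; last lra.
  have -> : \sum_(i < k) edot (\sum_j c j *: b j) (b (lift ord0 i)) ^+ 2 = \sum_i y i ^+ 2.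
    by apply: eq_bigr => i _; rewrite edot_frame_coord// /c liftK.
  by rewrite subrK.
- by rewrite edot_frame_coord// /c unlift_none oppr_lt0.
- by move=> i; rewrite edot_frame_coord// /c liftK.
Qed.

(** The components of n orthogonal to u are 1-Lipschitz on pairs and already map the cap onto a cube
    of fixed size, so the bound does not depend on e. *)
Lemma cap_lower k : exists2 c : R, 0 < c &
  forall (x0 u : 'rV[R]_k.+1) (K : set R) e a s, edot u u = 1 -> compact K -> K !=set0 ->
  noncritical K e -> right_free K e a s -> (c%:E <= hausdorff k (cap x0 u K e a))%E.
Proof.
have [C C0 hC] := @hausdorff_cube_lower R k.
pose r : R := 1 / (2 * k.+1%:R); have r0 : 0 < r by rewrite divr_gt0// mulr_gt0.
exists (C * r ^+ k); first by rewrite mulr_gt0// exprn_gt0.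
move=> x0 u K e a s u1 cK K0 he fa.
have [b [b0 bb bE]] := orthonormal_frame u1.
apply: (hC _ _ (fun i (z : 'rV[R]_(k.+1 + k.+1)) => edot (rsubmx z) (b (lift ord0 i)))) => //.
  move=> i z z'; rewrite -edotBl -[rsubmx z - _]raddfB.
  apply: (le_trans (edot_abs _ _)); rewrite [enorm (b _)](@enorm_eq _ _ _ 1) ?bb ?eqxx ?expr1n// mulr1.
  exact: enorm_rsubmx.
move=> y yr; have [n [nn nb ny]] := sphere_over_cube bb bE yr.
exists (sphere_point x0 u e a n); last by move=> i; rewrite row_mxKr.
by rewrite (capE x0 u1 cK K0 he fa) /= row_mxKl row_mxKr subrK -b0; split.
Qed.

(** Ensures that the normalizing factor of [C0] is a positive number: [fine] would turn an infinite
    measure into 0. *)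
Lemma hausdorff_esphere_fin_gt0 k :
  (0 < hausdorff k (esphere : set 'rV[R]_k.+1) < +oo)%E.
Proof.
have d1 : edot (delta_mx 0 ord0 : 'rV[R]_k.+1) (delta_mx 0 ord0) = 1.
  rewrite /edot (bigD1 ord0)//= !mxE !eqxx mulr1 big1 ?addr0// => j ji.
  by rewrite !mxE (negPf ji) andbF mulr0.
apply/andP; split.
  have [C C0 hC] := @hausdorff_cube_lower R k.
  pose r : R := 1 / (2 * k.+1%:R); have r0 : 0 < r by rewrite divr_gt0// mulr_gt0.
  have [b [b0 bb bE]] := orthonormal_frame d1.
  apply: (@lt_le_trans _ _ (C * r ^+ k)%:E); first by rewrite lte_fin mulr_gt0// exprn_gt0.
  apply: (hC _ _ (fun i z => edot z (b (lift ord0 i)))) => //.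
    move=> i z z'; rewrite -edotBl.
    by apply: (le_trans (edot_abs _ _)); rewrite [enorm (b _)](@enorm_eq _ _ _ 1) ?bb ?eqxx ?expr1n// mulr1.
  move=> y yr; have [n [nn nb ny]] := sphere_over_cube bb bE yr.
  by exists n => //; apply/esphereE.
have [C [D [C0 D0 hC]]] := @premeasure_band R k.
apply: (@le_lt_trans _ _ C%:E); last by rewrite ltry.
apply: (@hausdorff_le_premeasure _ _ _ _ _ 1) => // e /andP[e0 e1].
pose h := Num.min 1 (e / D).
have h0 : 0 < h by rewrite lt_min ltr01 divr_gt0.
have := hC _ (delta_mx 0 ord0) (esphere : set 'rV[R]_k.+1) id 1 h 1 e d1 ler01.
rewrite expr1n !mulr1; apply => //.
- by rewrite h0 ge_min lexx.
- by rewrite mul1r mulrC -ler_pdivlMr// ge_min lexx orbT.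
- move=> z zS; split; first by apply/esphereE.
  apply: (le_trans (edot_abs _ _)).
  by rewrite zS [enorm _](@enorm_eq _ _ _ 1) ?expr1n// mulr1.
- by move=> z z' _ _; rewrite mul1r lerDl ltW.
Qed.

Local Open Scope ereal_scope.

(** A finite disjoint family becomes a partition once the rest of the space is added at index n and
    empty sets after it. *)
Lemma total_variation_ge (T : topologicalType) (nu : set T -> \bar R) (B : nat -> set T) n :
  (forall i, (i < n)%N -> <<s [set U : set T | open U] >> (B i)) ->
  (forall i j, (i < n)%N -> (j < n)%N -> i != j -> B i `&` B j = set0) ->
  \sum_(i < n) `|nu (B i)| <= total_variation nu.
Proof.
move=> mB tB; have [s0 sC sU] := smallest_sigma_algebra setT [set U : set T | open U].
pose rest := setT `\` \bigcup_i (if (i < n)%N then B i else set0).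
pose A i := if (i < n)%N then B i else if i == n then rest else set0.
have mA : borel_partition A.
  split.
  - move=> i; rewrite /A; case: ifPn => [/mB//|_]; case: eqP => [_|_]; last exact: s0.
    by apply: (sC); apply: sU => j; case: ifPn => [/mB//|_]; exact: s0.
  - apply/trivIsetP => i j _ _ ij; rewrite /A.
    have disj l : (l < n)%N -> B l `&` rest = set0.
      move=> ln; apply/seteqP; split => // x [Bx [_ []]]; exists l => //.
      by rewrite ln.
    case: (ltnP i n) => li; last have [ein|_] := eqVneq i n; last by rewrite set0I.
      case: (ltnP j n) => lj; first exact: tB.
      by have [_|_] := eqVneq j n; [exact: disj|rewrite setI0].
    case: (ltnP j n) => lj; first by rewrite setIC; exact: disj.
    by have [ejn|_] := eqVneq j n; [rewrite ein ejn eqxx in ij|rewrite setI0].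
  - apply/seteqP; split => // x _.
    have [[i _ xi]|xn] := pselect ((\bigcup_i (if (i < n)%N then B i else set0)) x).
      by exists i => //; rewrite /A; move: xi; case: ifP.
    by exists n => //; rewrite /A ltnn eqxx; split.
apply: (@le_trans _ _ (\sum_(i <oo) `|nu (A i)|)); last first.
  by apply: ereal_sup_ubound; exists A.
apply: le_trans (nneseries_ge_partial n (fun i => abse_ge0 (nu (A i)))).
by apply: lee_sum => i _; rewrite /A ltn_ord.
Qed.

Lemma C0_parallel_slab k (x0 u : 'rV[R]_k.+1) (K : set R) (F : set 'rV[R]_k.+1) (e a s : R) :
  edot u u = 1%R -> compact K -> K !=set0 -> noncritical K e ->
  parallel_set F e = [set y | line_dist x0 u K y <= e]%R -> right_free K e a s ->
  `|C0_parallel F e (slab x0 u e a)| =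
  ((fine (hausdorff k (esphere : set 'rV[R]_k.+1)))^-1 * `|theta e| ^+ k)%:E * hausdorff k (cap x0 u K e a).
Proof.
move=> u1 cK K0 he hF fa.
rewrite /C0_parallel /C0 /parallel_complement hF (closure_outside x0 u1 cK K0 he) /=.
have := integral_cap x0 u1 cK K0 he fa; rewrite /= => ->.
have H0 := @hausdorff_ge0 R _ k (cap x0 u K e a).
have S0 : (0 <= (fine (hausdorff k (esphere : set 'rV[R]_k.+1)))^-1)%R.
  by rewrite invr_ge0 fine_ge0// hausdorff_ge0.
rewrite !muleA -!EFinM abseM (gee0_abs H0); congr (_ * _).
by rewrite abse_EFin normrM normrM normrX normrN1 expr1n mul1r (ger0_norm S0) normrX.
Qed.

Lemma C0_var_lower k : exists2 c : R, (0 < c)%R &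
  forall (x0 u : 'rV[R]_k.+1) (K : set R) (F : set 'rV[R]_k.+1) (e : R),
  edot u u = 1%R -> compact K -> K !=set0 -> noncritical K e -> (e <= 1)%R ->
  parallel_set F e = [set y | line_dist x0 u K y <= e]%R ->
  (c * (1 + (gap_count K (2 * e)%R)%:R))%:E <= C0_var F e.
Proof.
have [c c0 hc] := cap_lower k.
have /andP[S0 Soo] := hausdorff_esphere_fin_gt0 k.
pose cS : R := (fine (hausdorff k (esphere : set 'rV[R]_k.+1)))^-1%R.
have cS0 : (0 < cS)%R by rewrite invr_gt0 fine_gt0// S0.
exists (cS * (1 / 2) ^+ k * c)%R; first by rewrite !mulr_gt0// exprn_gt0// divr_gt0.
move=> x0 u K F e u1 cK K0 he e1 hF; have [e0 hcrit] := he.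
have [mx Kmx hmx] := compact_has_max cK K0.
have [mn Kmn hmn] := compact_has_min cK K0.
have Kpq : K `<=` `[mn, mx] by move=> x Kx; rewrite /= in_itv /= hmn// hmx.
have e20 : (0 < 2 * e)%R by rewrite mulr_gt0.
(* The left ends of the long gaps, and the right end of K, which supplies the 1 in the bound. *)
pose l := mx :: [seq g.1 | g <- gaps K (2 * e)%R].
have ul : uniq l.
  rewrite /= map_inj_in_uniq ?(gaps_uniq Kpq e20) ?andbT.
    apply/mapP => -[g /(mem_gaps Kpq _ e20)[[_ Kb ab _] _] mxE].
    by have := hmx _ Kb; rewrite mxE leNgt ab.
  move=> [a b] [a' b'] /(mem_gaps Kpq _ e20)[g1 _] /(mem_gaps Kpq _ e20)[g2 _] /= aa'.
  apply/eqP/negPn/negP; rewrite eq_sym => ne; have := gap_disjoint g1 g2 ne.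
  case: g1 g2 => [_ _ ab _] [_ _ ab' _]; rewrite /= in ab ab' *; case; lra.
have free a : a \in l -> exists s, right_free K e a s.
  rewrite inE => /orP[/eqP ->|/mapP[[a' b] /(mem_gaps Kpq _ e20)[[Ka Kb ab gab] lab] /= ->]].
    exists 1%R; split => // x Kx; rewrite ltNge => /negP []; exact: hmx.
  rewrite /= in lab ab; exists ((b - a' - 2 * e) / 2)%R; split => //; first by rewrite divr_gt0; lra.
  move=> x Kx ax; have bx : (b <= x)%R.
    by rewrite leNgt; apply/negP => xb; apply: (gab x) => //; rewrite ax.
  lra.
have tv := @total_variation_ge _ (C0_parallel F e) (fun i => slab x0 u e (nth 0%R l i)) (size l).
apply: le_trans (tv _ _); last first.
- move=> i j il jl ij; apply/seteqP; split => // y [[y1 y2] [y3 y4]]; rewrite /= in y1 y2 y3 y4.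
  have [s [_ s0 fi]] := free _ (mem_nth 0%R il); have [s' [_ s'0 fj]] := free _ (mem_nth 0%R jl).
  have Ki : K (nth 0%R l i) by have [? []] := free _ (mem_nth 0%R il).
  have Kj : K (nth 0%R l j) by have [? []] := free _ (mem_nth 0%R jl).
  have ne : nth 0%R l i != nth 0%R l j by rewrite nth_uniq.
  case: (ltgtP (nth 0%R l i) (nth 0%R l j)) ne => // h _.
    by have := fi _ Kj h; lra.
  by have := fj _ Ki h; lra.
- by move=> i _; exact: slab_borel.
apply: (@le_trans _ _ (\sum_(i < size l) (cS * (1 / 2) ^+ k * c)%:E)).
  rewrite sumEFin lee_fin sumr_const card_ord -[leRHS]mulr_natr /l /= size_map.
  by rewrite /gap_count addrC natr1.
apply: lee_sum => i _.
have [s fa] := free _ (mem_nth 0%R (ltn_ord i)).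
rewrite (C0_parallel_slab u1 cK K0 he hF fa).
apply: (@le_trans _ _ ((cS * `|theta e| ^+ k)%:E * c%:E)).
  rewrite -EFinM lee_fin ler_wpM2r ?(ltW c0)// ler_wpM2l ?(ltW cS0)// lerXn2r ?nnegrE ?divr_ge0//.
  exact: theta_ge he e1.
apply: lee_wpmul2l; first by rewrite lee_fin mulr_ge0 ?exprn_ge0 ?(ltW cS0).
exact: (hc _ _ _ _ _ s).
Qed.

End LowerBound.

(** * Upper bound for the total curvature *)

Section Covering.
Context {R : realType} {k : nat}.
Variables (x0 u : 'rV[R]_k.+1) (K : set R).
Hypotheses (u1 : edot u u = 1) (cK : compact K) (K0 : K !=set0).
Variable e : R.
Hypotheses (he : noncritical K e) (e1 : e <= 1).
Local Notation ld := (line_dist x0 u K).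
Local Notation ax := (axial x0 u).
Local Notation tr := (transverse x0 u).
Local Notation pt := (axis_point x0 u).
Local Notation X := [set y : 'rV[R]_k.+1 | e <= ld y].
Local Notation space := 'rV[R]_(k.+1 + k.+1).

(** Radius h = 0 describes an exact piece of sphere; h > 0 allows for a centre that has been rounded
    to the grid. *)
Definition sphere_piece (kap w h : R) : set space :=
  [set z | [/\ edot (rsubmx z) (rsubmx z) = 1, `|edot (rsubmx z) u| <= w &
     enorm (lsubmx z - (pt kap - e *: rsubmx z)) <= h]].

Definition edge_piece (a b : R) : set space :=
  [set z | edot (rsubmx z) (rsubmx z) = 1 /\ edge_normal x0 u e a b (lsubmx z) (rsubmx z)].

Lemma enorm_pair (z z' : space) :
  enorm (z - z') <= enorm (lsubmx z - lsubmx z') + enorm (rsubmx z - rsubmx z').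
Proof.
apply: le_trans (enorm_row_mx _ _).
by rewrite -[z in leLHS]hsubmxK -[z' in leLHS]hsubmxK opp_row_mx add_row_mx.
Qed.

Lemma sphere_piece_lip kap w h z z' : 0 <= h ->
  sphere_piece kap w h z -> sphere_piece kap w h z' ->
  enorm (z - z') <= 2 * (enorm (rsubmx z - rsubmx z') + h).
Proof.
have [e0 _] := he => h0 [_ _ zh] [_ _ zh'].
apply: (le_trans (enorm_pair z z')).
have h1 : enorm (lsubmx z - lsubmx z') <= h + (e * enorm (rsubmx z - rsubmx z') + h).
  apply: (le_trans (enorm_triangle _ (pt kap - e *: rsubmx z) _)); apply: lerD => //.
  apply: (le_trans (enorm_triangle _ (pt kap - e *: rsubmx z') _)); apply: lerD.
    rewrite -[e in leRHS](gtr0_norm e0) -enormZ enormB.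
    by rewrite le_eqVlt; apply/orP; left; apply/eqP; congr enorm; apply/rowP => i; rewrite !mxE; ring.
  by rewrite enormB.
have := enorm_ge0 (rsubmx z - rsubmx z').
move: (enorm (rsubmx z - rsubmx z')) (enorm (lsubmx z - lsubmx z')) h1 => q p h1 q0.
have : e * q <= q by rewrite ler_piMl.
lra.
Qed.

(* |t q - t' q'| ^ 2 = (t - t') ^ 2 |q| ^ 2 + t t' |q - q'| ^ 2 when |q| = |q'|. *)
Lemma scaled_same_norm (q q' : 'rV[R]_k.+1) (t t' : R) : edot q q = edot q' q' ->
  e^-1 <= t -> e^-1 <= t' -> enorm (q - q') <= e * enorm (t *: q - t' *: q').
Proof.
have [e0 _] := he => qq te te'.
have i0 : 0 < e^-1 by rewrite invr_gt0.
rewrite -(ler_pM2l i0) mulKf ?gt_eqF// enorm_ge; last by rewrite mulr_ge0 ?enorm_ge0 ?(ltW i0).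
rewrite exprMn enorm_sqr.
have -> : edot (t *: q - t' *: q') (t *: q - t' *: q') =
    (t - t') ^+ 2 * edot q q + t * t' * edot (q - q') (q - q').
  by rewrite !edotE (edotC q' q) -qq; ring.
apply: (@le_trans _ _ (t * t' * edot (q - q') (q - q'))); last first.
  by rewrite lerDr mulr_ge0 ?sqr_ge0 ?edot_ge0.
by rewrite ler_wpM2r ?edot_ge0// expr2 ler_pM// ltW.
Qed.

(** On an edge the axial coordinate and |q| are fixed and t q is the transverse part of - n, so the
    normal determines the point, in a Lipschitz way by [scaled_same_norm]. *)
Lemma edge_piece_lip a b z z' : edge_piece a b z -> edge_piece a b z' ->
  enorm (z - z') <= 2 * enorm (rsubmx z - rsubmx z').
Proof.
have [e0 _] := he => -[_ [ax1 q1 _ [t te nE]]] [_ [ax2 q2 _ [t' te' nE']]].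
apply: (le_trans (enorm_pair z z')).
have h1 : enorm (lsubmx z - lsubmx z') <= e * enorm (rsubmx z - rsubmx z').
  have -> : lsubmx z - lsubmx z' = tr (lsubmx z) - tr (lsubmx z').
    by rewrite /transverse ax1 ax2; apply/rowP => i; rewrite !mxE; ring.
  apply: (le_trans (scaled_same_norm _ te te')).
    by apply/eqP; rewrite -(inj_eq (addrI (((b - a) / 2) ^+ 2))) q1 q2.
  rewrite ler_wpM2l ?(ltW e0)// enorm_le ?enorm_ge0// enorm_sqr.
  have key (n n' q q' : 'rV[R]_k.+1) p p' : n = p *: u - t *: q -> n' = p' *: u - t' *: q' ->
      edot q u = 0 -> edot q' u = 0 ->
      edot (t *: q - t' *: q') (t *: q - t' *: q') <= edot (n - n') (n - n'); last first.
    by apply: key nE nE' _ _; exact: edot_transverse.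
  move=> -> -> qu qu'; rewrite -subr_ge0.
  have -> : edot (p *: u - t *: q - (p' *: u - t' *: q')) (p *: u - t *: q - (p' *: u - t' *: q')) -
    edot (t *: q - t' *: q') (t *: q - t' *: q') = (p - p') ^+ 2.
    by rewrite !edotE (edotC u q) (edotC u q') (edotC q' q) qu qu' u1; ring.
  exact: sqr_ge0.
have := enorm_ge0 (rsubmx z - rsubmx z').
move: (enorm (rsubmx z - rsubmx z')) (enorm (lsubmx z - lsubmx z')) h1 => q p h1 q0.
have : e * q <= q by rewrite ler_piMl.
lra.
Qed.

(** The displacement from [pt c - e *: n] has four parts: a - c, at most h; half the gap and e (n,
    u), at most e h each; and (1 - e t) q, at most half the gap because t |q| <= 1 and |q| >= e - (b
    - a) / 2. *)
Lemma narrow_edge a b c h z : edge_piece a b z -> 0 <= b - a -> b - a <= 2 * e * h ->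
  `|a - c| <= h -> 0 <= h -> sphere_piece c h (4 * h) z.
Proof.
have [e0 _] := he => -[nn [ax1 q1 n1 [t te nE]]] ab0 abh ac h0.
have D0 : 0 <= (b - a) / 2 by rewrite divr_ge0.
have eh : e * h <= h by rewrite ler_piMl.
have abe : (b - a) / (2 * e) <= h by rewrite ler_pdivrMr ?mulr_gt0//; lra.
split => //; first exact: le_trans abe.
have qu := edot_transverse x0 u1 (lsubmx z).
have zE : lsubmx z = x0 + ((a + b) / 2) *: u + tr (lsubmx z).
  by rewrite /transverse ax1; apply/rowP => i; rewrite !mxE; ring.
have [q qE] : exists q, q = tr (lsubmx z) by eexists.
rewrite -qE in nE qu q1 zE.
have [p pE] : exists p, p = edot (rsubmx z) u by eexists.
rewrite -pE in nE n1.
have -> : lsubmx z - (pt c - e *: rsubmx z) =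
    (a - c) *: u + ((b - a) / 2) *: u + (e * p) *: u + (1 - e * t) *: q.
  by rewrite {1}zE nE /axis_point; apply/rowP => i; rewrite !mxE; field.
have un : enorm u = 1 by apply: enorm_eq; rewrite ?expr1n.
have te1 : 1 <= e * t by rewrite -ler_pdivrMl// mulr1.
have tq : t * enorm q <= 1.
  have t0 : 0 <= t by apply: le_trans te; rewrite invr_ge0 ltW.
  rewrite -ler_sqr ?nnegrE ?mulr_ge0 ?enorm_ge0// expr1n exprMn enorm_sqr -nn nE.
  rewrite !edotE (edotC u q) qu u1; have := sqr_ge0 p; lra.
have qe : e - (b - a) / 2 <= enorm q.
  have [l|l] := leP (e - (b - a) / 2) 0; first exact: le_trans l (enorm_ge0 _).
  rewrite -ler_sqr ?nnegrE ?enorm_ge0 ?(ltW l)// enorm_sqr.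
  have -> : edot q q = e ^+ 2 - ((b - a) / 2) ^+ 2 by rewrite -q1; ring.
  move: ((b - a) / 2) D0 l => D D0 l.
  rewrite -subr_ge0 (_ : _ - _ = 2 * D * (e - D)); last ring.
  by rewrite !mulr_ge0// ltW.
apply: (le_trans (enormD _ _)); apply: (@le_trans _ _ (h + e * h + e * h + (b - a) / 2)); last lra.
apply: lerD.
  apply: (le_trans (enormD _ _)); apply: lerD; first apply: (le_trans (enormD _ _)); first apply: lerD.
  - by rewrite enormZ un mulr1.
  - by rewrite enormZ un mulr1 ger0_norm//; lra.
  - rewrite enormZ un mulr1 normrM (gtr0_norm e0) ler_wpM2l ?(ltW e0)//; exact: le_trans abe.
rewrite enormZ ler0_norm; last lra.
have : e * (t * enorm q) <= e by rewrite ler_piMr ?(ltW e0).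
lra.
Qed.

(** Expand |x - pt c| >= e for x = pt kap - e n. For p = (n, u) nonzero it says that K has no point
    strictly within 2 e |p| of kap on one side, so an inclined normal reveals a gap or an extreme
    point. *)
Lemma sphere_gap kap (n : 'rV[R]_k.+1) : K kap -> edot n n = 1 -> ld (pt kap - e *: n) = e ->
  forall c, K c -> (kap - c) ^+ 2 >= 2 * e * edot n u * (kap - c).
Proof.
have [e0 _] := he => Kk nn le c Kc.
have := line_dist_le x0 u1 cK K0 (pt kap - e *: n) Kc.
rewrite le enorm_ge ?(ltW e0)//.
have -> : pt kap - e *: n - pt c = (kap - c) *: u - e *: n.
  by rewrite /axis_point; apply/rowP => i; rewrite !mxE; ring.
rewrite !edotE (edotC u n) u1 nn; lra.
Qed.

Definition gap_width (g : R * R) := Num.min 1 ((g.2 - g.1) / (2 * e)).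

(* The points of the normal bundle not covered by the end points and the long gaps
   have normals almost orthogonal to the line, and lie near spheres centred on a
   grid of mesh h. *)
Lemma nor_cover mn mx h z : K mn -> K mx -> (forall x, K x -> mn <= x <= mx) ->
  0 < h -> nor X z ->
  [\/ sphere_piece mn 1 0 z \/ sphere_piece mx 1 0 z,
      (exists2 g, g \in gaps K (2 * e * h) &
        [\/ sphere_piece g.1 (gap_width g) 0 z, sphere_piece g.2 (gap_width g) 0 z |
            edge_piece g.1 g.2 z /\ (g.2 - g.1) / (2 * e) = gap_width g]) |
      exists2 i : nat, (i <= Num.truncn ((mx - mn) / h))%N &
        sphere_piece (mn + i%:R * h) (4 * h) (4 * h) z].
Proof.
have [e0 _] := he => Kmn Kmx Kb h0 [bz /esphereE nn cz].
have Kpq : K `<=` `[mn, mx] by move=> x /Kb; rewrite /= in_itv.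
have eh0 : 0 < 2 * e * h by rewrite !mulr_gt0.
have ldz : ld (lsubmx z) = e by exact: line_dist_boundary_outside bz.
have grid c : K c -> exists2 i : nat, (i <= Num.truncn ((mx - mn) / h))%N & `|c - (mn + i%:R * h)| <= h.
  move=> /Kb/andP[mc cm]; exists (Num.truncn ((c - mn) / h)).
    by apply: le_truncn; rewrite ler_pM2r ?invr_gt0// lerD2r.
  have := @truncn_itv _ ((c - mn) / h); rewrite divr_ge0 ?subr_ge0 ?(ltW h0)// => /(_ isT).
  rewrite ler_pdivlMr// ltr_pdivrMr// -natr1 => /andP[g1 g2].
  by rewrite ler_norml; apply/andP; split; lra.
have n1 : `|edot (rsubmx z) u| <= 1.
  by apply: (le_trans (edot_abs _ _)); rewrite !(@enorm_eq _ _ _ 1) ?expr1n ?mulr1.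
case: (nor_cases u1 cK K0 he ldz nn cz) => [[c [Kc _ zE]]|[a [b [gab ab en]]]]; last first.
  have [Ka Kb' ab' _] := gab.
  have [l|l] := ltP (2 * e * h) (b - a).
    apply: Or32; exists (a, b); first by apply/(mem_gaps Kpq _ eh0).
    apply: Or33; split => //=; rewrite /gap_width /= min_r// ler_pdivrMr ?mulr_gt0// mul1r ltW//.
  have [i iM ic] := grid a Ka; apply: Or33; exists i => //.
  have [z1 z2 z3] : sphere_piece (mn + i%:R * h) h (4 * h) z.
    by apply: (@narrow_edge a b) => //; rewrite ?subr_ge0 ?(ltW ab') ?(ltW h0).
  split => //; apply: le_trans z2 _; lra.
have exact_ kap w : c = kap -> `|edot (rsubmx z) u| <= w -> sphere_piece kap w 0 z.
  by move=> <- hw; split => //; rewrite zE subrr enorm0.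
(* Normals almost orthogonal to the line go to the grid point within h of c. *)
have [l|l] := leP `|edot (rsubmx z) u| h.
  have [i iM ic] := grid c Kc; apply: Or33; exists i => //; split => //; first lra.
  rewrite zE; apply: le_trans (_ : `|c - (mn + i%:R * h)| <= _); last lra.
  rewrite (_ : _ - _ = (c - (mn + i%:R * h)) *: u); last first.
    by rewrite /axis_point; apply/rowP => j; rewrite !mxE; ring.
  by rewrite enormZ [enorm u](@enorm_eq _ _ _ 1) ?expr1n ?mulr1.
have [p pE] : exists p, p = edot (rsubmx z) u by eexists.
rewrite -pE in n1 l exact_.
have sg := @sphere_gap c (rsubmx z) Kc nn; rewrite -zE -pE in sg; have {}sg := sg ldz.
have d0 : 0 < 2 * e * `|p| by rewrite !mulr_gt0// (lt_trans h0).
have dh : 2 * e * h < 2 * e * `|p| by rewrite ltr_pM2l ?mulr_gt0.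
have width g : 2 * e * `|p| <= g.2 - g.1 -> `|p| <= gap_width g.
  by move=> gp; rewrite le_min n1 ler_pdivlMr ?mulr_gt0//; lra.
(* The free side of c is the right one if p < 0 and the left one otherwise. So c is an extreme point
   of K or the end of a gap of length at least 2 e |p| > 2eh, which is in the list. *)
have [p0|p0] := ltP p 0.
  have [cmx|cmx] := eqVneq c mx; first by apply: Or31; right; exact: exact_.
  have cm : c < mx by rewrite lt_neqAle cmx; have /andP[] := Kb _ Kc.
  have free t : c < t < c + 2 * e * `|p| -> ~ K t.
    move=> /andP[ct tc] /sg; apply/negP; rewrite -ltNge -subr_gt0.
    have -> : 2 * e * p * (c - t) - (c - t) ^+ 2 = (t - c) * (2 * e * - p - (t - c)) by ring.
    by rewrite mulr_gt0 ?subr_gt0// -(ltr0_norm p0) ltrBlDl.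
  have [b [gb db bm]] := right_gap cK Kc Kmx cm d0 free.
  apply: Or32; exists (c, b); first by apply/(mem_gaps Kpq _ eh0); split => //=; lra.
  by apply: Or31; apply: exact_ => //; apply: width => /=; lra.
have [cmn|cmn] := eqVneq c mn; first by apply: Or31; left; exact: exact_.
have cm : mn < c by rewrite lt_neqAle eq_sym cmn; have /andP[] := Kb _ Kc.
have free t : c - 2 * e * `|p| < t < c -> ~ K t.
  move=> /andP[ct tc] /sg; apply/negP; rewrite -ltNge -subr_gt0.
  have -> : 2 * e * p * (c - t) - (c - t) ^+ 2 = (c - t) * (2 * e * p - (c - t)) by ring.
  by rewrite mulr_gt0 ?subr_gt0// -[in ltRHS](ger0_norm p0) ltrBlDl -ltrBlDr.
have [a [ga da am]] := left_gap cK Kc Kmn cm d0 free.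
apply: Or32; exists (a, c); first by apply/(mem_gaps Kpq _ eh0); split => //=; lra.
by apply: Or32; apply: exact_ => //; apply: width => /=; lra.
Qed.

End Covering.

Section CurvatureUpper.
Context {R : realType}.
Local Open Scope ereal_scope.

(** Two pieces for the ends of K, three for each listed gap and about (mx - mn) / h grid bands of
    width 4h: number and width of the last compensate, so h can go to 0 with the scale. The 6 is 2
    for the ends of K plus 4 for rounding in the number of bands. *)
Lemma nor_hausdorff_le k : exists2 C : R, (0 < C)%R &
  forall (x0 u : 'rV[R]_k.+1) (K : set R) (e mn mx Bd : R),
  edot u u = 1%R -> compact K -> noncritical K e -> (e <= 1)%R ->
  K mn -> K mx -> (forall x, K x -> (mn <= x <= mx)%R) ->
  (forall h, (0 < h)%R -> (gap_energy K e h <= Bd)%R) ->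
  hausdorff k (nor [set y | (e <= line_dist x0 u K y)%R]) <=
  (C * (6 + 4 * (mx - mn) + 3 * Bd))%:E.
Proof.
have [C [D [C0 D0 band]]] := @premeasure_band R k.
exists (C * 2 ^+ k)%R; first by rewrite mulr_gt0// exprn_gt0.
move=> x0 u K e mn mx Bd u1 cK he e1 Kmn Kmx Kb hB; have [e0 _] := he.
have K0 : K !=set0 by exists mn.
apply: (@hausdorff_le_premeasure _ _ _ _ _ 1%R) => // d /andP[d0 d1].
pose c : R := (C * 2 ^+ k)%R; have c0 : (0 < c)%R by rewrite mulr_gt0// exprn_gt0.
(* 4h is the largest mesh and also the width of the grid bands: it must be at most 1, and its cells
   must have diameter at most d. *)
pose h : R := (Num.min (1 / 4) (d / (8 * D)))%R.
have h0 : (0 < h)%R by rewrite lt_min !divr_gt0// mulr_gt0.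
have h4 : (4 * h <= 1)%R.
  have : (h <= 1 / 4)%R by rewrite ge_min lexx.
  lra.
have hD : (D * (2 * (4 * h)) <= d)%R.
  have : (h <= d / (8 * D))%R by rewrite ge_min lexx orbT.
  rewrite ler_pdivlMr ?mulr_gt0//; lra.
have hD1 : (D * (2 * h) <= d)%R by apply: le_trans hD; rewrite ler_pM2l//; lra.
have eh0 : (0 < 2 * e * h)%R by rewrite !mulr_gt0.
have sph kap w r s : (0 <= r <= s)%R -> (0 < s <= w)%R -> (w <= 1)%R -> (D * (2 * s) <= d)%R ->
    hausdorff_premeasure k d (sphere_piece x0 u e kap w r) <= (c * w)%:E.
  move=> /andP[r0 rs] sw w1 sd; apply: (band _ u _ rsubmx _ s) => //.
    by move=> z [nn n1 _].
  move=> z z' zp zp'; apply: (le_trans (sphere_piece_lip he e1 r0 zp zp')).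
  by rewrite ler_pM2l// lerD2l.
have Kpq : K `<=` `[mn, mx] by move=> x /Kb; rewrite /= in_itv.
have wid g : g \in gaps K (2 * e * h)%R -> (h < gap_width e g)%R.
  move=> /(mem_gaps Kpq _ eh0)[_ lg]; rewrite lt_min; apply/andP; split; first lra.
  by rewrite ltr_pdivlMr ?mulr_gt0//; lra.
have wid1 g : (gap_width e g <= 1)%R by rewrite ge_min lexx.
pose M := Num.truncn ((mx - mn) / h).
pose P1 := [set z : 'rV[R]_(k.+1 + k.+1) | exists2 b, b \in [:: true; false] &
  sphere_piece x0 u e (if b then mn else mx) 1 0 z].
(* Gaps longer than 2e have no edge; discarding their edge pieces makes the band estimate with width
   [gap_width] valid for all listed gaps. *)
pose E2 g := if (g.2 - g.1 == 2 * e * gap_width e g)%R then edge_piece x0 u e g.1 g.2 else set0.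
pose S g := sphere_piece x0 u e g.1 (gap_width e g) 0 `|` (sphere_piece x0 u e g.2 (gap_width e g) 0 `|` E2 g).
pose P2 := [set z : 'rV[R]_(k.+1 + k.+1) | exists2 g, g \in gaps K (2 * e * h)%R & S g z].
pose P3 := [set z : 'rV[R]_(k.+1 + k.+1) | exists2 i, i \in iota 0 M.+1 &
  sphere_piece x0 u e (mn + i%:R * h) (4 * h) (4 * h) z].
have mn_mx : (mn <= mx)%R by have /andP[] := Kb _ Kmn.
have cov : nor [set y | (e <= line_dist x0 u K y)%R] `<=` P1 `|` (P2 `|` P3).
  move=> z /(nor_cover u1 cK K0 he e1 Kmn Kmx Kb h0)[[zs|zs]|[g gg zs]|[i iM zs]].
  - by left; exists true.
  - by left; exists false.
  - right; left; exists g => //; case: zs => [?|?|[zs wE]]; [by left|by right; left|right; right].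
    by rewrite /E2 -wE mulrC divfK ?eqxx// gt_eqF// mulr_gt0.
  - by right; right; exists i => //; rewrite mem_iota add0n.
apply: (le_trans (le_outer_measure (@hausdorff_premeasure R _ k d) _ _ cov)).
have le1 : hausdorff_premeasure k d P1 <= (c * 2)%:E.
  apply: (le_trans (outer_measure_seq _ _ _)); rewrite big_cons big_seq1.
  rewrite (_ : c * 2 = c * 1 + c * 1)%R; last by ring.
  by rewrite EFinD; apply: leeD; apply: (sph _ _ _ h) => //; rewrite ?lexx ?(ltW h0) ?h0//=; lra.
have le2 : hausdorff_premeasure k d P2 <= (c * (3 * Bd))%:E.
  apply: (le_trans (outer_measure_seq _ _ _)).
  apply: (@le_trans _ _ (\sum_(g <- gaps K (2 * e * h)%R) (c * (3 * gap_width e g))%:E)); last first.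
    rewrite sumEFin lee_fin -mulr_sumr ler_pM2l// -mulr_sumr ler_pM2l//; exact: hB.
  rewrite big_seq [leRHS]big_seq; apply: lee_sum => g gg.
  have hw := wid _ gg; have w1 := wid1 g.
  rewrite (_ : c * (3 * gap_width e g) = c * gap_width e g + (c * gap_width e g + c * gap_width e g))%R; last by ring.
  apply: (le_trans (outer_measureU2 _ _ _)); rewrite EFinD; apply: leeD.
    by apply: (sph _ _ _ h) => //; rewrite ?lexx ?(ltW h0) ?h0 ?(ltW hw).
  apply: (le_trans (outer_measureU2 _ _ _)); rewrite EFinD; apply: leeD.
    by apply: (sph _ _ _ h) => //; rewrite ?lexx ?(ltW h0) ?h0 ?(ltW hw).
  rewrite /E2; case: eqP => [wE|_]; last first.
    by rewrite outer_measure0 lee_fin mulr_ge0 ?(ltW c0)// ltW// (lt_trans h0).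
  apply: (band _ u _ rsubmx _ h) => //; first by rewrite h0 ltW.
    move=> z [nn [_ _ n1 _]]; split => //; apply: (le_trans n1).
    by rewrite wE mulrAC divff ?mul1r// gt_eqF// mulr_gt0.
  move=> z z' zp zp'; apply: (le_trans (edge_piece_lip u1 he e1 zp zp')).
  by rewrite ler_pM2l// lerDl ltW.
have le3 : hausdorff_premeasure k d P3 <= (c * (4 * (mx - mn) + 4))%:E.
  apply: (le_trans (outer_measure_seq _ _ _)).
  apply: (@le_trans _ _ (\sum_(i <- iota 0 M.+1) (c * (4 * h))%:E)).
    apply: lee_sum => i _; apply: (sph _ _ _ (4 * h)%R) => //; rewrite ?lexx ?andbT.
      by rewrite mulr_ge0// ltW.
    by rewrite mulr_gt0.
  rewrite sumEFin big_const_seq count_predT iter_addr_0 size_iota lee_fin -mulrnAr ler_pM2l//.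
  rewrite -[leLHS]mulr_natr -natr1.
  have : (M%:R * h <= mx - mn)%R.
    by rewrite -ler_pdivlMr// truncn_le// divr_ge0 ?subr_ge0// ltW.
  lra.
apply: (le_trans (outer_measureU2 _ _ _)).
rewrite (_ : _ * _ = c * 2 + (c * (3 * Bd) + c * (4 * (mx - mn) + 4)))%R; last by rewrite -/c; ring.
rewrite !EFinD; apply: leeD => //; apply: (le_trans (outer_measureU2 _ _ _)); exact: leeD.
Qed.

End CurvatureUpper.

(** * From the normal bundle to the total variation *)

Section TotalVariationUpper.
Context {R : realType}.

Lemma abs_curvature_density_le1 l (X : set 'rV[R]_l) z : `|curvature_density X z| <= 1.
Proof.
rewrite /curvature_density; case: xgetP => [y _ [kappa _ <-]|_]; last by rewrite normr0.
rewrite normr_prod {z}.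
apply: prodr_ile1 => i _; rewrite normr_ge0 /=; case: (kappa i) => [r||]; rewrite /= ?normr1//.
have s0 : 0 < Num.sqrt (1 + r ^+ 2) by rewrite sqrtr_gt0 ltr_pwDl ?sqr_ge0.
rewrite normrM normfV (gtr0_norm s0) ler_pdivrMr// mul1r -sqrtr_sqr ler_wsqrtr//.
by rewrite lerDr.
Qed.

Local Open Scope ereal_scope.
Import HBNNSimple.

(** f need not be measurable: a simple function below its positive or negative part is at most the
    indicator of its own support, which is a measurable subset of P. The two parts account for the
    factor 2. *)
Lemma abs_integral_le d (T : measurableType d) (mu : {measure set T -> \bar R})
    (D P : set T) (f : T -> \bar R) c :
  (forall x, D x -> `|f x| <= 1) -> (forall x, D x -> f x != 0 -> P x) ->
  (forall S, measurable S -> S `<=` P -> mu S <= c) ->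
  `|\int[mu]_(x in D) f x| <= c + c.
Proof.
move=> f1 fP hP.
have nn g : (forall x, D x -> 0 <= g x <= `|f x|) -> 0 <= \int[mu]_(x in D) g x <= c.
  move=> gf; have g0 x : D x -> 0 <= g x by move=> /gf/andP[].
  rewrite integral_ge0//= ge0_integralE//; apply: ge_ereal_sup => _ [h /= hg <-].
  have mS : measurable (h @^-1` [set~ 0%R]) by apply: measurable_funPTI; exact: measurableC.
  apply: le_trans (hP _ mS _).
    rewrite -sintegral_indic -[\1__]/(indic_nnsfun R mS : T -> R).
    apply: le_sintegral => x; change (h x <= \1_(h @^-1` [set~ 0%R]) x :> R)%R; rewrite indicE; case: (pselect (h x = 0%R)) => [->|hx].
      by rewrite ler0n.
    rewrite mem_set// -lee_fin (le_trans (hg x))// patchE; case: ifPn => [/set_mem Dx|_]; last by rewrite lee01.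
    by have /andP[_ /le_trans] := gf x Dx; apply; exact: f1.
  move=> x /= hx; have := hg x; rewrite patchE; case: ifPn => [/set_mem Dx hgx|_].
    apply: fP => //; apply/eqP => fx0; apply: hx; apply: le_anti.
    have := le_trans hgx (proj2 (andP (gf x Dx))); rewrite fx0 abse0 lee_fin => ->/=.
    exact: fun_ge0.
  by rewrite lee_fin => h0; case: hx; apply: le_anti; rewrite h0 fun_ge0.
have /andP[p0 pc] : 0 <= \int[mu]_(x in D) f^\+ x <= c.
  by apply: nn => x _; rewrite funeposE le_max lexx orbT /= ge_max lee_abs abse_ge0.
have /andP[n0 nc] : 0 <= \int[mu]_(x in D) f^\- x <= c.
  by apply: nn => x _; rewrite funenegE le_max lexx orbT /= ge_max abse_ge0 andbT -abseN lee_abs.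
rewrite integralE; apply: (le_trans (lee_abs_sub _ _)).
by rewrite !gee0_abs//; exact: leeD.
Qed.

(** The preimages of the Borel pieces are Caratheodory measurable, so the parts of [nor X] over them
    have total measure at most that of [nor X], whether or not that set is measurable. *)
Lemma C0_var_le_nor k (F : set 'rV[R]_k.+1) e c :
  hausdorff k (nor (parallel_complement F e)) <= c%:E ->
  C0_var F e <= (2 * (fine (hausdorff k (esphere : set 'rV[R]_k.+1)))^-1 * c)%:E.
Proof.
set X := parallel_complement F e; set a := (_^-1)%R => hc.
have a0 : (0 <= a)%R by rewrite invr_ge0 fine_ge0// hausdorff_ge0.
have cl : continuous (lsubmx : 'rV[R]_(k.+1 + k.+1) -> 'rV[R]_k.+1).
  move=> x B /enorm_ballP[d d0 hB]; apply/enorm_ballP; exists d => // y yx; apply: hB.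
  by rewrite -raddfB; apply: le_lt_trans yx; exact: enorm_lsubmx.
have bound A : <<s [set U : set 'rV[R]_k.+1 | open U] >> A ->
    `|C0_parallel F e A| <= (2 * a)%:E * hausdorff k (nor X `&` lsubmx @^-1` A).
  move=> bA; rewrite /C0_parallel abseM abse_EFin normrX normrN1 expr1n mul1e.
  rewrite /C0 abseM abse_EFin (ger0_norm a0) mulrC EFinM -muleA.
  apply: lee_wpmul2l; rewrite ?lee_fin//.
  rewrite (_ : 2%:E * _ = hausdorff k (nor X `&` lsubmx @^-1` A) + hausdorff k (nor X `&` lsubmx @^-1` A)); last first.
    by rewrite mule_natl mule2n.
  apply: (@abs_integral_le _ (caratheodory_type (@hausdorff R (k.+1 + k.+1) k)) (@hausdorff_measure R (k.+1 + k.+1) k) (nor X) (nor X `&` lsubmx @^-1` A)).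
  - move=> z _; rewrite abse_EFin lee_fin normrM -[leRHS]mulr1.
    apply: ler_pM => //; last exact: abs_curvature_density_le1.
    by rewrite indicE; case: (_ \in _); rewrite ?normr1 ?normr0.
  - move=> z nz; rewrite indicE; case: (pselect (A (lsubmx z))) => [Az _//|Az].
    by rewrite memNset// mul0r eqxx.
  - by move=> S _ SP; exact: le_hausdorff.
apply: ge_ereal_sup => _ [A [bA tA _] <-].
apply: (@le_trans _ _ (\sum_(i <oo) (2 * a)%:E * hausdorff k (nor X `&` lsubmx @^-1` (A i)))).
  by apply: lee_nneseries => i _ *; [exact: abse_ge0|exact: bound].
rewrite nneseriesZl; last by move=> *; exact: hausdorff_ge0.
rewrite [leRHS]EFinM; apply: lee_wpmul2l; first by rewrite lee_fin mulr_ge0.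
apply: le_trans hc; apply: le_trans (@caratheodory_lime_le _ _ (@hausdorff R _ k) (fun i => lsubmx @^-1` (A i)) _ _ (nor X)).
- by rewrite leeDl// outer_measure_ge0.
- by move=> n; exact: borel_caratheodory.
- apply/trivIsetP => i j _ _ ij; rewrite -preimage_setI.
  by have /trivIsetP /(_ i j Logic.I Logic.I ij) -> := tA; rewrite preimage_set0.
Qed.

End TotalVariationUpper.

(** * The scaling exponent *)

Section LineExponent.
Context {R : realType}.

Lemma near_right0 (N P : set R) :
  (\forall e \near within (~` N) 0^'+, P e) <->
  exists2 d, 0 < d & forall e, 0 < e < d -> ~ N e -> P e.
Proof.
split.
  move=> /nbhs_ballP[d /= d0 hd]; exists d => // e /andP[e0 ed] Ne; apply: hd => //.
  by rewrite /ball /= sub0r normrN gtr0_norm.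
move=> [d d0 hd]; apply/nbhs_ballP; exists d => // e; rewrite /ball /= sub0r normrN => ed e0 Ne.
by apply: hd => //; rewrite e0 -(gtr0_norm e0).
Qed.

Lemma negligible_itv (N : set R) a b : lebesgue_measure.-negligible N -> a < b ->
  exists2 e, a < e < b & ~ N e.
Proof.
move=> [A [mA A0 NA]] ab; apply: contrapT => h.
have sub : `]a, b[ `<=` A.
  move=> e; rewrite /= in_itv /= => eab; apply: NA; apply: contrapT => Ne.
  by apply: h; exists e.
have : (lebesgue_measure (`]a, b[%classic : set R) <= 0)%E.
  by rewrite -A0; apply: le_measure; rewrite ?inE//; exact: measurable_itv.
by rewrite lebesgue_measure_itv /= lte_fin ab -EFinD lee_fin subr_le0 leNgt ab.
Qed.

Lemma closure_compact (T : set R) M : (forall t, T t -> `|t| <= M) -> compact (closure T).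
Proof.
move=> TM; apply: (subclosed_compact _ (@segment_compact R (- M) M)); first exact: closed_closure.
have cI : closed `[- M, M] by exact: itv_closed.
move: cI; rewrite closure_id => ->; apply: closure_subset => t /TM.
by rewrite ler_norml /= in_itv.
Qed.

Definition line_exponent (K : set R) : \bar R :=
  ereal_inf [set s%:E | s in [set s | gap_decay K s]].

Section OnLine.
Context {k : nat}.
Variables (x0 u : 'rV[R]_k.+1) (T : set R) (M : R).
Hypotheses (u1 : edot u u = 1) (T0 : T !=set0) (TM : forall t, T t -> `|t| <= M).
Let K := closure T.
Let F := [set x0 + t *: u | t in T].

Let cK : compact K. Proof. exact: closure_compact TM. Qed.

Let K0 : K !=set0. Proof. by have [t Tt] := T0; exists t; exact: subset_closure. Qed.

(** F need not be closed: a nearest point in the closure is approximated by points of T, at cost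
    d. *)
Lemma parallel_set_line e : parallel_set F e = [set y | line_dist x0 u K y <= e].
Proof.
apply/seteqP; split => y /=.
  rewrite /parallel_set /= => h; rewrite -lee_fin; apply: le_trans h.
  apply: le_ereal_inf_tmp => _ [_ [t Tt <-] <-]; rewrite lee_fin.
  by apply: line_dist_le => //; exact: subset_closure.
move=> ye; have [c Kc yc] := line_dist_attained x0 u1 cK K0 y.
rewrite /parallel_set /=; apply/lee_addgt0Pr => d d0.
have [t [Tt ct]] : T `&` ball c d !=set0 by apply: Kc; exact: nbhsx_ballx.
apply: (@le_trans _ _ (enorm (y - (x0 + t *: u)))%:E).
  by apply: ereal_inf_lbound; exists (x0 + t *: u) => //; exists t.
rewrite -EFinD lee_fin; apply: (le_trans (enorm_triangle _ (axis_point x0 u c) _)).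
rewrite -yc lerD// (_ : _ - _ = (c - t) *: u); last first.
  by rewrite /axis_point; apply/rowP => i; rewrite !mxE; ring.
by rewrite enormZ [enorm u](@enorm_eq _ _ _ 1) ?expr1n// mulr1 ltW.
Qed.

Lemma parallel_complement_line e : noncritical K e ->
  parallel_complement F e = [set y | e <= line_dist x0 u K y].
Proof.
by move=> he; rewrite /parallel_complement parallel_set_line (closure_outside x0 u1 cK K0 he).
Qed.

Lemma regular_value_line e : noncritical K e -> regular_value F e.
Proof.
move=> he; split; first by case: he.
  rewrite parallel_complement_line//; exact: positive_reach_outside.
rewrite parallel_set_line; exact: lipschitz_manifold_parallel.
Qed.

Let exceptional := [set e : R | exists a b, gap K a b /\ b - a = 2 * e].

Let mn : {m | K m /\ forall x, K x -> m <= x}.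
Proof. by apply: cid; have [m] := compact_has_min cK K0; exists m. Qed.

Let mx : {m | K m /\ forall x, K x -> x <= m}.
Proof. by apply: cid; have [m] := compact_has_max cK K0; exists m. Qed.

Let Kpq : K `<=` `[sval mn, sval mx].
Proof.
move=> x Kx; have [_ h1] := svalP mn; have [_ h2] := svalP mx.
by rewrite /= in_itv /= h1// h2.
Qed.

Let mn_mx : sval mn <= sval mx.
Proof. by have [_ h1] := svalP mn; have [Km _] := svalP mx; exact: h1. Qed.

Lemma exceptional_negligible : lebesgue_measure.-negligible exceptional.
Proof.
have cN := gap_lengths_countable Kpq.
exists exceptional; split => //; [exact: countable_measurable|exact: countable_lebesgue_measure0].
Qed.

Lemma noncriticalP e : 0 < e -> ~ exceptional e -> noncritical K e.
Proof. by move=> e0 h; split => // a b gab ab; apply: h; exists a, b. Qed.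

Lemma ess_lim_line s : (gap_decay K s /\ s < 1) \/ 1 < s -> ess_lim_C0_var_eq0 F s.
Proof.
move=> hs; exists exceptional; split; first exact: exceptional_negligible.
  by move=> e e0 nr; apply: contrapT => /(noncriticalP e0)/regular_value_line.
have [C C0 hC] := @nor_hausdorff_le R k.
pose a := (fine (hausdorff k (esphere : set 'rV[R]_k.+1)))^-1.
have a0 : 0 <= a by rewrite invr_ge0 fine_ge0// hausdorff_ge0.
pose A := 2 * a * (C * (6 + 4 * (sval mx - sval mn))).
have A0 : 0 <= A by rewrite !mulr_ge0 ?(ltW C0)// addr_ge0// mulr_ge0// subr_ge0.
have main t : 0 < t -> \forall e \near within (~` exceptional) 0^'+,
    (0 <= (e `^ s)%:E * C0_var F e <= (A * t)%:E)%E.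
  move=> t0; have [d d0 hd] := gap_energy_decay Kpq mn_mx hs t0.
  apply/near_right0; exists (Num.min 1 d); first by rewrite lt_min ltr01.
  move=> e /andP[e0]; rewrite lt_min => /andP[e1 ed] Ne.
  have he := noncriticalP e0 Ne.
  have es0 : 0 < e `^ s by rewrite powR_gt0.
  have est : e `^ s <= t.
    have := hd e 1; rewrite e0 ed => /(_ isT ltr01); apply: le_trans.
    by rewrite ler_peMr ?(ltW es0)// lerDl (gap_energy_ge0 Kpq).
  have tv0 : (0 <= C0_var F e)%E.
    have := @total_variation_ge _ _ (C0_parallel F e) (fun=> set0) 0; rewrite big_ord0; exact.
  apply/andP; split; first by rewrite mule_ge0// lee_fin ltW.
  (* The energy bound of [hd] in the form required by [hC]; multiplied by e ^ s, the result is a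
     multiple of 3t + (3 + 4 (mx - mn)) e ^ s, where e ^ s <= t. *)
  have hB h : 0 < h -> gap_energy K e h <= t / e `^ s - 1.
    move=> h0; rewrite lerBrDl ler_pdivlMr// mulrC; apply: hd => //; by rewrite e0.
  have := hC x0 u K e (sval mn) (sval mx) _ u1 cK he (ltW e1) (proj1 (svalP mn)) (proj1 (svalP mx)) _ hB.
  have Kb x : K x -> sval mn <= x <= sval mx.
    by move=> Kx; have := Kpq Kx; rewrite /= in_itv.
  move=> /(_ Kb); rewrite -(parallel_complement_line he) => /C0_var_le_nor h.
  apply: (le_trans (lee_wpmul2l _ h)); first by rewrite lee_fin ltW.
  rewrite -EFinM lee_fin -/a.
  have -> : e `^ s * (2 * a * (C * (6 + 4 * (sval mx - sval mn) + 3 * (t / e `^ s - 1)))) =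
      2 * a * (C * (3 * t + (3 + 4 * (sval mx - sval mn)) * e `^ s)).
    by field; rewrite gt_eqF.
  rewrite /A -!mulrA; apply: ler_wpM2l => //; apply: ler_wpM2l => //; apply: ler_wpM2l; first exact: ltW.
  have : (3 + 4 * (sval mx - sval mn)) * e `^ s <= (3 + 4 * (sval mx - sval mn)) * t.
    by apply: ler_wpM2l => //; rewrite addr_ge0// mulr_ge0// subr_ge0.
  lra.
apply/fine_cvgP; split.
  near=> e; have : (0 <= (e `^ s)%:E * C0_var F e <= (A * 1)%:E)%E by near: e; exact: main.
  by move=> /andP[h1 h2]; rewrite ge0_fin_numE// (le_lt_trans h2) ?ltry.
apply/cvgrPdist_le => t t0; near=> e.
have : (0 <= (e `^ s)%:E * C0_var F e <= (A * (t / (A + 1)))%:E)%E.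
  by near: e; apply: main; rewrite divr_gt0// ltr_wpDl.
move=> /andP[h1 h2]; rewrite sub0r normrN /= ger0_norm ?fine_ge0//.
rewrite -lee_fin fineK; last by rewrite ge0_fin_numE// (le_lt_trans h2) ?ltry.
apply: (le_trans h2); rewrite lee_fin mulrCA ler_piMr ?(ltW t0)//.
by rewrite ler_pdivrMr ?ltr_wpDl// mul1r lerDl.
Unshelve. all: by end_near.
Qed.

(* The lower bound is available off a null set only; as the gap count is monotone,
   it suffices to use it at one value between e / 2 and e. *)
Lemma gap_decay_of_ess_lim s : 0 <= s -> ess_lim_C0_var_eq0 F s -> gap_decay K s.
Proof.
move=> s0 [N [nN _ cvg0]]; split => // t t0.
have [c c0 hc] := @C0_var_lower R k.
have p2 : 0 < 2 `^ s :> R by rewrite powR_gt0.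
(* c is the constant of the lower bound, and 2 ^ s pays for replacing e by some e' > e / 2. *)
pose t' := c * t / 2 `^ s.
have t'0 : 0 < t' by rewrite divr_gt0// mulr_gt0.
have : \forall e \near within (~` N) 0^'+, ((e `^ s)%:E * C0_var F e < t'%:E)%E.
  by apply: (cvg0 [set x | (x < t'%:E)%E]); apply: open_ereal_lt'; rewrite lte_fin.
move=> /near_right0[d d0 hd]; exists (Num.min 1 d); first by rewrite lt_min ltr01.
move=> e /andP[e0]; rewrite lt_min => /andP[e1 ed].
have nN' : lebesgue_measure.-negligible (N `|` exceptional).
  by apply: negligibleU => //; exact: exceptional_negligible.
have [|e' /andP[ee' e'e] /not_orP[Ne' He']] := @negligible_itv _ (e / 2) e nN'; first lra.
have e'0 : 0 < e' by apply: lt_trans ee'; rewrite divr_gt0.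
have he' := noncriticalP e'0 He'.
have es : e `^ s <= 2 `^ s * e' `^ s.
  rewrite -powRM ?(ltW e'0)//; apply: ge0_ler_powR; rewrite ?nnegrE ?mulr_ge0 ?(ltW e0) ?(ltW e'0)//; lra.
have cnt : (gap_count K (2 * e)%R <= gap_count K (2 * e')%R)%N.
  by apply: (gap_count_antitone Kpq); [rewrite mulr_gt0|rewrite ler_pM2l// ltW].
have h1 := hc x0 u K F e' u1 cK K0 he' (ltW (lt_trans e'e e1)) (parallel_set_line e').
have h2 : (e' `^ s * (c * (1 + (gap_count K (2 * e'))%:R)) <= t').
  rewrite -lee_fin EFinM; apply: le_trans (ltW (hd e' _ Ne')); last by rewrite e'0 (lt_trans e'e).
  by apply: lee_wpmul2l => //; rewrite lee_fin powR_ge0.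
apply: (@le_trans _ _ ((2 `^ s * e' `^ s) * (1 + (gap_count K (2 * e'))%:R))).
  by apply: ler_pM => //; rewrite ?powR_ge0 ?addr_ge0// lerD2l ler_nat.
rewrite -(ler_pM2l c0) -[leRHS](divfK (lt0r_neq0 p2)) -/t'.
apply: (@le_trans _ _ (e' `^ s * (c * (1 + (gap_count K (2 * e')%R)%:R)) * 2 `^ s)); last by rewrite ler_pM2r.
by rewrite le_eqVlt; apply/orP; left; apply/eqP; ring.
Qed.

Lemma scaling_exponent_line : scaling_exponent F = line_exponent K.
Proof.
apply: le_anti; apply/andP; split; last first.
  by apply: ereal_inf_le_tmp => _ [s [s0 hs] <-]; exists s => //; exact: gap_decay_of_ess_lim.
apply: le_ereal_inf_tmp => _ [s hs <-]; have [s0 _] := hs.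
have [s1|s1] := ltP s 1.
  by apply: ereal_inf_lbound; exists s => //; split => //; apply: ess_lim_line; left.
(* [ess_lim_line] leaves out s = 1; for the infimum it is enough to reach every s + d > 1. *)
apply/lee_addgt0Pr => d d0; apply: ereal_inf_lbound; exists (s + d) => //.
split; first by rewrite addr_ge0// ltW.
by apply: ess_lim_line; right; lra.
Qed.

End OnLine.

Lemma bounded_line (d : nat) (F : set 'rV[R]_d) : bounded_set F ->
  is_affine_subspace 1 (affine_hull F) ->
  exists (f w : 'rV[R]_d) (T : set R) (M : R),
  [/\ edot w w = 1, T 0, forall t, T t -> `|t| <= M & F = [set f + t *: w | t in T]].
Proof.
move=> bF [p [V [V1 hull]]].
have hullF : F `<=` affine_hull F.
  move=> x Fx; exists 1%N, (fun=> 1), (fun=> x); split => //; rewrite big_ord1 ?scale1r//.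
have [f Ff] : F !=set0.
  have : affine_hull F p by rewrite hull; exists 0; rewrite ?addr0//=; exact: mem0v.
  case=> -[|n] [c [x [Fx c1 _]]]; last by exists (x ord0).
  by move: c1; rewrite big_ord0 => /eqP; rewrite eq_sym oner_eq0.
have [v v0 Vv] : exists2 v, v != 0 & V = <[v]>%VS.
  exists (vpick V); first by rewrite vpick0 -dimv_eq0 V1.
  apply/eqP; rewrite eq_sym eqEdim V1 dim_vline vpick0 -dimv_eq0 V1 /= andbT.
  by rewrite -memvE memv_pick.
have nv : 0 < enorm v by exact: enorm_gt0.
pose w := (enorm v)^-1 *: v.
have ww : edot w w = 1.
  by rewrite /w edotZl edotZr -enorm_sqr expr2 mulKf ?mulVf// gt_eqF.
have wn : enorm w = 1 by apply: enorm_eq; rewrite ?expr1n.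
have onl x : F x -> exists t, x = f + t *: w.
  move=> Fx; have := hullF _ Fx; have := hullF _ Ff; rewrite hull Vv.
  move=> [a /= /vlineP[ta ->] <-] [b /= /vlineP[tb ->] <-].
  exists ((tb - ta) * enorm v); rewrite /w scalerA mulfK ?gt_eqF// scalerBl.
  by rewrite -addrA [_ *: v + _]addrC subrK.
have [B [_ hB]] := bF; have {}hB x : F x -> `|x| <= B + 1 by apply: hB; rewrite ltrDl.
exists f, w, [set t | F (f + t *: w)], (d%:R * (B + 1) + enorm f); split => //=.
- by rewrite scale0r addr0.
- move=> t Ft; have -> : `|t| = enorm (f + t *: w - f) by rewrite addrC addKr enormZ wn mulr1.
  apply: (le_trans (enormD _ _)); rewrite enormN lerD2r; apply: (le_trans (enorm_le_normr _)).
  by rewrite ler_wpM2l// hB.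
- by apply/seteqP; split => [x Fx|_ [t Ft <-]//]; have [t xE] := onl x Fx; exists t; rewrite /= -?xE.
Qed.

(** The isometry is not assumed affine: the distances from x to the preimages x0 and x1 give (x -
    x0, x1 - x0) = t t1, the case of equality in Cauchy-Schwarz, which places x on the line through
    x0 and x1. *)
Lemma chart_line (k d : nat) (f w : 'rV[R]_d) (T : set R) (phi : 'rV[R]_k.+1 -> 'rV[R]_d) :
  edot w w = 1 -> T 0 -> isometric_chart [set f + t *: w | t in T] phi ->
  exists x0 u : 'rV[R]_k.+1, edot u u = 1 /\
    phi @^-1` [set f + t *: w | t in T] = [set x0 + t *: u | t in T].
Proof.
move=> ww T0 [_ Fr iso]; have wn : enorm w = 1 by apply: enorm_eq; rewrite ?expr1n.
have pre t : T t -> exists x, phi x = f + t *: w.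
  by move=> Tt; have [|x _ <-] := Fr (f + t *: w); [exists t|exists x].
have [x0 x0E] := pre 0 T0; rewrite scale0r addr0 in x0E.
have dist t x : phi x = f + t *: w -> edot (x - x0) (x - x0) = t ^+ 2.
  by move=> xE; rewrite -enorm_sqr -iso xE x0E addrC addKr enormZ wn mulr1 real_normK ?num_real.
suff [u uu hu] : exists2 u : 'rV[R]_k.+1, edot u u = 1 &
    forall t x, T t -> phi x = f + t *: w -> x = x0 + t *: u.
  exists x0, u; split => //; apply/seteqP; split => [x [t Tt tE]|_ [t Tt <-]].
    by exists t => //; rewrite -(hu t x).
  by exists t => //; have [x xE] := pre t Tt; rewrite -(hu t x Tt xE).
(* If T contains only 0, any unit vector serves. *)
have [[t1 [Tt1 t10]]|T1] := pselect (exists t, T t /\ t != 0); last first.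
  exists (delta_mx 0 ord0) => [|t x Tt xE].
    rewrite /edot (bigD1 ord0)//= !mxE !eqxx mulr1 big1 ?addr0// => j ji.
    by rewrite !mxE (negPf ji) andbF mulr0.
  have t0 : t = 0 by apply/eqP/negPn/negP => t0; apply: T1; exists t.
  have := dist t x xE; rewrite t0 expr0n /= scale0r addr0 => /edot_eq0 /eqP.
  by rewrite subr_eq0 => /eqP.
have [x1 x1E] := pre t1 Tt1; have d1 := dist _ _ x1E.
exists (t1^-1 *: (x1 - x0)) => [|t x Tt xE].
  by rewrite edotZl edotZr d1; field.
have dx := dist t x xE.
have dx1 : edot (x - x1) (x - x1) = (t - t1) ^+ 2.
  rewrite -enorm_sqr -iso xE x1E (_ : _ - _ = (t - t1) *: w).
    by rewrite enormZ wn mulr1 real_normK ?num_real.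
  by apply/rowP => i; rewrite !mxE; ring.
have [v vE] : exists v, v = x - x0 by eexists.
have [v1 v1E] : exists v1, v1 = x1 - x0 by eexists.
rewrite -vE in dx; rewrite -v1E in d1 *.
have xx1 : x - x1 = v - v1 by rewrite vE v1E; apply/rowP => i; rewrite !mxE; ring.
have vv1 : edot v v1 = t * t1.
  by move: dx1; rewrite xx1 !edotE dx d1 (edotC v1 v); lra.
have /edot_eq0/eqP : edot (v - t *: (t1^-1 *: v1)) (v - t *: (t1^-1 *: v1)) = 0.
  by rewrite !edotE (edotC v1 v) vv1 dx d1; field.
rewrite subr_eq0 => /eqP h; by rewrite -h vE addrC subrK.
Qed.

End LineExponent.

Unset Implicit Arguments.

Theorem proposition4p10 (R : realType) (d : nat) (F : set 'rV[R]_d)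
  (hbounded : bounded_set F)
  (hdim : is_affine_subspace 1 (affine_hull F))
  (l l' : nat) (hl : (1 <= l <= d)%N) (hl' : (1 <= l' <= d)%N)
  (phi : 'rV[R]_l -> 'rV[R]_d) (hphi : isometric_chart F phi)
  (phi' : 'rV[R]_l' -> 'rV[R]_d) (hphi' : isometric_chart F phi') :
  scaling_exponent (phi @^-1` F) = scaling_exponent (phi' @^-1` F).
Proof.
have [f [w [T [M [ww T0 TM FE]]]]] := bounded_line hbounded hdim.
suff main n (psi : 'rV[R]_n -> 'rV[R]_d) : (0 < n)%N -> isometric_chart F psi ->
    scaling_exponent (psi @^-1` F) = line_exponent (closure T).
  by rewrite !main//; [case/andP: hl'|case/andP: hl].
case: n psi => [//|k] psi _; rewrite FE => /(chart_line ww T0)[x0 [u [uu ->]]].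
by apply: (scaling_exponent_line _ uu _ TM); exists 0.
Qed.
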